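(* Let $k$ be an algebraically closed field and let $S$ be a numerical semigroup that is special (over $k$). Then $S$ is not a Weierstrass semigroup over $k$; that is, there is no smooth projective curve $X$ over $k$ with a point $p\in X$ such that $S$ is the set of pole orders at $p$ of rational functions on $X$ that are regular on $X\setminus\{p\}$.
   Context: A numerical semigroup is a subset $S\subset \mathbb{Z}_{\ge 0}$ with finite complement, containing $0$ and closed under addition. The semigroup ring is $k[S]=k[t^S]:=k[t^s\mid s\in S]\subset k[t]$, graded by $\deg t^s=s$. If $s_0<\dots<s_u$ are the minimal generators of $S$, write $k[S]=P_0/I_0$ with $P_0=k[x_0,\dots,x_u]$ graded by $\deg x_i=s_i$. Weierstrass: $S$ is a Weierstrass semigroup over $k$ if it is the semigroup of pole orders at $p$ of rational functions regular on $X\setminus\{p\}$ for some point $p$ of a smooth projective (connected) curve $X$ over $k$. (For $k=\mathbb{C}$, $X$ is a compact Riemann surface.) Flat positively graded deformation of $k[S]$: a finitely generated positively graded $k$-algebra $A$ with $A_0=k$, and a graded flat $A$-algebra $B=P/I$, where $P=A[x_0,\dots,x_u]$ with $\deg x_i=s_i$ and $I$ is a homogeneous ideal, such that $B/A_{+}B\cong k[S]$ as graded algebras (compatibly with the generators $x_i$). Special resolution: a minimal (graded) free resolution $$P\xleftarrow{\ \phi_1\ }P^6\xleftarrow{\ \phi_2\ }P^8\xleftarrow{\ \phi_3\ }P^3\leftarrow 0$$ over $P$ is special of format $\{1,6,8,3\}$ if it admits an acyclic subcomplex $$P\xleftarrow{\ \phi_1'\ }P^4\xleftarrow{\ \phi_2'\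 }P^4\xleftarrow{\ \phi_3'\ }P\leftarrow 0$$ that is, term by term, a (graded) direct summand of it. In matrix terms: for suitable (homogeneous) bases, the last 4 entries of the first column of the $8\times 3$ matrix $\phi_3$ are zero and $\phi_3'$ consists of the first 4 entries of that column; the 5th and 6th rows of the first 4 columns of the $6\times 8$ matrix $\phi_2$ are zero, and $\phi_2'$ is the $4\times4$ submatrix of the first 4 rows and columns of $\phi_2$; $\phi_1'$ consists of the first 4 entries of $\phi_1$; and the resulting complex is acyclic (its homology vanishes except at the leftmost term). Special semigroup: $S$ is special (over $k$) if for every flat positively graded deformation $B=P/I$ of $k[S]$ the minimal graded free resolution of $B$ over $P$ is special of format $\{1,6,8,3\}$. *)

(* Defs.v *)
From HB Require Import structures.
From mathcomp Require Import all_boot all_order all_algebra.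
From mathcomp Require Import sesquilinear.
From mathcomp Require Import mpoly.

Set Implicit Arguments.
Unset Strict Implicit.
Unset Printing Implicit Defensive.

Import GRing.Theory.
Local Open Scope ring_scope.

(** * Numerical semigroups *)

Definition numerical_semigroup (S : pred nat) : Prop :=
  [/\ S 0%N,
      forall a b, S a -> S b -> S (a + b)%N
    & exists c, forall n, (c <= n)%N -> S n].

Definition generated_by (s : seq nat) (n : nat) : Prop :=
  exists c : nat -> nat, n = (\sum_(a <- s) c a * a)%N.

Definition minimal_generators (S : pred nat) (s : seq nat) : Prop :=
  [/\ sorted ltn s,
      forall n, S n <-> generated_by s n
    & forall a, a \in s -> ~ (forall n, S n -> generated_by (rem a s) n)].

(** * Gradings over the nonnegative integers *)

Record grading (k : fieldType) (A : comAlgType k) := Grading {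
  homog_part :> nat -> A -> Prop;
  homog_part0 : forall i, homog_part i 0;
  homog_partP : forall i (c : k) a b,
    homog_part i a -> homog_part i b -> homog_part i (c *: a + b);
  homog_part_one : homog_part 0%N 1;
  homog_partM : forall i j a b,
    homog_part i a -> homog_part j b -> homog_part (i + j)%N (a * b);
  homog_part_span : forall a, exists N (c : nat -> A),
    (forall i, homog_part i (c i)) /\ a = \sum_(i < N) c i;
  homog_part_free : forall N (c : nat -> A),
    (forall i, homog_part i (c i)) -> \sum_(i < N) c i = 0 ->
    forall i, (i < N)%N -> c i = 0
}.

(* The span V_+ of the homogeneous elements of positive degree of V, where
   [hom d] is the degree d part. *)
Definition positive_part (V : nmodType) (hom : nat -> V -> Prop) (v : V) :=
  exists N (c : nat -> V),
    (forall i, hom i.+1 (c i)) /\ v = \sum_(i < N) c i.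

Definition homogeneous_ideal (P : comNzRingType) (hom : nat -> P -> Prop)
    (I : P -> Prop) : Prop :=
  forall f, I f -> exists N (c : nat -> P),
    (forall i, hom i (c i) /\ I (c i)) /\ f = \sum_(i < N) c i.

Definition finitely_generated (k : fieldType) (A : comAlgType k) : Prop :=
  exists m (f : {lrmorphism {mpoly k[m]} -> A}), forall a, exists p, f p = a.

Section WeightedPolynomials.
Variables (k : fieldType) (A : comAlgType k) (gr : grading A).
Variables (n : nat) (s : n.-tuple nat).

Definition wdeg (m : 'X_{1.. n}) : nat := (\sum_(i < n) tnth s i * m i)%N.

(* The grading of A[x_0, .., x_(n-1)] with deg x_i = s_i. *)
Definition phomog (d : nat) (f : {mpoly A[n]}) : Prop :=
  forall m, if (wdeg m <= d)%N then gr (d - wdeg m)%N f@_m else f@_m = 0.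

(* phi is a degree 0 map (+)_j P(- dc j) -> (+)_i P(- dr i). *)
Definition homogeneous_mx (p q : nat) (dr : 'I_p -> nat) (dc : 'I_q -> nat)
    (phi : 'M[{mpoly A[n]}]_(p, q)) : Prop :=
  forall i j, if (dr i <= dc j)%N then phomog (dc j - dr i)%N (phi i j)
              else phi i j = 0.

Definition minimal_mx (p q : nat) (phi : 'M[{mpoly A[n]}]_(p, q)) : Prop :=
  forall i j, positive_part phomog (phi i j).

End WeightedPolynomials.

(** * Flatness *)

(* The element \sum_((m, b) <- z) m (x) b of the tensor product M (x)_A B
   vanishes: by the universal property, this means that every bilinear map
   sends it to 0. *)
Definition tensor_eq0 (A : comNzRingType) (M B : lmodType A)
    (z : seq (M * B)) : Prop :=
  forall (T : lmodType A) (beta : {bilinear M -> B -> T}),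
    \sum_(x <- z) beta x.1 x.2 = 0.

Definition flat (A : comNzRingType) (B : lmodType A) : Prop :=
  forall (M N : lmodType A) (f : {linear M -> N}), injective f ->
  forall z : seq (M * B),
    tensor_eq0 [seq (f x.1, x.2) | x <- z] -> tensor_eq0 z.

(** * Flat positively graded deformations of k[S] *)

(* B is presented as P/I by a surjective A-algebra morphism pi with kernel I;
   rho : B -> k[t] has image k[S] and kernel A_+ B, that is, it induces the
   isomorphism B / A_+ B ~ k[S]. *)
Definition flat_graded_deformation (k : fieldType) (S : pred nat)
    (n : nat) (s : n.-tuple nat) (A : comAlgType k) (gr : grading A)
    (B : comAlgType A) (pi : {lrmorphism {mpoly A[n]} -> B}) : Prop :=
  [/\ finitely_generated A,
      (forall a, gr 0%N a -> exists c : k, a = c%:A),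
      (forall b, exists f, pi f = b),
      homogeneous_ideal (phomog gr s) (fun f => pi f = 0)
    & flat B] /\
  exists rho : {rmorphism B -> {poly k}},
  [/\ (forall (c : k) b, rho (c%:A *: b) = c *: rho b),
      (forall i, rho (pi 'X_i) = 'X^(tnth s i)),
      (forall d f, phomog gr s d f -> exists c, rho (pi f) = c *: 'X^d),
      (forall q : {poly k},
         (exists b, rho b = q) <-> (forall i, q`_i != 0 -> S i))
    & (forall b, rho b = 0 <->
         exists r (a : 'I_r -> A) (c : 'I_r -> B),
           (forall i, positive_part gr (a i)) /\ b = \sum_i a i *: c i)].

(** * Special resolutions *)

Definition exact_at (P : comNzRingType) (l m n : nat)
    (phi : 'M[P]_(l, m)) (psi : 'M[P]_(m, n)) : Prop :=
  forall v : 'cV[P]_m, phi *m v = 0 <-> exists w : 'cV[P]_n, v = psi *m w.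

Definition injective_mx (P : comNzRingType) (m n : nat) (phi : 'M[P]_(m, n)) :=
  forall v : 'cV[P]_n, phi *m v = 0 -> v = 0.

Definition acyclic3 (P : comNzRingType) (a b c d : nat) (phi1 : 'M[P]_(a, b))
    (phi2 : 'M[P]_(b, c)) (phi3 : 'M[P]_(c, d)) : Prop :=
  [/\ exact_at phi1 phi2, exact_at phi2 phi3 & injective_mx phi3].

Section Resolutions.
Variables (k : fieldType) (A : comAlgType k) (gr : grading A).
Variables (n : nat) (s : n.-tuple nat).
Local Notation P := {mpoly A[n]}.

Definition minimal_graded_free_resolution (I : P -> Prop) (b1 b2 b3 : nat)
    (phi1 : 'M[P]_(1, b1)) (phi2 : 'M[P]_(b1, b2)) (phi3 : 'M[P]_(b2, b3)) :=
  [/\ acyclic3 phi1 phi2 phi3,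
      (forall f, I f <-> exists w : 'cV[P]_b1, f%:M = phi1 *m w),
      (exists (d1 : 'I_b1 -> nat) (d2 : 'I_b2 -> nat) (d3 : 'I_b3 -> nat),
        [/\ homogeneous_mx gr s (fun=> 0%N) d1 phi1,
            homogeneous_mx gr s d1 d2 phi2
          & homogeneous_mx gr s d2 d3 phi3])
    & [/\ minimal_mx gr s phi1, minimal_mx gr s phi2 & minimal_mx gr s phi3]].

(* The bases are adapted: the complex P <- P^4 <- P^4 <- P is spanned by the
   first 4, 4 and 1 basis vectors of P^6, P^8 and P^3. *)
Definition special_form (phi1 : 'M[P]_(1, 4 + 2)) (phi2 : 'M[P]_(4 + 2, 4 + 4))
    (phi3 : 'M[P]_(4 + 4, 1 + 2)) : Prop :=
  [/\ dlsubmx phi3 = 0, dlsubmx phi2 = 0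
    & acyclic3 (lsubmx phi1) (ulsubmx phi2) (ulsubmx phi3)].

(* Minimal graded free resolutions of P/I are isomorphic to one another, and a
   change of homogeneous bases turns one into another one; the choice of
   suitable bases is therefore part of the choice of the matrices. *)
Definition special_quotient (I : P -> Prop) : Prop :=
  exists (phi1 : 'M[P]_(1, 4 + 2)) (phi2 : 'M[P]_(4 + 2, 4 + 4))
         (phi3 : 'M[P]_(4 + 4, 1 + 2)),
    minimal_graded_free_resolution I phi1 phi2 phi3 /\
    special_form phi1 phi2 phi3.

End Resolutions.

Definition special_semigroup (k : fieldType) (S : pred nat) : Prop :=
  exists n (s : n.-tuple nat), minimal_generators S s /\
  forall (A : comAlgType k) (gr : grading A) (B : comAlgType A)
         (pi : {lrmorphism {mpoly A[n]} -> B}),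
    flat_graded_deformation S s gr pi ->
    special_quotient gr s (fun f => pi f = 0).

(** * Projective varieties over an algebraically closed field *)

(* Points of P^N are given by nonzero vectors of homogeneous coordinates, and
   subsets of P^N by the predicates on coordinate vectors that hold exactly at
   the coordinates of their points. *)
Section ProjectiveVarieties.
Variables (k : closedFieldType) (N : nat).
Local Notation vec := 'rV[k]_N.+1.
Local Notation poly := {mpoly k[N.+1]}.

Definition ev (f : poly) (x : vec) : k := f.@[x 0].

Definition same_point (x y : vec) : Prop := exists2 c : k, c != 0 & y = c *: x.

Definition proj_closed (Z : vec -> Prop) : Prop :=
  exists F : poly -> Prop,
    (forall f, F f -> exists d, f \is d.-homog) /\
    (forall x, Z x <-> x != 0 /\ forall f, F f -> ev f x = 0).

Definition proj_irreducible (Z : vec -> Prop) : Prop :=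
  (exists x, Z x) /\
  forall Z1 Z2, proj_closed Z1 -> proj_closed Z2 ->
    (forall x, Z x -> Z1 x \/ Z2 x) ->
    (forall x, Z x -> Z1 x) \/ (forall x, Z x -> Z2 x).

Definition proj_variety (X : vec -> Prop) : Prop :=
  proj_closed X /\ proj_irreducible X.

Definition irreducible_chain (X : vec -> Prop) (d : nat) : Prop :=
  exists Z : nat -> vec -> Prop,
    (forall i, (i <= d)%N -> proj_variety (Z i) /\ forall x, Z i x -> X x) /\
    (forall i, (i < d)%N ->
       (forall x, Z i x -> Z i.+1 x) /\ exists x, Z i.+1 x /\ ~ Z i x).

Definition proj_dim (X : vec -> Prop) (d : nat) : Prop :=
  irreducible_chain X d /\ ~ irreducible_chain X d.+1.

Definition vanishes_on (X : vec -> Prop) (f : poly) : Prop :=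
  forall x, X x -> ev f x = 0.

Definition homog_ideal_generators (X : vec -> Prop) (m : nat)
    (F : 'I_m -> poly) : Prop :=
  (forall i, vanishes_on X (F i) /\ exists d, F i \is d.-homog) /\
  (forall f d, f \is d.-homog -> vanishes_on X f ->
     exists g : 'I_m -> poly, f = \sum_i g i * F i).

(* Jacobian criterion, in homogeneous coordinates. *)
Definition smooth_of_dim (X : vec -> Prop) (d : nat) : Prop :=
  exists m (F : 'I_m -> poly), homog_ideal_generators X F /\
  forall x, X x ->
    (\rank (\matrix_(i < m, j < N.+1) ev (F i)^`M(j) x) + d = N)%N.

Definition smooth_projective_curve (X : vec -> Prop) : Prop :=
  [/\ proj_variety X, proj_dim X 1 & smooth_of_dim X 1].

(** Rational functions on X are represented by fractions phi.1 / phi.2. *)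

Definition rational_function (X : vec -> Prop) (phi : poly * poly) : Prop :=
  (exists d, phi.1 \is d.-homog /\ phi.2 \is d.-homog) /\
  ~ vanishes_on X phi.2.

Definition eq_rational (X : vec -> Prop) (phi psi : poly * poly) : Prop :=
  vanishes_on X (phi.1 * psi.2 - psi.1 * phi.2).

Definition mul_rational (phi psi : poly * poly) : poly * poly :=
  (phi.1 * psi.1, phi.2 * psi.2).

Definition exp_rational (phi : poly * poly) (e : nat) : poly * poly :=
  (phi.1 ^+ e, phi.2 ^+ e).

Definition defined_by (X : vec -> Prop) (x : vec) (phi psi : poly * poly) :=
  [/\ rational_function X psi, eq_rational X phi psi & ev psi.2 x != 0].

Definition regular_at (X : vec -> Prop) (x : vec) (phi : poly * poly) : Prop :=
  exists psi, defined_by X x phi psi.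

Definition zero_at (X : vec -> Prop) (x : vec) (phi : poly * poly) : Prop :=
  exists2 psi, defined_by X x phi psi & ev psi.1 x = 0.

Definition unit_at (X : vec -> Prop) (x : vec) (phi : poly * poly) : Prop :=
  exists2 psi, defined_by X x phi psi & ev psi.1 x != 0.

(* tau generates the maximal ideal of the local ring of X at x. *)
Definition uniformizer (X : vec -> Prop) (x : vec) (tau : poly * poly) :=
  [/\ rational_function X tau, zero_at X x tau
    & forall phi, rational_function X phi -> zero_at X x phi ->
        exists psi, [/\ rational_function X psi, regular_at X x psi
                      & eq_rational X phi (mul_rational tau psi)]].

Definition pole_order (X : vec -> Prop) (x : vec) (phi : poly * poly)
    (e : nat) : Prop :=
  exists2 tau, uniformizer X x tau &
    unit_at X x (mul_rational phi (exp_rational tau e)).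

Definition regular_away_from (X : vec -> Prop) (p : vec) (phi : poly * poly) :=
  forall x, X x -> ~ same_point p x -> regular_at X x phi.

End ProjectiveVarieties.

Definition weierstrass_semigroup (k : closedFieldType) (S : pred nat) : Prop :=
  exists (N : nat) (X : 'rV[k]_N.+1 -> Prop) (p : 'rV[k]_N.+1),
    [/\ smooth_projective_curve X, X p
      & forall e, S e <-> exists phi,
          [/\ rational_function X phi, regular_away_from X p phi
            & pole_order X p phi e]].

(* Main.v *)
Require Import Defs.
From HB Require Import structures.
From mathcomp Require Import all_boot all_order all_algebra.
From mathcomp Require Import ring_quotient sesquilinear mpoly.
From mathcomp Require Import zify ring.
From Stdlib Require Import Classical ClassicalEpsilon.

(* Suppose that S is the set of pole orders at p of the functions on X that are
   regular away from p.  Filtering the ring R of these functions by the pole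
   order gives a deformation B = P/I of k[S] over k[z], the Rees algebra, whose
   fibre at z = 1 is the normal domain R.  Take a special resolution of B, and
   let y in P^4 be the matrix phi3'.  Multiplication by an element of I is
   homotopic to 0 on the resolution, hence I is contained in the ideal (y).  The
   depth of B rules out n <= 3 generators, so the 4 homogeneous equations y = 0
   in n + 1 > 4 variables have a common zero x other than the origin.  It lies
   on Spec B, which has a tangent space of dimension at most 2 there: off the
   fibre z = 0 because R is normal, on it because k[S] is smooth away from the
   origin.  So I contains n - 1 functions with independent differentials at x.
   At x, the homotopies for these functions and the derivatives of phi1, phi2,
   phi3 satisfy Clifford relations.  They give n - 1 <= 3 because phi3' vanishes
   at x; applied to the subcomplex, they put every relation between the
   differentials at x of the 4 entries of phi1' in the image of phi2'(x).  But
   phi2'(x) = 0, and 4 differentials in a space of dimension 3 are dependent. *)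

Set Implicit Arguments.
Unset Strict Implicit.
Unset Printing Implicit Defensive.

Import GRing.Theory.
Local Open Scope ring_scope.

(** * Ideals *)

(** Geometrically, Spec B is a surface that is smooth away from the origin, so near the point x it
    is cut out by n - 1 = 3 equations with independent differentials, and the resolution is there a
    Koszul complex plus trivial summands. This leaves no room for a subcomplex of ranks 1, 4, 4, 1
    whose last map vanishes at x. Localization is avoided: only the values and first derivatives of
    the matrices at x are used, and the Koszul structure survives as an action on Tor(P/I, k).
    Homotopies raise the degree, derivatives lower it, and their anticommutator is the scalar d f.
    Hence lowering is injective on what raising kills, and conversely.

    The family over k[z] replaces the curve for two reasons: being special is a condition on graded
    deformations, and homogeneity in positive degrees is what forces y to have a common zero; on an
    affine fibre y could generate the unit ideal. The format enters through its numbers: 4 entries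
    of y against n + 1 variables, 6 generators against 4 so that I is not (y), and length 3 against
    the number of equations. *)

Lemma exists_minimal (Q : nat -> Prop) :
  (exists n, Q n) -> exists2 n, Q n & forall m, Q m -> (n <= m)%N.
Proof.
case=> n Qn; apply: NNPP => noQ.
have: forall m, ~ Q m.
  move=> m; elim/ltn_ind: m => m IH Qm; apply: noQ; exists m => // l Ql.
  by rewrite leqNgt; apply/negP => /IH.
by move/(_ n).
Qed.

Lemma ord_choice (n : nat) (T : Type) (Q : 'I_n -> T -> Prop) :
  (forall i, exists x, Q i x) -> exists f, forall i, Q i (f i).
Proof.
move=> h; exists (fun i => proj1_sig (constructive_indefinite_description _ (h i))).
by move=> i; case: constructive_indefinite_description.
Qed.

Section Ideals.
Variable R : comNzRingType.
Implicit Types (J K : R -> Prop).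

Definition ideal J : Prop :=
  [/\ J 0, forall a b, J a -> J b -> J (a + b) & forall a b, J b -> J (a * b)].

Definition prime_ideal J : Prop :=
  [/\ ideal J, ~ J 1 & forall a b, J (a * b) -> J a \/ J b].

Definition noetherian : Prop :=
  forall J : nat -> R -> Prop, (forall i, ideal (J i)) ->
    (forall i a, J i a -> J i.+1 a) ->
  exists m, forall i a, J i a -> J m a.

Definition adjoin J (g : R) (a : R) : Prop := exists b, J (a - b * g).

Lemma ideal0 J : ideal J -> J 0. Proof. by case. Qed.
Lemma idealD J : ideal J -> forall a b, J a -> J b -> J (a + b).
Proof. by case. Qed.
Lemma idealM J : ideal J -> forall a b, J b -> J (a * b). Proof. by case. Qed.
Lemma idealMl J : ideal J -> forall a b, J a -> J (a * b).
Proof. by move=> IJ a b Ja; rewrite mulrC; apply: idealM. Qed.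
Lemma idealN J : ideal J -> forall a, J a -> J (- a).
Proof. by move=> IJ a Ja; rewrite -mulN1r; apply: idealM. Qed.
Lemma idealB J : ideal J -> forall a b, J a -> J b -> J (a - b).
Proof. by move=> IJ a b Ja Jb; apply: idealD => //; apply: idealN. Qed.
Lemma ideal_sum J : ideal J -> forall (I : Type) (r : seq I) (P : pred I) F,
  (forall i, P i -> J (F i)) -> J (\sum_(i <- r | P i) F i).
Proof.
by move=> IJ I r P F h; elim/big_ind: _; [exact: ideal0 | exact: idealD | exact: h].
Qed.
Lemma adjoin_ideal J g : ideal J -> ideal (adjoin J g).
Proof.
move=> IJ; split.
- by exists 0; rewrite mul0r subrr; apply: ideal0.
- move=> a b [c Jc] [d Jd]; exists (c + d).
  by rewrite mulrDl opprD addrACA; apply: idealD.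
- by move=> a b [c Jc]; exists (a * c); rewrite -mulrA -mulrBr; apply: idealM.
Qed.

Lemma adjoin_sub J g a : J a -> adjoin J g a.
Proof. by move=> Ja; exists 0; rewrite mul0r subr0. Qed.

Lemma adjoin_gen J g : ideal J -> adjoin J g g.
Proof. by move=> IJ; exists 1; rewrite mul1r subrr; apply: ideal0. Qed.

Lemma prime_idealX J g n : prime_ideal J -> J (g ^+ n) -> J g.
Proof.
case=> IJ J1 Jp; elim: n => [/J1 //|n IH]; rewrite exprS => /Jp[//|]; exact: IH.
Qed.

(** If no such ideal were maximal, choice would assign to each one a strictly larger one, and
    iterating from [J0] would give a chain that never stops. *)
Lemma noetherian_maximal (Q : (R -> Prop) -> Prop) J0 :
  noetherian -> ideal J0 -> Q J0 ->
  exists J, [/\ ideal J, Q J, forall a, J0 a -> J a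
    & forall K, ideal K -> Q K -> (forall a, J a -> K a) -> forall a, K a -> J a].
Proof.
move=> noeR IJ0 QJ0.
pose T := {J : R -> Prop | [/\ ideal J, Q J & forall a, J0 a -> J a]}.
apply: NNPP => nomax.
have step (t : T) : exists u : T, (forall a, sval t a -> sval u a) /\
    exists a, sval u a /\ ~ sval t a.
  case: t => J [IJ QJ J0J] /=; apply: NNPP => nou; apply: nomax.
  exists J; split=> // K IK QK JK a Ka; apply: NNPP => nJa; apply: nou.
  have hK : [/\ ideal K, Q K & forall a, J0 a -> K a] by split=> // c /J0J/JK.
  by exists (exist _ K hK); split=> //; exists a.
pose next t := proj1_sig (constructive_indefinite_description _ (step t)).
have nextP t := proj2_sig (constructive_indefinite_description _ (step t)).
have h0 : [/\ ideal J0, Q J0 & forall a, J0 a -> J0 a] by [].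
pose F i := iter i next (exist _ J0 h0 : T).
have [m hm] := noeR (fun i => sval (F i)) (fun i => let: And3 p _ _ := svalP (F i) in p)
   (fun i => proj1 (nextP (F i))).
by have [a [h1 h2]] := proj2 (nextP (F m)); apply: h2; apply: (hm m.+1).
Qed.

(* An ideal maximal among those containing no power of g is prime. *)
Lemma prime_avoiding J g : noetherian -> ideal J -> (forall D, ~ J (g ^+ D)) ->
  exists P, [/\ prime_ideal P, forall a, J a -> P a & ~ P g].
Proof.
move=> noeR IJ Jg.
have [P [IP Pg JP Pmax]] :=
  noetherian_maximal (Q := fun K => forall D, ~ K (g ^+ D)) noeR IJ Jg.
exists P; split=> //; last by move=> Pg1; apply: (Pg 1%N).
split=> //; first exact: (Pg 0%N).
move=> a b Pab; apply: NNPP => /not_or_and[na nb].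
(* By maximality, adjoining an element outside [P] brings in a power of [g]. For [a] and [b] with
   product in [P], the product of the two powers falls back into [P]. *)
have adj c : ~ P c -> exists D, adjoin P c (g ^+ D).
  move=> nc; apply: NNPP => /not_ex_all_not h; apply: nc.
  by apply: (Pmax _ (adjoin_ideal c IP) h);
    [exact: adjoin_sub | exact: adjoin_gen].
have [D [c Pc]] := adj a na; have [E [d Pd]] := adj b nb.
apply: (Pg (D + E)%N); rewrite exprD.
rewrite -(subrK (c * a) (g ^+ D)) mulrDl; apply: idealD => //; first exact: idealMl.
rewrite -(subrK (d * b) (g ^+ E)) mulrDr; apply: idealD => //; first exact: idealM.
by rewrite mulrACA; apply: idealM.
Qed.

End Ideals.

Section IdealMorphism.
Variables (R R' : comNzRingType) (rho : {rmorphism R -> R'}).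

Lemma ideal_preim (J : R' -> Prop) : ideal J -> ideal (fun a => J (rho a)).
Proof.
case=> J0 JD JM; split; first by rewrite rmorph0.
- by move=> a b; rewrite rmorphD; apply: JD.
- by move=> a b; rewrite rmorphM; apply: JM.
Qed.

Lemma noetherian_surj : (forall b, exists a, rho a = b) ->
  noetherian R -> noetherian R'.
Proof.
move=> surj noeR J IJ Jasc.
have [||m hm] := noeR (fun i a => J i (rho a)).
- by move=> i; apply: ideal_preim.
- by move=> i a; apply: Jasc.
by exists m => i b; have [a <-] := surj b; apply: hm.
Qed.

End IdealMorphism.

Lemma ascending (T : Type) (J : nat -> T -> Prop) :
  (forall i a, J i a -> J i.+1 a) -> forall i j a, (i <= j)%N -> J i a -> J j a.
Proof.
move=> asc i j a /subnK <-; elim: (j - i)%N => // d IH /IH; rewrite addSn; apply: asc.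
Qed.

(** * The Hilbert basis theorem *)

Section HilbertBasis.
Variables (R : comNzRingType).

(** Hilbert's argument on the ideals [L i d] of the coefficients of degree [d] of those elements of
    [J i] that have size at most [d.+1]. They grow with [i] and with [d], so the diagonal chain
    [L i i] stops, and this settles all large [d] at once. *)
Lemma noetherian_poly : noetherian R -> noetherian {poly R}.
Proof.
move=> noeR J IJ Jasc.
pose L i d a := exists f : {poly R}, [/\ J i f, (size f <= d.+1)%N & f`_d = a].
have IL i d : ideal (L i d).
  split.
  - by exists 0; rewrite size_poly0 coef0; split=> //; apply: ideal0 (IJ i).
  - move=> a b [f [Jf sf fd]] [g [Jg sg gd]]; exists (f + g).
    rewrite coefD fd gd; split=> //; first exact: (idealD (IJ i)).
    by apply: leq_trans (size_polyD _ _) _; rewrite geq_max sf sg.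
  - move=> a b [f [Jf sf fd]]; exists (a%:P * f).
    rewrite coefCM fd; split=> //; first exact: (idealM (IJ i)).
    by rewrite mul_polyC; apply: leq_trans (size_scale_leq _ _) _.
have Li d i a : L i d a -> L i.+1 d a.
  by case=> f [Jf sf fd]; exists f; split=> //; apply: Jasc.
have Ld i d a : L i d a -> L i d.+1 a.
  case=> f [Jf sf fd]; exists (f * 'X); split.
  - exact: idealMl (IJ i) _ _ _.
  - apply: leq_trans (size_polyMleq _ _) _.
    by rewrite size_polyX addn2.
  - by rewrite coefMX.
have [m hm] := noeR (fun i => L i i) (fun i => IL i i)
  (fun i a h => Ld i.+1 i a (Li i i a h)).
(* The finitely many degrees below the stop [m] of the diagonal each have their own stop; [M] lies
   beyond all of them. *)
have [M leM hM] : exists2 M, (m <= M)%N &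
    forall d, (d < m)%N -> forall i a, L i d a -> L M d a.
  suff: forall e, exists2 M, (m <= M)%N &
    forall d, (d < e)%N -> forall i a, L i d a -> L M d a by apply.
  elim=> [|e [M mM IH]]; first by exists m.
  have [M' hM'] := noeR (fun i => L i e) (fun i => IL i e) (Li e).
  exists (maxn M M'); first by rewrite leq_max mM.
  move=> d; rewrite ltnS leq_eqVlt => /predU1P[-> i a /hM'|/IH h i a /h].
    by apply: (ascending (Li e)); rewrite leq_maxr.
  by apply: (ascending (Li d)); rewrite leq_maxl.
have LM i d a : L i d a -> L M d a.
  move=> La; have [ltdm|lemd] := ltnP d m; first exact: hM La.
  apply: (ascending (J := fun d => L M d) (Ld M)) lemd _.
  apply: (ascending (Li m)) leM _; apply: (hm (maxn i d)).
  apply: (ascending (Ld (maxn i d)) (leq_maxr i d)).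
  exact: (ascending (Li d)) (leq_maxl i d) La.
(* Leading coefficients in [J i] already occur in [J M], so subtracting elements of [J M] lowers the
   size of [f] until nothing is left. *)
exists M => i f Jf.
have: J (maxn i M) f by apply: (ascending Jasc) (leq_maxl _ _) Jf.
move: {Jf} (maxn i M) (leq_maxr i M) => {}i leMi.
elim: (size f) {-2}f (leqnn (size f)) => {f} [f|d IH f sf Jf].
  by rewrite leqn0 size_poly_eq0 => /eqP -> _; apply: ideal0 (IJ M).
have [|g [Jg sg gd]] := LM i d f`_d; first by exists f.
rewrite -(subrK g f); apply: (idealD (IJ M)) => //; apply: IH.
  apply/leq_sizeP => j; rewrite leq_eqVlt => /predU1P[<-|ltdj].
    by rewrite coefB gd subrr.
  by rewrite coefB !nth_default ?subrr // (leq_trans _ ltdj).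
apply: (idealB (IJ i)) => //; exact: (ascending Jasc) Jg.
Qed.

End HilbertBasis.

(** * The Nullstellensatz *)

(** The leading coefficient of [g] need not be invertible, so each division step multiplies by it
    instead. The bound on [q] is recorded because the Nullstellensatz applies the minimality of a
    degree to a quotient. *)
Lemma pseudo_division (R : comNzRingType) (g f : {poly R}) d :
  g != 0 -> (size f <= d + size g)%N ->
  exists N q r, [/\ (lead_coef g ^+ N)%:P * f = q * g + r,
    (size r < size g)%N & (size q <= d.+1)%N].
Proof.
move=> g0; have sg : (0 < size g)%N by rewrite size_poly_gt0.
elim: d f => [|d IH] f sf.
  have [lt|ge] := ltnP (size f) (size g).
    by exists 0%N, 0, f; rewrite expr0 mul1r mul0r add0r size_poly0.
  have eqs : size f = size g by apply/eqP; rewrite eqn_leq ge sf.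
  exists 1%N, (lead_coef f)%:P, ((lead_coef g)%:P * f - (lead_coef f)%:P * g).
  rewrite expr1 addrC subrK; split=> //; last by rewrite size_polyC; case: eqP.
  rewrite -(prednK sg) ltnS; apply/leq_sizeP => j.
  rewrite leq_eqVlt coefB !coefCM => /predU1P[<-|lt].
    by rewrite /lead_coef eqs mulrC subrr.
  by rewrite !nth_default ?mulr0 ?subrr // ?eqs -(prednK sg).
set c := f`_(d + size g); pose f' := (lead_coef g)%:P * f - c%:P * ('X^(d.+1) * g).
have [|N [q [r [E sr sq]]]] := IH f'.
  apply/leq_sizeP => j; rewrite leq_eqVlt coefB !coefCM coefXnM => /predU1P[<-|lt].
    have -> : (d + size g < d.+1)%N = false by lia.
    have -> : (d + size g - d.+1 = (size g).-1)%N by lia.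
    by rewrite mulrC subrr.
  rewrite nth_default; last by apply: leq_trans sf _; rewrite addSn.
  rewrite mulr0 sub0r; case: ifP => [_|/negbT]; first by rewrite mulr0 oppr0.
  rewrite -leqNgt => le; rewrite nth_default ?mulr0 ?oppr0 //.
  by move: (size g) lt => s; clear; lia.
exists N.+1, (q + (lead_coef g ^+ N * c)%:P * 'X^(d.+1)), r; split=> //.
  by rewrite mulrDl addrAC -E /f' exprSr !polyCM; ring.
apply: leq_trans (size_polyD _ _) _; rewrite geq_max (leq_trans sq) //=.
by rewrite mul_polyC (leq_trans (size_scale_leq _ _)) // size_polyXn.
Qed.

Section Nullstellensatz.
Variable k : closedFieldType.

(** Points are ring morphisms to [k] that fix the constants. The open condition on [g] is built in
    because the induction on the number of variables hands one down to the coefficient ring: there,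
    certain leading coefficients must not vanish. *)
Definition nullstellensatz (R : comNzRingType) (iota : {rmorphism k -> R}) : Prop :=
  forall (J : R -> Prop) (g : R), ideal J -> (forall D, ~ J (g ^+ D)) ->
  exists chi : {rmorphism R -> k},
    [/\ cancel iota chi, forall a, J a -> chi a = 0 & chi g != 0].

Lemma nullstellensatz_field : nullstellensatz (idfun : {rmorphism k -> k}).
Proof.
move=> J g IJ Jg; exists (idfun : {rmorphism k -> k}); split=> //=.
  move=> a Ja; apply/eqP; apply: contraPT (Jg 0%N) => a0 [].
  by rewrite expr0 -(mulVf a0); apply: idealM.
by apply/eqP => g0; apply: (Jg 1%N); rewrite expr1 g0; apply: ideal0.
Qed.

Section Polynomials.
Variables (R : comNzRingType) (iota : {rmorphism k -> R}).
Hypothesis nullR : nullstellensatz iota.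

Let pt (chi : {rmorphism R -> k}) (b : k) : {rmorphism {poly R} -> k} :=
  (horner_eval b \o map_poly chi : {rmorphism {poly R} -> k}).

Lemma ptC chi b c : pt chi b c%:P = chi c.
Proof. by rewrite /= map_polyC /horner_eval hornerC. Qed.

Lemma ideal_poly (P : {poly R} -> Prop) (f : {poly R}) : ideal P ->
  (forall i, P (f`_i)%:P) -> P f.
Proof.
move=> IP h; rewrite -[f]coefK poly_def; apply: ideal_sum => // i _.
by rewrite -mul_polyC; apply: idealMl.
Qed.

Lemma drop_lead_coef (f : {poly R}) : f != 0 ->
  exists f1, f = f1 + (lead_coef f)%:P * 'X^((size f).-1) /\ (size f1 < size f)%N.
Proof.
move=> f0; exists (f - (lead_coef f)%:P * 'X^((size f).-1)); rewrite subrK; split=> //.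
rewrite -[X in (_ < X)%N](prednK (n := size f)) ?size_poly_gt0 // ltnS.
apply/leq_sizeP => j; rewrite leq_eqVlt coefB coefCM coefXn => /predU1P[<-|lt].
  by rewrite eqxx mulr1 subrr.
rewrite (gtn_eqF lt) mulr0 subr0 nth_default //.
by rewrite -(prednK (n := size f)) ?size_poly_gt0.
Qed.

Lemma ideal_strip (P : {poly R} -> Prop) (f : {poly R}) : ideal P ->
  P f \/ exists2 f' : {poly R}, ~ P (lead_coef f')%:P & (size f' <= size f)%N /\ P (f - f').
Proof.
move=> IP; elim: {f}(size f) {-2}f (leqnn (size f)) => [f|d IH f sf].
  by rewrite leqn0 size_poly_eq0 => /eqP ->; left; apply: ideal0.
have [Pl|nPl] := classic (P (lead_coef f)%:P); last first.
  by right; exists f => //; rewrite subrr; split=> //; apply: ideal0.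
have [->|/drop_lead_coef[f1 [Ef sf1]]] := eqVneq f 0; first by left; apply: ideal0.
have Pf1 : P (f - f1) by rewrite Ef addrAC subrr add0r; apply: idealMl.
case: (IH f1) => [|Pf|[f' h [sf' Pf']]]; first by rewrite -ltnS (leq_trans sf1).
  by left; rewrite -(subrK f1 f); apply: idealD.
right; exists f' => //; split; first exact: leq_trans sf' (ltnW sf1).
by rewrite -(subrKA f1); apply: idealD.
Qed.

Lemma coef_in_contraction (P : {poly R} -> Prop) s (f : {poly R}) : ideal P ->
  (forall h, P h -> (size h < s)%N -> P (lead_coef h)%:P) ->
  P f -> (size f < s)%N -> forall i, P (f`_i)%:P.
Proof.
move=> IP hP.
elim: {f}(size f) {-2}f (leqnn (size f)) => [f|d IH f sf Pf sfs i].
  by rewrite leqn0 size_poly_eq0 => /eqP -> _ _ i; rewrite coef0 polyC0; apply: ideal0.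
have Pl := hP f Pf sfs.
have [->|/drop_lead_coef[f1 [Ef sf1]]] := eqVneq f 0.
  by rewrite coef0 polyC0; apply: ideal0.
rewrite Ef coefD coefCM polyCD polyCM; apply: idealD => //; last exact: idealMl.
apply: IH; first by rewrite -ltnS (leq_trans sf1).
  have -> : f1 = f - (lead_coef f)%:P * 'X^((size f).-1) by rewrite {1}Ef addrK.
  by apply: idealB => //; apply: idealMl.
exact: ltn_trans sfs.
Qed.

(** A point of the contraction [P0] is lifted along the new variable. If [P] is extended from [P0],
    any value that is not a root of [g] will do. Otherwise [P] is generated, up to [P0] and powers
    of a leading coefficient, by one polynomial [f], and the value is a root of [f]. *)
Lemma nullstellensatz_prime_poly (P : {poly R} -> Prop) g :
  prime_ideal P -> ~ P g ->
  exists chi : {rmorphism {poly R} -> k},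
    [/\ cancel (polyC \o iota) chi, forall a, P a -> chi a = 0 & chi g != 0].
Proof.
move=> primeP nPg; have [IP P1 Pp] := primeP.
pose P0 a := P a%:P.
have IP0 : ideal P0 by apply: (@ideal_preim _ _ (polyC : {rmorphism R -> {poly R}})).
have P0X a D : P0 (a ^+ D) -> P0 a by rewrite /P0 rmorphXn; apply: prime_idealX.
have [[f1 Pf1 nf1]|noF] := classic (exists2 f, P f & ~ P0 (lead_coef f)); last first.
  have coefP f : P f -> forall i, P0 f`_i.
    move=> Pf; apply: (coef_in_contraction (s := (size f).+1)) => // h Ph _.
    by apply: NNPP => nh; apply: noF; exists h.
  have [i nPgi] : exists i, ~ P0 g`_i.
    by apply: not_all_ex_not => h; apply: nPg; apply: ideal_poly.
  have [|chi [ichi chiP chig]] := nullR (g := g`_i) IP0; first by move=> D /P0X.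
  have /closed_nonrootP[b nb] : map_poly chi g != 0.
    by apply/eqP => /polyP/(_ i)/eqP; rewrite coef_map coef0 (negbTE chig).
  exists (pt chi b); split=> // [c|a /coefP h].
    by change (pt chi b (iota c)%:P = c); rewrite ptC.
  rewrite /= (_ : map_poly chi a = 0) ?/horner_eval ?horner0 //.
  by apply/polyP => j; rewrite coef_map coef0 /= chiP.
have [f [Pf nf fmin]] : exists f, [/\ P f, ~ P0 (lead_coef f) &
    forall h, P h -> ~ P0 (lead_coef h) -> (size f <= size h)%N].
  have [|s [f [Pf nf <-]] smin] := @exists_minimal
    (fun s => exists f, [/\ P f, ~ P0 (lead_coef f) & size f = s]).
    by exists (size f1), f1.
  by exists f; split=> // h Ph nh; apply: smin; exists h.
have f0 : f != 0 by apply/eqP => f0; apply: nf; rewrite f0 lead_coef0; apply: ideal0.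
have smallP r : P r -> (size r < size f)%N -> forall i, P0 r`_i.
  apply: coef_in_contraction => // h Ph sh; apply: NNPP => nh.
  by have := fmin h Ph nh; rewrite leqNgt sh.
have sf : (1 < size f)%N.
  rewrite ltnNge; apply/negP => /size1_polyC Ef; apply: nf.
  by move: Pf; rewrite Ef lead_coefC.
have IK := adjoin_ideal g IP.
have small_in r : adjoin P g r -> ~ P r ->
    exists2 r' : {poly R}, ~ P0 (lead_coef r') & (size r' <= size r)%N /\ adjoin P g r'.
  move=> Kr nPr; case: (ideal_strip r IP) => // -[r' nr' [sr' Pr']]; exists r' => //.
  split=> //; rewrite -(subKr r r'); apply: (idealB IK) => //; exact: adjoin_sub.
(* Over the fraction field of [R] modulo [P0], this [v] is a greatest common divisor of [f] and [g].
   The next two steps show that it is a constant: it is smaller than [f] because [g] is not in [P],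
   and a nonconstant [v] would split [f] against the minimality of [f] in the prime [P]. *)
have [v [Kv nv vmin]] : exists v, [/\ adjoin P g v, ~ P0 (lead_coef v) &
    forall h, adjoin P g h -> ~ P0 (lead_coef h) -> (size v <= size h)%N].
  have [|s [h [Kh nh <-]] smin] := @exists_minimal
    (fun s => exists h, [/\ adjoin P g h, ~ P0 (lead_coef h) & size h = s]).
    by exists (size f), f; split=> //; apply: adjoin_sub.
  by exists h; split=> // h' Kh' nh'; apply: smin; exists h'.
have v0 : v != 0 by apply/eqP => v0; apply: nv; rewrite v0 lead_coef0; apply: ideal0.
have smallK r : adjoin P g r -> (size r < size v)%N -> P r.
  move=> Kr sr; apply: NNPP => /(small_in r Kr)[r' nr' [sr' Kr']].
  by have := vmin r' Kr' nr'; rewrite leqNgt (leq_ltn_trans sr').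
have svf : (size v < size f)%N.
  have [N [q [r [E sr _]]]] := pseudo_division (d := size g) f0 (leq_addr _ _ : size g <= _)%N.
  have Kr : adjoin P g r.
    rewrite -(addKr (q * f) r) -E addrC; apply: (idealB IK).
      by apply: (idealM IK); apply: adjoin_gen.
    by apply: adjoin_sub; apply: idealM.
  rewrite ltnNge; apply/negP => le; have Pr := smallK r Kr (leq_trans sr le).
  have: P ((lead_coef f ^+ N)%:P * g) by rewrite E; apply: idealD => //; apply: idealM.
  by case/Pp => // /P0X.
have sv1 : (size v <= 1)%N.
  rewrite leqNgt; apply/negP => sv1.
  have le : (size f <= (size f - size v) + size v)%N by rewrite subnK // ltnW.
  have [N [q [r [E sr sq]]]] := pseudo_division v0 le.
  have Pr : P r.
    apply: smallK => //; rewrite -(addKr (q * v) r) -E addrC; apply: (idealB IK).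
      by apply: adjoin_sub; apply: idealM.
    exact: (idealM IK).
  have: P (q * v) by rewrite -(addrK r (q * v)) -E; apply: idealB => //; apply: idealM.
  case/Pp => [Pq|Pv]; last first.
    by have := fmin v Pv nv; rewrite leqNgt svf.
  have sqf : (size q < size f)%N.
    by lia.
  have Pqc := smallP q Pq sqf.
  have: P0 ((lead_coef v ^+ N)%:P * f)`_(size f).-1.
    rewrite E coefD [r`_ _]nth_default ?addr0; last first.
      by move: sf svf sr; move: (size _) (size v) (size r) => a b c; clear; lia.
    rewrite coefM; apply: ideal_sum => // i _; apply: idealMl => //; exact: Pqc.
  by rewrite coefCM /P0 polyCM => /Pp[/P0X|].
have [c Ev] : exists c, v = c%:P by exists v`_0; apply: size1_polyC.
move: nv Kv; rewrite Ev lead_coefC => nc [q Kq].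
have nac : ~ P0 (lead_coef f * c) by rewrite /P0 polyCM => /Pp[].
(* Where the leading coefficient of [f] survives, [f] keeps its positive degree and has a root.
   Where [c] survives, so does [g], since [c] is a multiple of [g] modulo [P]. *)
have [|chi [ichi chiP]] := nullR (g := lead_coef f * c) IP0; first by move=> D /P0X.
rewrite rmorphM mulf_eq0 => /norP[chif chic].
have smf : size (map_poly chi f) = size f by rewrite size_map_poly_id0.
have /closed_rootP[b /rootP rb] : size (map_poly chi f) != 1%N.
  by rewrite smf gtn_eqF.
have ptP h : P h -> pt chi b h = 0.
  move=> Ph; have [N [u [r [E sr _]]]] := pseudo_division (d := size h) f0 (leq_addr _ _ : size h <= _)%N.
  have Pr : P r.
    by rewrite -(addKr (u * f) r) -E addrC; apply: idealB => //; apply: idealM.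
  have := congr1 (pt chi b) E.
  rewrite rmorphM ptC rmorphD rmorphM /= /horner_eval rb mulr0 add0r.
  have -> : map_poly chi r = 0.
    by apply/polyP => i; rewrite coef_map coef0 /= chiP //; apply: smallP.
  rewrite horner0 rmorphXn => /eqP; rewrite mulf_eq0 expf_eq0 (negbTE chif) andbF.
  by move=> /eqP.
exists (pt chi b); split=> // [a|].
  by change (pt chi b (iota a)%:P = a); rewrite ptC.
have := ptP _ Kq; rewrite rmorphB rmorphM ptC => /eqP; rewrite subr_eq0 => /eqP E.
by apply: contraNneq chic => g0; rewrite E g0 mulr0.
Qed.

Lemma nullstellensatz_poly : noetherian R ->
  nullstellensatz (polyC \o iota : {rmorphism k -> {poly R}}).
Proof.
move=> noeR J g IJ Jg.
have [P [primeP JP nPg]] := prime_avoiding (noetherian_poly noeR) IJ Jg.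
have [chi [h1 h2 h3]] := nullstellensatz_prime_poly primeP nPg.
by exists chi; split=> // a /JP/h2.
Qed.

End Polynomials.

Lemma factor_surj (R R' T : comNzRingType) (rho : {rmorphism R -> R'})
    (chi : {rmorphism R -> T}) :
  (forall b, exists a, rho a = b) -> (forall a, rho a = 0 -> chi a = 0) ->
  exists psi : {rmorphism R' -> T}, forall a, psi (rho a) = chi a.
Proof.
move=> surj ker.
pose lift b := proj1_sig (constructive_indefinite_description _ (surj b)).
have liftK b : rho (lift b) = b by rewrite /lift; case: constructive_indefinite_description.
pose f b := chi (lift b).
have fE a : f (rho a) = chi a.
  by apply/eqP; rewrite -subr_eq0 -rmorphB ker // rmorphB liftK subrr.
have fB : zmod_morphism f.
  by move=> a b; rewrite -{1}(liftK a) -{1}(liftK b) -rmorphB fE rmorphB.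
have fM : monoid_morphism f.
  split; first by rewrite -(rmorph1 rho) fE rmorph1.
  by move=> a b; rewrite -{1}(liftK a) -{1}(liftK b) -rmorphM fE rmorphM.
pose F := HB.pack_for {rmorphism R' -> T} f (GRing.isZmodMorphism.Build _ _ f fB)
  (GRing.isMonoidMorphism.Build _ _ f fM).
by exists F.
Qed.

Lemma nullstellensatz_surj (R R' : comNzRingType) (iota : {rmorphism k -> R})
    (rho : {rmorphism R -> R'}) :
  (forall b, exists a, rho a = b) -> nullstellensatz iota ->
  nullstellensatz (rho \o iota : {rmorphism k -> R'}).
Proof.
move=> surj nullR J g IJ; have [g' <-] := surj g => Jg.
have [||chi [h1 h2 h3]] := nullR (fun a => J (rho a)) g'.
- exact: ideal_preim.
- by move=> D; rewrite rmorphXn.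
have [|psi psiE] := factor_surj (rho := rho) (chi := chi) surj.
  by move=> a a0; apply: h2; rewrite a0; apply: ideal0.
exists psi; split=> [c|a|]; last by rewrite psiE.
  by change (psi (rho (iota c)) = c); rewrite psiE.
by have [a' <-] := surj a; rewrite psiE; apply: h2.
Qed.

End Nullstellensatz.

Lemma mpoly_gen_ind (n : nat) (A : comNzRingType) (Q : {mpoly A[n]} -> Prop) :
  (forall p q, Q p -> Q q -> Q (p + q)) -> (forall p q, Q p -> Q q -> Q (p * q)) ->
  (forall c, Q c%:MP) -> (forall i, Q 'X_i) -> forall p, Q p.
Proof.
move=> QD QM QC QX p; rewrite (mpolyE p); elim/big_ind: _ => [|//|m _].
  by rewrite -mpolyC0.
rewrite -mul_mpolyC; apply: (QM) => //; rewrite mpolyXE_id.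
elim/big_ind: _ => [||i0 _]; [by rewrite -mpolyC1 | exact: QM |].
by elim: (m i0) => [|d IH]; rewrite ?expr0 -?mpolyC1 // exprS; apply: QM.
Qed.

(* The evaluation morphism is kept opaque: unfolding [mmap] during unification
   is prohibitively slow. *)
Lemma mpoly_hom_sig (n : nat) (A S : comNzRingType) (f : {rmorphism A -> S})
    (h : 'I_n -> S) :
  {F : {rmorphism {mpoly A[n]} -> S} | (forall c, F c%:MP = f c) /\ forall i, F 'X_i = h i}.
Proof.
exists (mmap f h : {rmorphism {mpoly A[n]} -> S}).
by split=> [c|i]; rewrite /= ?mmapC // mmapX mmap1U.
Qed.

Definition mpoly_hom n A S f h := sval (@mpoly_hom_sig n A S f h).

Lemma mpoly_homC n A S f h c : @mpoly_hom n A S f h c%:MP = f c.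
Proof. exact: (proj1 (svalP (mpoly_hom_sig f h))). Qed.

Lemma mpoly_homX n A S f h i : @mpoly_hom n A S f h 'X_i = h i.
Proof. exact: (proj2 (svalP (mpoly_hom_sig f h))). Qed.

Section MultivariatePolynomials.
Variables (k : closedFieldType) (A : comNzRingType) (iota : {rmorphism k -> A}).
Hypotheses (noeA : noetherian A) (nullA : nullstellensatz iota).

(** Both properties pass to univariate polynomials and to quotients, so a surjection from [{poly
    {mpoly A[n]}}] onto [{mpoly A[n.+1]}] carries the induction without an isomorphism. *)
Lemma nullstellensatz_mpoly n : noetherian {mpoly A[n]} /\
  nullstellensatz (@mpolyC n A \o iota : {rmorphism k -> {mpoly A[n]}}).
Proof.
elim: n => [|n [noeP nullP]].
  have surj (b : {mpoly A[0]}) : exists a, (@mpolyC 0 A) a = b.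
    elim/mpoly_gen_ind: b => [_ _ [a <-] [b <-]|_ _ [a <-] [b <-]|c|[]//].
    - by exists (a + b); rewrite mpolyCD.
    - by exists (a * b); rewrite mpolyCM.
    - by exists c.
  split; first exact: noetherian_surj surj noeA.
  exact: nullstellensatz_surj surj nullA.
pose rho : {rmorphism {poly {mpoly A[n]}} -> {mpoly A[n.+1]}} :=
  (horner_eval 'X_ord_max \o map_poly (@mwiden n A)).
have surj (b : {mpoly A[n.+1]}) : exists a, rho a = b.
  elim/mpoly_gen_ind: b => [_ _ [a <-] [b <-]|_ _ [a <-] [b <-]|c|i].
  - by exists (a + b); rewrite rmorphD.
  - by exists (a * b); rewrite rmorphM.
  - by exists (c%:MP)%:P; rewrite /= map_polyC /horner_eval hornerC /= mwidenC.
  - have [lt|ge] := ltnP i n.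
      exists ('X_(Ordinal lt))%:P; rewrite /= map_polyC /horner_eval hornerC /=.
      by rewrite mwidenX mnmwiden1; congr 'X_[U_(_)]; apply: val_inj.
    exists 'X; rewrite /= map_polyX /horner_eval hornerX.
    by congr 'X_[U_(_)]; apply: val_inj; apply/eqP; rewrite eqn_leq ge -ltnS ltn_ord.
split; first exact: noetherian_surj surj (noetherian_poly noeP).
move=> J g IJ Jg.
have [chi [h1 h2 h3]] :=
  nullstellensatz_surj surj (nullstellensatz_poly nullP noeP) IJ Jg.
exists chi; split=> // c; rewrite -{2}(h1 c) /= map_polyC /horner_eval hornerC /=.
by rewrite mwidenC.
Qed.

End MultivariatePolynomials.

(** * Homotopies and Clifford relations *)

Section ExactMatrices.
Variable P : comNzRingType.

Lemma exact_at_mx (l m n q : nat) (phi : 'M[P]_(l, m)) (psi : 'M[P]_(m, n))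
    (V : 'M[P]_(m, q)) :
  exact_at phi psi -> phi *m V = 0 -> exists W : 'M[P]_(n, q), V = psi *m W.
Proof.
move=> ex phiV.
have [j|w wP] := @ord_choice q _ (fun j w => col j V = psi *m w).
  by apply/ex; rewrite colE mulmxA phiV mul0mx.
exists (\matrix_(i, j) w j i 0); apply/matrixP => i j.
have /matrixP/(_ i 0) := wP j; rewrite !mxE => ->.
by apply: eq_bigr => a _; rewrite !mxE.
Qed.

Lemma exact_at_mul0 (l m n : nat) (phi : 'M[P]_(l, m)) (psi : 'M[P]_(m, n)) :
  exact_at phi psi -> phi *m psi = 0.
Proof.
move=> ex; apply/matrixP => i j.
have [_ /(_ (ex_intro _ _ erefl))] := ex (psi *m delta_mx j (0 : 'I_1)).
by rewrite mulmxA -colE => /matrixP/(_ i 0); rewrite !mxE.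
Qed.

Lemma injective_mx0 (m n q : nat) (phi : 'M[P]_(m, n)) (V : 'M[P]_(n, q)) :
  injective_mx phi -> phi *m V = 0 -> V = 0.
Proof.
move=> inj phiV; apply/matrixP => i j.
have := inj (col j V); rewrite colE mulmxA phiV mul0mx => /(_ erefl)/matrixP/(_ i 0).
by rewrite -colE !mxE.
Qed.

(* Multiplication by an element of the image of phi1 is homotopic to 0. *)
Lemma null_homotopy (b c d : nat) (phi1 : 'M[P]_(1, b)) (phi2 : 'M[P]_(b, c))
    (phi3 : 'M[P]_(c, d)) (f : P) (h0 : 'M[P]_(b, 1)) :
  acyclic3 phi1 phi2 phi3 -> f%:M = phi1 *m h0 ->
  exists (h1 : 'M[P]_(c, b)) (h2 : 'M[P]_(d, c)),
    [/\ f%:M = phi2 *m h1 + h0 *m phi1, f%:M = phi3 *m h2 + h1 *m phi2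
      & f%:M = h2 *m phi3].
Proof.
case=> ex1 ex2 inj3 E0.
have z12 := exact_at_mul0 ex1; have z23 := exact_at_mul0 ex2.
have [h1 E1] : exists h1, f%:M - h0 *m phi1 = phi2 *m h1.
  apply: (exact_at_mx ex1).
  by rewrite mulmxBr mulmxA -E0 mul_scalar_mx mul_mx_scalar subrr.
have [h2 E2] : exists h2, f%:M - h1 *m phi2 = phi3 *m h2.
  apply: (exact_at_mx ex2).
  rewrite mulmxBr mulmxA -E1 mulmxBl -mulmxA z12 mulmx0 subr0.
  by rewrite mul_scalar_mx mul_mx_scalar subrr.
exists h1, h2; split; rewrite -?E1 -?E2 ?subrK //.
apply/eqP; rewrite -subr_eq0; apply/eqP/(injective_mx0 inj3).
rewrite mulmxBr mulmxA -E2 mulmxBl -mulmxA z23 mulmx0 subr0.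
by rewrite mul_scalar_mx mul_mx_scalar subrr.
Qed.

End ExactMatrices.

Section PointDerivations.
Variables (k : fieldType) (P : comNzRingType) (ev : {rmorphism P -> k}).

Definition point_derivation (d : P -> k) : Prop :=
  (forall a b, d (a + b) = d a + d b) /\
  (forall a b, d (a * b) = d a * ev b + ev a * d b).

Variable d : P -> k.
Hypothesis dP : point_derivation d.

Lemma pderD a b : d (a + b) = d a + d b. Proof. by case: dP. Qed.
Lemma pderM a b : d (a * b) = d a * ev b + ev a * d b. Proof. by case: dP. Qed.
Lemma pder0 : d 0 = 0.
Proof. by apply: (addrI (d 0)); rewrite -pderD !addr0. Qed.
Lemma pderN a : d (- a) = - d a.
Proof. by apply: (addrI (d a)); rewrite -pderD !subrr pder0. Qed.
Lemma pderB a b : d (a - b) = d a - d b. Proof. by rewrite pderD pderN. Qed.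
Lemma pder1 : d 1 = 0.
Proof. by apply: (addrI (d 1)); rewrite -{3}(mulr1 1) pderM rmorph1 mulr1 mul1r addr0. Qed.
Lemma pder_sum (I : Type) (r : seq I) (Q : pred I) F :
  d (\sum_(i <- r | Q i) F i) = \sum_(i <- r | Q i) d (F i).
Proof. exact: (big_morph d pderD pder0). Qed.
Lemma pder_mx (m n q : nat) (A : 'M[P]_(m, n)) (B : 'M[P]_(n, q)) :
  map_mx d (A *m B) =
  map_mx d A *m map_mx ev B + map_mx ev A *m map_mx d B.
Proof.
apply/matrixP => i j; rewrite !mxE pder_sum -big_split /=.
by apply: eq_bigr => a _; rewrite !mxE pderM.
Qed.
Lemma pder_mxD (m n : nat) (A B : 'M[P]_(m, n)) :
  map_mx d (A + B) = map_mx d A + map_mx d B.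
Proof. by apply/matrixP => i j; rewrite !mxE pderD. Qed.
Lemma pder_scalar_mx (n : nat) (a : P) : map_mx d (a%:M : 'M_n) = (d a)%:M.
Proof.
by apply/matrixP => i j; rewrite !mxE; case: eqP; rewrite ?mulr1n ?mulr0n ?pder0.
Qed.
Lemma pder_mx0 (m n : nat) : map_mx d (0 : 'M_(m, n)) = 0.
Proof. by apply/matrixP => i j; rewrite !mxE pder0. Qed.

End PointDerivations.

(** * The Clifford action on Tor at a point *)

Section Clifford.
Variables (k : fieldType) (P : comNzRingType) (ev : {rmorphism P -> k}).
Variables (b c e : nat) (phi1 : 'M[P]_(1, b)) (phi2 : 'M[P]_(b, c)) (phi3 : 'M[P]_(c, e)).
Hypothesis acyc : acyclic3 phi1 phi2 phi3.
Hypothesis phi1_0 : map_mx ev phi1 = 0.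

Local Notation "A ^e" := (map_mx ev A) (at level 2, format "A ^e").
Local Notation "A ^d[ d ]" := (map_mx d A) (at level 2, format "A ^d[ d ]").

Lemma der12 d : point_derivation ev d -> phi1^d[d] *m phi2^e = 0.
Proof.
move=> dP; have [ex _ _] := acyc; have := congr1 (map_mx d) (exact_at_mul0 ex).
by rewrite (pder_mx dP) (pder_mx0 dP) phi1_0 mul0mx addr0.
Qed.

Lemma der23 d : point_derivation ev d ->
  phi2^d[d] *m phi3^e = - (phi2^e *m phi3^d[d]).
Proof.
move=> dP; have [_ ex _] := acyc; have := congr1 (map_mx d) (exact_at_mul0 ex).
by rewrite (pder_mx dP) (pder_mx0 dP) => /eqP; rewrite addr_eq0 => /eqP.
Qed.

(* The homotopies of the multiplications by f and the derivatives of the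
   differentials act on Tor(P/I, k) as creation and annihilation operators. *)
Lemma homotopy_at (f : P) : (exists h0, f%:M = phi1 *m h0) ->
  exists (h0 : 'M[P]_(b, 1)) (h1 : 'M[P]_(c, b)) (h2 : 'M[P]_(e, c)),
  [/\ forall d, point_derivation ev d -> (d f)%:M = phi1^d[d] *m h0^e,
      [/\ phi2^e *m h1^e = 0, h1^e *m phi2^e = - (phi3^e *m h2^e) & h2^e *m phi3^e = 0],
      forall d, point_derivation ev d ->
        (d f)%:M = phi2^d[d] *m h1^e + phi2^e *m h1^d[d] + h0^e *m phi1^d[d],
      forall d, point_derivation ev d ->
        (d f)%:M = phi3^d[d] *m h2^e + phi3^e *m h2^d[d] + (h1^d[d] *m phi2^e + h1^e *m phi2^d[d])
    & forall d, point_derivation ev d ->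
        (d f)%:M = h2^d[d] *m phi3^e + h2^e *m phi3^d[d]].
Proof.
case=> h0 E0; have [h1 [h2 [E1 E2 E3]]] := null_homotopy acyc E0.
have f0 : ev f = 0.
  have := congr1 (map_mx ev) E0; rewrite map_scalar_mx map_mxM phi1_0 mul0mx.
  by move/matrixP/(_ 0 0); rewrite !mxE mulr1n.
exists h0, h1, h2; split=> [d dP||d dP|d dP|d dP].
- have := congr1 (map_mx d) E0; rewrite (pder_scalar_mx dP) (pder_mx dP) phi1_0.
  by rewrite mul0mx addr0.
- split.
  + have := congr1 (map_mx ev) E1; rewrite map_scalar_mx map_mxD !map_mxM phi1_0 /= f0.
    by rewrite mulmx0 addr0 raddf0.
  + have := congr1 (map_mx ev) E2; rewrite map_scalar_mx map_mxD !map_mxM /= f0 raddf0.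
    by move/esym/eqP; rewrite addrC addr_eq0 => /eqP.
  + by have := congr1 (map_mx ev) E3; rewrite map_scalar_mx !map_mxM /= f0 raddf0.
- have := congr1 (map_mx d) E1.
  by rewrite (pder_scalar_mx dP) (pder_mxD dP) !(pder_mx dP) phi1_0 mulmx0 add0r.
- have := congr1 (map_mx d) E2.
  by rewrite (pder_scalar_mx dP) (pder_mxD dP) !(pder_mx dP).
- by have := congr1 (map_mx d) E3; rewrite (pder_scalar_mx dP) (pder_mx dP).
Qed.

Section TopClass.
Variables (f1 f2 f3 : P) (d1 d2 d3 : P -> k).
Hypotheses (If1 : exists h, f1%:M = phi1 *m h) (If2 : exists h, f2%:M = phi1 *m h)
  (If3 : exists h, f3%:M = phi1 *m h).
Hypotheses (dP1 : point_derivation ev d1) (dP2 : point_derivation ev d2)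
  (dP3 : point_derivation ev d3).
Hypotheses (d11 : d1 f1 = 1) (d21 : d2 f1 = 0) (d22 : d2 f2 = 1)
  (d31 : d3 f1 = 0) (d32 : d3 f2 = 0) (d33 : d3 f3 = 1).

(** Let A_i be the lowering operator given by the derivative along [d_i], and C_i the raising
    operator given by the homotopy of [f_i]. Every C_i kills Tor_3, as there is no Tor_4, and the
    triangular pairing makes C_i anticommute with A_j for j > i. So if A_1 A_2 A_3 t = 0, then
    applying C_1, C_2, C_3 in turn gives A_2 A_3 t = 0, A_3 t = 0 and t = 0, up to boundaries. *)
Lemma top_class_neq0 (t : 'cV[k]_e) : phi3^e *m t = 0 ->
  phi1^d[d1] *m (phi2^d[d2] *m (phi3^d[d3] *m t)) = 0 -> t = 0.
Proof.
move=> t0; set a3 := phi3^d[d3] *m t; set a23 := phi2^d[d2] *m a3 => c0.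
have a3cyc : phi2^e *m a3 = 0.
  apply: oppr_inj; rewrite /a3 mulmxA -mulNmx -der23 // -mulmxA t0 mulmx0.
  by rewrite oppr0.
have top f : (exists h, f%:M = phi1 *m h) -> forall h2 : 'M[P]_(e, c),
    (d3 f)%:M = h2^d[d3] *m phi3^e + h2^e *m phi3^d[d3] -> h2^e *m a3 = d3 f *: t.
  move=> _ h2 /(congr1 (mulmxr t)); rewrite /= mulmxDl -!mulmxA t0 mulmx0 add0r.
  by rewrite mul_scalar_mx.
have [h0 [h1 [h2 [_ [_ _ _] /(_ _ dP1) E1 /(_ _ dP2) E2 /(_ _ dP3)/(top _ If1)]]]] := homotopy_at If1.
rewrite d31 scale0r => h2a3.
have h1a23 : h1^e *m a23 = - (phi3^e *m (h2^d[d2] *m a3)).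
  move: E2; rewrite d21 => /(congr1 (mulmxr a3)) /=.
  rewrite !mulmxDl -!mulmxA h2a3 a3cyc !mulmx0 add0r add0r raddf0 mul0mx.
  by move/esym/eqP; rewrite addrC addr_eq0 => /eqP.
have {E1} [b' a23E] : exists b', a23 = phi2^e *m b'.
  exists (phi3^d[d1] *m (h2^d[d2] *m a3) + h1^d[d1] *m a23).
  move: E1; rewrite d11 => /(congr1 (mulmxr a23)) /=; rewrite mul1mx => {1}->.
  rewrite !mulmxDl -!mulmxA h1a23 c0 mulmx0 addr0 mulmxN [phi2^d[d1] *m _]mulmxA der23 //.
  by rewrite mulNmx opprK mulmxDr !mulmxA.
have [h0' [h1' [h2' [_ [_ h1phi _] _ /(_ _ dP2) E2' /(_ _ dP3)/(top _ If2)]]]] := homotopy_at If2.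
rewrite d32 scale0r => h2a3'.
have [b2 a3E] : exists b2, a3 = phi3^e *m b2.
  exists (h2'^d[d2] *m a3 - h2'^e *m b').
  move: E2'; rewrite d22 => /(congr1 (mulmxr a3)) /=; rewrite mul1mx => {1}->.
  rewrite !mulmxDl -!mulmxA h2a3' a3cyc !mulmx0 add0r add0r -/a23 a23E [h1'^e *m _]mulmxA h1phi.
  by rewrite mulNmx mulmxBr !mulmxA.
have [_ [_ [h2'' [_ [_ _ h2phi] _ _ /(_ _ dP3)/(top _ If3)]]]] := homotopy_at If3.
by rewrite d33 scale1r a3E mulmxA h2phi mul0mx.
Qed.

(** The mirror image of [top_class_neq0]: a class in Tor_1 that A_1, A_2 and A_3 kill is zero. The
    class C_2 C_1 kappa in Tor_3 is killed by C_3 for lack of Tor_4 and by A_3 by anticommutation,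
    hence vanishes. Then A_2 gives C_1 kappa = 0, and A_1 gives kappa = 0 modulo boundaries. *)
Lemma bottom_class (kappa : 'cV[k]_b) :
  d1 f2 = 0 -> d1 f3 = 0 -> d2 f3 = 0 ->
  phi1^d[d1] *m kappa = 0 -> phi1^d[d2] *m kappa = 0 -> phi1^d[d3] *m kappa = 0 ->
  exists w, kappa = phi2^e *m w.
Proof.
move=> d12 d13 d23 k1 k2 k3.
have [h0 [h1 [h2 [_ [p2h1 _ _] E1 _ _]]]] := homotopy_at If1.
have [_ [h1' [h2' [_ [_ h1p2' _] _ E2 _]]]] := homotopy_at If2.
have [_ [_ [h2'' [_ [_ _ h2p3''] _ _ E3]]]] := homotopy_at If3.
set a1 := h1^e *m kappa; set a12 := h2'^e *m a1.
have a1cyc : phi2^e *m a1 = 0 by rewrite mulmxA p2h1 mul0mx.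
have a12cyc : phi3^e *m a12 = 0.
  by apply: oppr_inj; rewrite mulmxA -mulNmx -h1p2' -mulmxA a1cyc mulmx0 oppr0.
have phi2a1 d : point_derivation ev d -> phi1^d[d] *m kappa = 0 ->
    exists w, phi2^d[d] *m a1 = d f1 *: kappa - phi2^e *m w.
  move=> dP dk; exists (h1^d[d] *m kappa).
  have /(congr1 (mulmxr kappa)) /= := E1 d dP.
  rewrite !mulmxDl -!mulmxA dk mulmx0 addr0 mul_scalar_mx => ->.
  by rewrite -/a1 !mulmxA addrK.
have phi3a12 d : point_derivation ev d -> d f1 = 0 -> phi1^d[d] *m kappa = 0 ->
    exists w, phi3^d[d] *m a12 = d f2 *: a1 - phi3^e *m w.
  move=> dP df1 dk; have [w wE] := phi2a1 d dP dk.
  exists (h2'^d[d] *m a1 + h2'^e *m w).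
  have /(congr1 (mulmxr a1)) /= := E2 d dP.
  rewrite !mulmxDl -!mulmxA a1cyc mulmx0 add0r mul_scalar_mx wE df1 scale0r add0r.
  rewrite mulmxN [h1'^e *m _]mulmxA h1p2' => ->.
  apply/esym/eqP; rewrite subr_eq mulNmx opprK mulmxDr -!mulmxA !addrA.
  by [].
have a12_0 : a12 = 0.
  have [w] := phi3a12 d3 dP3 d31 k3; rewrite d32 scale0r sub0r => wE.
  have /(congr1 (mulmxr a12)) /= := E3 d3 dP3.
  rewrite mulmxDl -!mulmxA a12cyc mulmx0 add0r d33 mul1mx => ->.
  by rewrite wE mulmxN mulmxA h2p3'' mul0mx oppr0.
have [w3 a1E] : exists w, a1 = phi3^e *m w.
  have [w] := phi3a12 d2 dP2 d21 k2; rewrite d22 scale1r a12_0 mulmx0 => /esym/eqP.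
  by rewrite subr_eq0 => /eqP ->; exists w.
have [w] := phi2a1 d1 dP1 k1; rewrite d11 scale1r => /eqP.
rewrite eq_sym subr_eq => /eqP ->; exists (w - phi3^d[d1] *m w3).
by rewrite a1E mulmxA der23 // mulNmx mulmxBr !mulmxA addrC.
Qed.

(** The homotopy C_4 of [f4] anticommutes with A_1, A_2, A_3 and kills [t], so it sends A_1 A_2 A_3
    t to a boundary. On Tor_0 the composite A_4 C_4 is the identity, hence A_1 A_2 A_3 t = 0, and
    [top_class_neq0] applies. *)
Lemma no_fourth_equation (f4 : P) (d4 : P -> k) (t : 'cV[k]_e) :
  (exists h, f4%:M = phi1 *m h) -> point_derivation ev d4 ->
  d1 f4 = 0 -> d2 f4 = 0 -> d3 f4 = 0 -> d4 f4 = 1 ->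
  phi3^e *m t = 0 -> t = 0.
Proof.
move=> If4 dP4 d14 d24 d34 d44 t0; apply: top_class_neq0 => //.
set a3 := phi3^d[d3] *m t; set a23 := phi2^d[d2] *m a3; set z := _ *m a23.
have a3cyc : phi2^e *m a3 = 0.
  by apply: oppr_inj; rewrite /a3 mulmxA -mulNmx -der23 // -mulmxA t0 mulmx0 oppr0.
have [h0 [h1 [h2 [E0 _ /(_ _ dP1) E1 /(_ _ dP2) E2 /(_ _ dP3) E3]]]] := homotopy_at If4.
have h2a3 : h2^e *m a3 = 0.
  have /(congr1 (mulmxr t)) /= := E3.
  by rewrite mulmxDl -!mulmxA t0 mulmx0 add0r d34 raddf0 mul0mx.
have h1a23 : h1^e *m a23 = - (phi3^e *m (h2^d[d2] *m a3)).
  move: E2; rewrite d24 => /(congr1 (mulmxr a3)) /=.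
  rewrite !mulmxDl -!mulmxA h2a3 a3cyc !mulmx0 add0r add0r raddf0 mul0mx.
  by move/esym/eqP; rewrite addrC addr_eq0 => /eqP.
have h0z : h0^e *m z = - (phi2^e *m (phi3^d[d1] *m (h2^d[d2] *m a3) + h1^d[d1] *m a23)).
  move: E1; rewrite d14 => /(congr1 (mulmxr a23)) /=; rewrite raddf0 mul0mx.
  rewrite !mulmxDl -!mulmxA h1a23 mulmxN [phi2^d[d1] *m _]mulmxA der23 // mulNmx opprK.
  by move/esym/eqP; rewrite addrC addr_eq0 mulmxDr -!mulmxA => /eqP.
have /(congr1 (mulmxr z)) /= := E0 _ dP4.
rewrite d44 mul1mx -mulmxA h0z mulmxN [phi1^d[d4] *m _]mulmxA der12 // mul0mx oppr0.
by [].
Qed.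

End TopClass.
End Clifford.

(** * The contradiction at a smooth point where [y] vanishes *)

Section SpecialComplex.
Variables (k : fieldType) (P : comNzRingType) (I : P -> Prop).
Variables (phi1 : 'M[P]_(1, 4 + 2)) (phi2 : 'M[P]_(4 + 2, 4 + 4))
  (phi3 : 'M[P]_(4 + 4, 1 + 2)).
Hypotheses (primeI : prime_ideal I) (acyc : acyclic3 phi1 phi2 phi3)
  (genI : forall f, I f <-> exists w : 'cV[P]_(4 + 2), f%:M = phi1 *m w)
  (spec : [/\ dlsubmx phi3 = 0, dlsubmx phi2 = 0
     & acyclic3 (lsubmx phi1) (ulsubmx phi2) (ulsubmx phi3)]).
Variable ev0 : {rmorphism P -> k}.
Hypothesis min2 : map_mx ev0 phi2 = 0.

Local Notation "A ^d[ d ]" := (map_mx d A) (at level 2, format "A ^d[ d ]").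
Local Notation y := (ulsubmx phi3 : 'cV[P]_4).
Local Notation phi1' := (lsubmx phi1 : 'rV[P]_4).
Local Notation phi2' := (ulsubmx phi2 : 'M[P]_4).

Lemma special_block3 : lsubmx phi3 = col_mx y 0.
Proof.
case: spec => dl3 _ _.
by rewrite -[phi3 in LHS]submxK block_mxEh row_mxKl dl3.
Qed.

Lemma special_block2 : lsubmx phi2 = col_mx phi2' 0.
Proof.
case: spec => _ dl2 _.
by rewrite -[phi2 in LHS]submxK block_mxEh row_mxKl dl2.
Qed.

(* I annihilates Ext^3(P/I, P), of which P/(y) is a quotient. *)
Lemma ideal_sub_col f : I f -> exists g : 'rV[P]_4, f%:M = g *m y.
Proof.
move=> /genI[h0 E0]; have [h1 [h2 [_ _ E3]]] := null_homotopy acyc E0.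
exists (ulsubmx h2); have := congr1 (fun M : 'M_(1 + 2) => ulsubmx M) E3.
rewrite /= scalar_mx_block block_mxKul => ->.
rewrite -{1}[h2]submxK -{1}[phi3]submxK mulmx_block block_mxKul.
by case: spec => -> _ _; rewrite mulmx0 addr0.
Qed.

(* Otherwise I = (y), although I needs 6 generators. *)
Lemma col_not_in_ideal : exists i, ~ I (y i 0).
Proof.
apply: not_all_ex_not => Iy.
have [b bP] := @ord_choice _ _ (fun i w => (y i 0)%:M = phi1 *m w)
  (fun i => proj1 (genI _) (Iy i)).
pose B := \matrix_(i, j) b j i 0.
have EB : y^T = phi1 *m B.
  apply/matrixP => i j; have /matrixP/(_ 0 0) := bP j.
  rewrite [LHS]mxE mulr1n => E; rewrite ord1 [LHS]mxE E !mxE.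
  by apply: eq_bigr => a _; rewrite !mxE.
have I1 j : I (phi1 0 j).
  apply/genI; exists (delta_mx j 0); apply/matrixP => a c.
  by rewrite !ord1 -colE !mxE mulr1n.
have [g gP] := @ord_choice _ _ _ (fun j => ideal_sub_col (I1 j)).
pose G := \matrix_(i, j) g j 0 i.
have EG : phi1 = y^T *m G.
  apply/matrixP => i j; have /matrixP/(_ 0 0) := gP j.
  rewrite [LHS]mxE mulr1n => E; rewrite ord1 E [LHS]mxE [RHS]mxE.
  by apply: eq_bigr => a _; rewrite !mxE mulrC.
have [ex1 _ _] := acyc.
(* [B] and [G] express [y] and [phi1] by each other, so the columns of [1 - B G] are relations. At
   the origin [phi2] is zero, and the identity of size 6 would factor through dimension 4. *)
have [C EC] : exists C, 1%:M - B *m G = phi2 *m C.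
  by apply: (exact_at_mx ex1); rewrite mulmxBr mulmx1 mulmxA -EB -EG subrr.
have := congr1 (map_mx ev0) EC; rewrite map_mxB !map_mxM min2 mul0mx map_mx1.
move=> /eqP; rewrite subr_eq0 => /eqP E.
have: (\rank (1%:M : 'M[k]_(4 + 2)) <= 4)%N by rewrite E (leq_trans (mxrankM_maxl _ _)) ?rank_leq_col.
by rewrite mxrank1.
Qed.

Section AtPoint.
Variables (iota : {rmorphism k -> P}) (ev : {rmorphism P -> k}).
Local Notation "A ^e" := (map_mx ev A) (at level 2, format "A ^e").
Hypotheses (evK : cancel iota ev) (evI : forall f, I f -> ev f = 0)
  (evy : y^e = 0).

Lemma phi1_at : phi1^e = 0.
Proof.
apply/matrixP => i j; rewrite !mxE evI // ord1; apply/genI.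
exists (delta_mx j 0); apply/matrixP => a c.
by rewrite !ord1 -colE !mxE mulr1n.
Qed.

(** The generator of the last term of the subcomplex. It becomes a class in Tor_3 at the point
    because [y] vanishes there. *)
Let t : 'cV[k]_(1 + 2) := col_mx 1%:M 0.

Lemma mul_top (A : 'M[k]_(4 + 4, 1 + 2)) : A *m t = lsubmx A.
Proof. by rewrite -{1}[A]hsubmxK mul_row_col mulmx1 mulmx0 addr0. Qed.

Lemma top_neq0 : t != 0.
Proof.
apply/eqP => /(congr1 usubmx); rewrite col_mxKu => /matrixP/(_ 0 0).
by rewrite usubmxEsub !mxE => /eqP; rewrite oner_eq0.
Qed.

Lemma top_cycle : phi3^e *m t = 0.
Proof. by rewrite mul_top -map_lsubmx special_block3 map_col_mx evy map_mx0 col_mx0. Qed.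

(** Zero blocks have zero derivatives, so lowering [t] never leaves the subcomplex. *)
Lemma derive_top d1 d2 d3 : point_derivation ev d2 -> point_derivation ev d3 ->
  phi1^d[d1] *m (phi2^d[d2] *m (phi3^d[d3] *m t)) =
  phi1'^d[d1] *m (phi2'^d[d2] *m y^d[d3]).
Proof.
move=> dP2 dP3; rewrite mul_top -map_lsubmx special_block3 map_col_mx (pder_mx0 dP3).
have -> : phi2^d[d2] *m col_mx y^d[d3] 0 = col_mx (phi2'^d[d2] *m y^d[d3]) 0.
  rewrite -{1}[phi2^d[d2]]hsubmxK mul_row_col mulmx0 addr0 -map_lsubmx special_block2.
  by rewrite map_col_mx (pder_mx0 dP2) mul_col_mx mul0mx.
by rewrite -{1}[phi1^d[d1]]hsubmxK mul_row_col mulmx0 addr0 map_lsubmx.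
Qed.

Section Tangent.
Variables (r : nat) (f : 'I_r -> P) (d : 'I_r -> P -> k).
Hypotheses (If : forall i, I (f i)) (dP : forall i, point_derivation ev (d i))
  (dual : forall i j, d i (f j) = (i == j)%:R).

Lemma codim_le3 : (r <= 3)%N.
Proof.
rewrite leqNgt; apply/negP => r4.
pose o (i : 'I_4) : 'I_r := widen_ord r4 i.
have o_inj i j : (o i == o j) = (i == j) by [].
have := top_neq0; apply/negP; rewrite negbK; apply/eqP.
pose Iphi i := proj1 (genI _) (If (o i)).
by apply: (no_fourth_equation acyc phi1_at (Iphi 0) (Iphi 1) (Iphi 2) (dP (o 0)) (dP (o 1))
    (dP (o 2)) _ _ _ _ _ _ (Iphi 3) (dP (o 3))); rewrite ?dual ?o_inj //;
  exact: top_cycle.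
Qed.

End Tangent.

Section Codim3.
Variables (f : 'I_3 -> P) (d : 'I_3 -> P -> k).
Hypotheses (If : forall i, I (f i)) (dP : forall i, point_derivation ev (d i))
  (dual : forall i j, d i (f j) = (i == j)%:R).

(* If a row of phi2' did not vanish at the point, then together with the
   coefficients of f in terms of y it would give four linear equations
   expressing y by f, and y would lie in I. *)
Lemma phi2'_at : phi2'^e = 0.
Proof.
have [h hP] := @ord_choice _ _ _ (fun i => ideal_sub_col (If i)).
apply/matrixP => i0; suff row0 : row i0 phi2'^e = 0.
  by move=> j; have /matrixP/(_ 0 j) := row0; rewrite !mxE.
apply/eqP/negPn/negP => rowN0.
pose H := \matrix_(i, j) h i 0 j : 'M[P]_(3, 4).
pose R := row i0 phi2'.
pose Q : 'M[P]_4 := (col_mx H R : 'M_(3 + 1, 4)).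
have Hy : H *m y = \col_i f i.
  apply/matrixP => i j; have /matrixP/(_ 0 0) := hP i.
  rewrite [LHS]mxE mulr1n => E; rewrite ord1 [RHS]mxE E [LHS]mxE [RHS]mxE.
  by apply: eq_bigr => a _; rewrite [H _ _]mxE.
have Ry : R *m y = 0.
  have [_ _ [_ ex _]] := spec.
  by rewrite /R -row_mul (exact_at_mul0 ex) row0.
(* As [y] vanishes at the point, differentiating [H y = f] and [R y = 0] leaves only the terms with
   derivatives of [y]. *)
pose Y := \matrix_(i, j) d j (y i 0) : 'M[k]_(4, 3).
have colY j : col j Y = y^d[d j] by apply/matrixP => a b; rewrite !mxE ord1.
have HY : H^e *m Y = 1%:M.
  apply/matrixP => i j; have := congr1 (map_mx (d j)) Hy.
  rewrite (pder_mx (dP j)) evy mulmx0 add0r -colY colE mulmxA -colE => /matrixP/(_ i 0).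
  rewrite [LHS]mxE => ->; rewrite !mxE dual eq_sym; by case: eqP.
have RY : R^e *m Y = 0.
  apply/matrixP => i j; have := congr1 (map_mx (d j)) Ry.
  rewrite (pder_mx (dP j)) evy mulmx0 add0r -colY colE mulmxA -colE => /matrixP/(_ i 0).
  by rewrite [LHS]mxE => ->; rewrite !mxE (pder0 (dP j)).
(* A row vector killed by [Q] at the point is multiplied by [Y]: this shows that its first three
   entries are 0, and then the last one is 0 because the row [R] is not. *)
have detQ : ev (\det Q) != 0.
  rewrite -det_map_mx -unitfE -unitmxE -row_free_unit -kermx_eq0.
  apply/eqP/row_matrixP => i.
  rewrite row0; set u := row i _.
  have uQ : u *m Q^e = 0 by rewrite /u -row_mul mulmx_ker row0.
  have E : @lsubmx _ 1 3 1 u *m H^e + @rsubmx _ 1 3 1 u *m R^e = 0.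
    by rewrite -mul_row_col hsubmxK -map_col_mx.
  have /= := congr1 (mulmxr Y) E; rewrite mulmxDl -!mulmxA HY RY mulmx0 addr0 mulmx1 mul0mx => u1.
  rewrite -(@hsubmxK _ 1 3 1 u).
  move: E; rewrite u1 mul0mx add0r.
  have -> : R^e = row i0 phi2'^e by rewrite map_row.
  rewrite [@rsubmx _ 1 3 1 u]mx11_scalar mul_scalar_mx => /eqP; rewrite scaler_eq0 (negbTE rowN0) orbF.
  by move=> /eqP ->; rewrite raddf0 row_mx0.
have [i nIy] := col_not_in_ideal.
have [II _ Ip] := primeI.
(* Cramer's rule: [Q y] has the entries of [f] and 0, all in [I]. Since [I] is prime and [det Q]
   does not vanish at the point, [y] itself would lie in [I]. *)
have : I (\det Q * y i 0).
  have -> : \det Q * y i 0 = (\adj Q *m (Q *m y)) i 0.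
    by rewrite mulmxA mul_adj_mx mul_scalar_mx !mxE.
  rewrite [X in I X]mxE; apply: ideal_sum => // j _; apply: idealM => //.
  have -> : Q *m y = (col_mx (H *m y) (R *m y) : 'cV_(3 + 1)) by rewrite -mul_col_mx.
  rewrite Hy Ry; case: (@split_ordP 3 1 j) => j' ->.
    by rewrite (@col_mxEu _ 3 1 1) mxE.
  by rewrite (@col_mxEd _ 3 1 1) mxE; apply: ideal0.
by case/Ip => [/evI/eqP|//]; rewrite (negbTE detQ).
Qed.

(** The class [t] is used to show that the differentials of the entries of [phi1'] span a space of
    dimension 3. Then constant combinations of these entries are dual to [d], so the subcomplex
    satisfies the hypotheses of [bottom_class] on its own. *)
Lemma special_contradiction : False.
Proof.
pose D := \matrix_(m < 3) (phi1'^d[d m]).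
have rowD m : row m D = phi1'^d[d m] by rewrite rowK.
have phi1'_at : phi1'^e = 0 by rewrite map_lsubmx phi1_at; apply/matrixP => i j; rewrite !mxE.
have freeD : row_free D.
  rewrite -kermx_eq0; apply/eqP/row_matrixP => i; rewrite row0.
  set u := row i _; apply/eqP/negPn/negP => /rV0Pn[m um].
  have uD : u *m D = 0 by rewrite /u -row_mul mulmx_ker row0.
  have [a [b [am bm ab]]] : exists a b : 'I_3, [/\ a != m, b != m & a != b].
    by case: m {um} => [[|[|[|//]]] lt];
      [exists 1, 2 | exists 0, 2 | exists 0, 1].
  (* Scaled so that [d1 (f m) = 1]. Its values on [f a] and [f b] are not controlled, which the
     triangular pairing in [top_class_neq0] allows. It kills the entries of [phi1'], so lowering [t]
     ends in 0. *)
  pose d1 p := \sum_j u 0 j / u 0 m * d j p.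
  have dP1 : point_derivation ev d1.
    split=> p q; rewrite /d1.
      by rewrite -big_split /=; apply: eq_bigr => j _; rewrite (pderD (dP j)) mulrDr.
    rewrite mulr_suml mulr_sumr -big_split /=; apply: eq_bigr => j _.
    by rewrite (pderM (dP j)); ring.
  have := top_neq0; apply/negP; rewrite negbK; apply/eqP.
  apply: (top_class_neq0 acyc phi1_at (f1 := f m) (f2 := f a) (f3 := f b)
    (d1 := d1) (d2 := d a) (d3 := d b)); try exact/genI;
    rewrite ?dual ?eqxx ?(negbTE am) ?(negbTE bm) //.
  - rewrite /d1 (bigD1 m) //= dual eqxx mulr1 divff // big1 ?addr0 // => j jm.
    by rewrite dual (negbTE jm) mulr0.
  - by rewrite eq_sym (negbTE ab).
  - exact: top_cycle.
  rewrite derive_top //.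
  have -> : phi1'^d[d1] = 0.
    apply/matrixP => i' j; have := congr1 (fun M : 'rV_4 => M 0 j) uD.
    rewrite [i']ord1 !mxE => E; rewrite -[RHS](mulr0 (u 0 m)^-1) -E mulr_sumr.
    by apply: eq_bigr => l _; rewrite !mxE mulrCA mulrA mulrC.
  by rewrite mul0mx.
have /row_freeP[W DW] := freeD.
have [kappa Dk k0] : exists2 kappa : 'cV[k]_4, D *m kappa = 0 & kappa != 0.
  have : cokermx D != 0.
    rewrite -mxrank_eq0 mxrank_coker -lt0n subn_gt0.
    by rewrite (leq_ltn_trans (rank_leq_row _)).
  move=> /eqP K0; have [j] : exists j, col j (cokermx D) != 0.
    apply: not_all_not_ex => h; apply: K0; apply/matrixP => i j.
    by have /negP/negPn/eqP/matrixP/(_ i 0) := h j; rewrite !mxE.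
  by exists (col j (cokermx D)) => //; rewrite colE mulmxA mulmx_coker mul0mx.
(* The right inverse [W] of [D], taken as a matrix of constants, selects the combinations of [phi1']
   dual to [d]. *)
pose f' l := (phi1' *m map_mx iota (col l W)) 0 0.
have If' l : exists h, (f' l)%:M = phi1' *m h.
  by exists (map_mx iota (col l W)); rewrite -mx11_scalar.
have dual' m l : d m (f' l) = (m == l)%:R.
  transitivity ((phi1' *m map_mx iota (col l W))^d[d m] 0 0); first by rewrite mxE.
  rewrite (pder_mx (dP m)) phi1'_at mul0mx addr0.
  have -> : (map_mx iota (col l W))^e = col l W.
    by apply/matrixP => i j; rewrite !mxE evK.
  have /matrixP/(_ m l) := DW; rewrite [in RHS]mxE => <-.
  by rewrite -rowD !mxE; apply: eq_bigr => j _; rewrite !mxE.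
have [_ _ acyc'] := spec.
have dk m : phi1'^d[d m] *m kappa = 0 by rewrite -rowD -row_mul Dk row0.
have [w] := bottom_class acyc' phi1'_at (If' 0) (If' 1) (If' 2) (dP 0) (dP 1) (dP 2)
  (dual' _ _) (dual' _ _) (dual' _ _) (dual' _ _) (dual' _ _) (dual' _ _)
  (dual' _ _) (dual' _ _) (dual' _ _) (dk _) (dk _) (dk _).
by rewrite phi2'_at mul0mx => /eqP; rewrite (negbTE k0).
Qed.

End Codim3.
End AtPoint.
End SpecialComplex.

(** * Depth *)

Section ExactnessModulo.
Variable P : comNzRingType.
Implicit Types J : P -> Prop.

Definition ideal_mx J (m n : nat) (M : 'M[P]_(m, n)) : Prop := forall i j, J (M i j).

Definition exact_mod J (l m n : nat) (phi : 'M[P]_(l, m)) (psi : 'M[P]_(m, n)) :=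
  forall v : 'cV[P]_m, ideal_mx J (phi *m v) -> exists w : 'cV[P]_n, ideal_mx J (v - psi *m w).

Section Ideal.
Variable J : P -> Prop.
Hypothesis IJ : ideal J.

Lemma ideal_mxD m n (M N : 'M[P]_(m, n)) : ideal_mx J M -> ideal_mx J N -> ideal_mx J (M + N).
Proof. by move=> hM hN i j; rewrite mxE; apply: idealD. Qed.
Lemma ideal_mxN m n (M : 'M[P]_(m, n)) : ideal_mx J M -> ideal_mx J (- M).
Proof. by move=> hM i j; rewrite mxE; apply: idealN. Qed.
Lemma ideal_mxMr l m n (M : 'M[P]_(l, m)) (N : 'M[P]_(m, n)) :
  ideal_mx J N -> ideal_mx J (M *m N).
Proof. by move=> hN i j; rewrite mxE; apply: ideal_sum => // a _; apply: idealM. Qed.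

Lemma adjoin_mx (w : P) m n (M : 'M[P]_(m, n)) :
  ideal_mx (adjoin J w) M -> exists U : 'M[P]_(m, n), ideal_mx J (M - w *: U).
Proof.
move=> h.
have [g gP] := @ord_choice _ _ _ (fun i => @ord_choice _ _ _ (fun j => h i j)).
by exists (\matrix_(i, j) g i j) => i j; rewrite !mxE mulrC; apply: gP.
Qed.

Section Step.
Variable w : P.

(* The long exact sequence of Tor for multiplication by [w] on [P/J]. *)
Lemma exact_mod_adjoin (l m n : nat) (phi : 'M[P]_(l, m)) (psi : 'M[P]_(m, n)) :
  exact_mod J phi psi ->
  (forall u : 'cV[P]_l, (exists v : 'cV[P]_m, ideal_mx J (w *: u - phi *m v)) ->
    exists v : 'cV[P]_m, ideal_mx J (u - phi *m v)) ->
  exact_mod (adjoin J w) phi psi.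
Proof.
move=> ex reg v /adjoin_mx[u hu].
have [v' hv'] : exists v : 'cV[P]_m, ideal_mx J (u - phi *m v).
  by apply: reg; exists v; rewrite -opprB; apply: ideal_mxN.
have [t ht] : exists t : 'cV[P]_n, ideal_mx J (v - w *: v' - psi *m t).
  apply: ex; rewrite mulmxBr -scalemxAr.
  rewrite -(subrKA (w *: u)) -scalerBr; apply: ideal_mxD => //.
  by move=> i j; rewrite mxE; apply: idealM.
exists t => i j; exists (v' i j); move: (ht i j); rewrite !mxE.
by congr J; ring.
Qed.

(** Exactness embeds the cokernel of [phi] modulo [J] into a free module over [P/J], on which a
    nonzerodivisor acts injectively. *)
Lemma regular_of_exact (q l m : nat) (psi : 'M[P]_(q, l)) (phi : 'M[P]_(l, m)) :
  exact_mod J psi phi -> psi *m phi = 0 -> (forall a, J (w * a) -> J a) ->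
  forall u : 'cV[P]_l, (exists v : 'cV[P]_m, ideal_mx J (w *: u - phi *m v)) ->
    exists v : 'cV[P]_m, ideal_mx J (u - phi *m v).
Proof.
move=> ex z reg u [v hv]; apply: ex => i j; apply: reg.
have := ideal_mxMr psi hv i j.
by rewrite mulmxBr mulmxA z mul0mx subr0 -scalemxAr mxE.
Qed.

End Step.
End Ideal.

Lemma exact_mod0 (l m n : nat) (phi : 'M[P]_(l, m)) (psi : 'M[P]_(m, n)) :
  exact_at phi psi -> exact_mod (eq 0) phi psi.
Proof.
move=> ex v h; have /ex[u uE] : phi *m v = 0 by apply/matrixP => i j; rewrite -h mxE.
by exists u => i j; rewrite uE subrr mxE.
Qed.

Lemma injective_exact_mod0 (l m : nat) (phi : 'M[P]_(l, m)) :
  injective_mx phi -> exact_mod (eq 0) phi (0 : 'M_(m, 0)).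
Proof.
move=> inj v h; have /inj -> : phi *m v = 0 by apply/matrixP => i j; rewrite -h mxE.
by exists 0 => i j; rewrite mulmx0 subrr mxE.
Qed.

Lemma zero_ideal : ideal (eq (0 : P)).
Proof.
by split=> // [a b <- <-|a b <-]; rewrite ?addr0 ?mulr0.
Qed.

End ExactnessModulo.

Section Origin.
Variables (k : fieldType) (n : nat).
Local Notation A := {poly k}.
Local Notation P := {mpoly A[n]}.
Local Notation z := (('X : A)%:MP_[n] : P).

(** The ideal (z, x_0, .., x_(j-1)). The index is a plain number, so steps beyond [n] need a
    meaning: they add nothing. *)
Fixpoint coord_ideal (j : nat) : P -> Prop :=
  if j is j'.+1 then
    if insub j' is Some i then adjoin (coord_ideal j') 'X_(i : 'I_n) else coord_ideal j'
  else adjoin (eq 0) z.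

Definition coord_kill (j : nat) : {rmorphism P -> P} :=
  mpoly_hom (@mpolyC n A \o polyC \o horner_eval 0 : {rmorphism A -> P})
    (fun i : 'I_n => if (i < j)%N then 0 else 'X_i).

Lemma coord_killC j c : coord_kill j c%:MP = (c.[0]%:P)%:MP.
Proof. exact: mpoly_homC. Qed.

Lemma coord_killX j i : coord_kill j 'X_i = if (i < j)%N then 0 else 'X_i.
Proof. exact: mpoly_homX. Qed.

Lemma ideal_coord j : ideal (coord_ideal j).
Proof.
elim: j => [|j IH] /=; first exact/adjoin_ideal/zero_ideal.
by case: insub => [i|//]; apply: adjoin_ideal.
Qed.

Lemma coord_ideal_le j j' f : (j <= j')%N -> coord_ideal j f -> coord_ideal j' f.
Proof.
apply: ascending => {j j' f} j f /=.
by case: insub => [i|//]; apply: adjoin_sub.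
Qed.

Lemma coord_idealX j (i : 'I_n) : (i < j)%N -> coord_ideal j 'X_i.
Proof.
move=> /coord_ideal_le; apply => /=; rewrite valK.
exact/adjoin_gen/ideal_coord.
Qed.

(** The quotient is realized as the image of a substitution inside the domain [P]. Membership
    becomes an equation, and regularity of the next variable becomes cancellation. *)
Lemma coord_idealP j f : coord_ideal j f <-> coord_kill j f = 0.
Proof.
have IJ := ideal_coord.
split=> [|f0].
  elim: j f => [|j IH] f /=.
    case=> b /eqP; rewrite eq_sym subr_eq0 => /eqP ->.
    change (coord_kill 0 (b * z) = 0).
    by rewrite rmorphM coord_killC hornerX polyC0 mpolyC0 mulr0.
  have killS g : coord_kill j g = 0 -> coord_kill j.+1 g = 0.
    suff E : coord_kill j.+1 (coord_kill j g) = coord_kill j.+1 g.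
      move=> g0. rewrite -E. rewrite g0. rewrite raddf0. reflexivity.
    elim/mpoly_gen_ind: g => [p q Ep Eq|p q Ep Eq|c|i].
    - by rewrite !rmorphD Ep Eq.
    - by rewrite !rmorphM Ep Eq.
    - by rewrite !coord_killC hornerC.
    - by rewrite !coord_killX; case: ifP => [/ltnW|_]; rewrite ?coord_killX // ltnS => ->; rewrite rmorph0.
  case: insubP => [i _ ij|_ /IH/killS//] [b /IH/killS].
  rewrite rmorphB rmorphM coord_killX ij ltnSn mulr0 subr0; apply.
suff: coord_ideal j (f - coord_kill j f) by rewrite f0 subr0.
elim/mpoly_gen_ind: f {f0} => [p q Jp Jq|p q Jp Jq|c|i].
- by rewrite rmorphD opprD addrACA; apply: idealD.
- rewrite rmorphM (_ : _ - _ = (p - coord_kill j p) * q + coord_kill j p * (q - coord_kill j q)).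
    by apply: idealD => //; [apply: idealMl | apply: idealM].
  by rewrite mulrBl mulrBr subrKA.
- rewrite coord_killC; apply: (coord_ideal_le (leq0n j)) => /=.
  have /factor_theorem[q qE] : root (c - c.[0]%:P) 0.
    by rewrite /root !hornerE subrr.
  by exists q%:MP; rewrite -mpolyCB qE subr0 mpolyCM subrr.
- rewrite coord_killX; case: ifP => [lt|_]; last by rewrite subrr; apply: ideal0.
  by rewrite subr0; apply: coord_idealX.
Qed.

Lemma coord_regular j (i : 'I_n) f : (j <= i)%N ->
  coord_ideal j ('X_i * f) -> coord_ideal j f.
Proof.
move=> le /coord_idealP; rewrite rmorphM coord_killX ltnNge le /= => /eqP.
rewrite mulf_eq0 => /orP[/eqP X0|/eqP f0]; last exact/coord_idealP.
have /(congr1 (mcoeff U_(i))) := X0; rewrite mcoeffX eqxx mcoeff0 => /eqP.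
by rewrite oner_eq0.
Qed.

(* For n <= 3 the depth of P/I at the origin is too large for a minimal
   resolution of length 3. *)
Lemma length3_codim_ge3 (b c d : nat) (phi1 : 'M[P]_(1, b)) (phi2 : 'M[P]_(b, c))
    (phi3 : 'M[P]_(c, d.+1)) (I : P -> Prop) :
  acyclic3 phi1 phi2 phi3 -> (forall f, I f <-> exists w : 'cV[P]_b, f%:M = phi1 *m w) ->
  ideal_mx (coord_ideal n) phi3 ->
  (forall u, I (z * u) -> I u) ->
  (forall (i : 'I_n) u, (adjoin I z) ('X_i * u) -> adjoin I z u) ->
  (0 < n)%N -> (3 < n)%N.
Proof.
move=> [ex1 ex2 inj3] genI min3 zreg xreg n0; rewrite ltnNge; apply/negP => n3.
have z12 := exact_at_mul0 ex1; have z23 := exact_at_mul0 ex2.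
have IJ := ideal_coord.
have I0 := @zero_ideal P.
have zreg0 (a : P) : 0 = z * a -> 0 = a.
  move=> /esym/eqP; rewrite mulf_eq0 => /orP[|/eqP//].
  by rewrite mpolyC_eq0 polyX_eq0.
have stepB j (i : 'I_n) (q l m m' : nat) (ps : 'M[P]_(q, l)) (ph : 'M[P]_(l, m)) (ps' : 'M[P]_(m, m')) :
    exact_mod (coord_ideal j) ps ph -> ps *m ph = 0 -> val i = j ->
    exact_mod (coord_ideal j) ph ps' -> exact_mod (coord_ideal j.+1) ph ps'.
  move=> e1 e2 ij e3 /=; rewrite -ij valK ij; apply: exact_mod_adjoin => //.
  by apply: regular_of_exact e1 e2 _ => // a; apply: coord_regular; rewrite ij.
(* [Eij] states that Tor_i(P/I, P/coord_ideal j) = 0. By [stepB], [Eij] and the statement one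
   position to the left give the statement for [j + 1]. The column i = 1 has to be fed from outside:
   by the regularity of [z] on P/I, and of x_0 on P/(I, z). *)
have E30 : exact_mod (coord_ideal 0) phi3 (0 : 'M_(d.+1, 0)).
  apply: exact_mod_adjoin => //; first exact: injective_exact_mod0.
  exact: regular_of_exact (exact_mod0 ex2) z23 zreg0.
have E20 : exact_mod (coord_ideal 0) phi2 phi3.
  apply: exact_mod_adjoin => //; first exact: exact_mod0.
  exact: regular_of_exact (exact_mod0 ex1) z12 zreg0.
have genI' (u : 'cV[P]_1) (w : 'cV[P]_b) : ideal_mx (eq 0) (u - phi1 *m w) -> u = phi1 *m w.
  by move=> h; apply/eqP; rewrite -subr_eq0; apply/eqP/matrixP => i j; rewrite -h mxE.
have E10 : exact_mod (coord_ideal 0) phi1 phi2.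
  apply: exact_mod_adjoin => //; first exact: exact_mod0.
  move=> u [v hv]; have Iu : I (z * u 0 0).
    by apply/genI; exists v; rewrite -(genI' _ _ hv) [u in RHS]mx11_scalar scale_scalar_mx.
  have [w hw] := proj1 (genI _) (zreg _ Iu).
  by exists w => i j; rewrite -hw -mx11_scalar subrr mxE.
have E31 : exact_mod (coord_ideal 1) phi3 (0 : 'M_(d.+1, 0)).
  exact: (stepB _ (Ordinal n0) _ _ _ _ _ _ _ E20 z23).
have E21 : exact_mod (coord_ideal 1) phi2 phi3.
  exact: (stepB _ (Ordinal n0) _ _ _ _ _ _ _ E10 z12).
(* For [j = n] the ideal is that of the origin, modulo which [phi3] is zero, so it cannot be
   injective on its nonempty set of columns. *)
have fin j : j = n -> exact_mod (coord_ideal j) phi3 (0 : 'M_(d.+1, 0)) -> False.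
  move=> -> E; have [|w] := E (delta_mx 0 0).
    by move=> i l; rewrite ord1 -colE mxE.
  move=> /(_ 0 0); rewrite mul0mx subr0 mxE /= => /coord_idealP.
  by rewrite rmorph1 => /eqP; rewrite oner_eq0.
have [n1|n1] := eqVneq n 1%N; first by apply: (fin 1%N).
have n2 : (1 < n)%N by lia.
have E32 : exact_mod (coord_ideal 2) phi3 (0 : 'M_(d.+1, 0)).
  exact: (stepB _ (Ordinal n2) _ _ _ _ _ _ _ E21 z23).
have [n2'|n2'] := eqVneq n 2%N; first by apply: (fin 2%N).
have n3' : (2 < n)%N by lia.
have E11 : exact_mod (coord_ideal 1) phi1 phi2.
  have -> : coord_ideal 1 = adjoin (coord_ideal 0) 'X_(Ordinal n0).
    by rewrite -[1%N]/(val (Ordinal n0)).+1 [LHS]/= -[0%N]/(val (Ordinal n0)) valK.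
  apply: exact_mod_adjoin; [exact: (IJ 0%N) | exact: E10 | move=> u [v hv]].
  have Iadj (t : P) : (exists w : 'cV[P]_b, ideal_mx (coord_ideal 0) (t%:M - phi1 *m w)) <-> adjoin I z t.
    split=> [[w]|[a /genI[w hw]]].
      case/(_ 0 0) => a /esym/eqP; rewrite subr_eq0 !mxE eqxx mulr1n => /eqP E.
      exists a; apply/genI; exists w; apply/matrixP => i j; rewrite !ord1 [LHS]mxE mulr1n mxE.
      by rewrite -E subKr.
    exists w => i j; exists a; apply/esym/eqP; rewrite !ord1 subr_eq0 -hw !mxE eqxx !mulr1n.
    by rewrite subKr.
  have [|w hw] := proj2 (Iadj (u 0 0)).
    apply: (xreg (Ordinal n0)); apply/Iadj; exists v.
    by rewrite -scale_scalar_mx -mx11_scalar.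
  by exists w; rewrite [u]mx11_scalar.
have E22 : exact_mod (coord_ideal 2) phi2 phi3.
  exact: (stepB _ (Ordinal n2) _ _ _ _ _ _ _ E11 z12).
apply: (fin 3%N); first by lia.
exact: (stepB _ (Ordinal n3') _ _ _ _ _ _ _ E22 z23).
Qed.

End Origin.

(** * The family over k[z] *)

Lemma noetherian_field (k : fieldType) : noetherian k.
Proof.
move=> J IJ Jasc.
have [[i [a Ja a0]]|h] := classic (exists i, exists2 a, J i a & a != 0).
  by exists i => j b _; rewrite -(mulfVK a0 b); apply: idealM.
exists 0%N => i a Ja; have [->|a0] := eqVneq a 0; first exact: ideal0 (IJ 0%N).
by case: h; exists i, a.
Qed.

Section Weights.
Variables (k : fieldType) (n : nat) (s : n.-tuple nat).
Local Notation A := {poly k}.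
Local Notation P := {mpoly A[n]}.
Local Notation z := (('X : A)%:MP_[n] : P).

Definition cst (c : k) : P := (c%:P)%:MP.

Lemma cst_is_zmod : zmod_morphism cst.
Proof. by move=> a b; rewrite /cst polyCB mpolyCB. Qed.
Lemma cst_is_monoid : monoid_morphism cst.
Proof. by split=> [|a b]; rewrite /cst ?polyCM ?mpolyCM. Qed.
HB.instance Definition _ := GRing.isZmodMorphism.Build k P cst cst_is_zmod.
HB.instance Definition _ := GRing.isMonoidMorphism.Build k P cst cst_is_monoid.

Lemma family_ring_ind (Q : P -> Prop) :
  (forall p q, Q p -> Q q -> Q (p + q)) -> (forall p q, Q p -> Q q -> Q (p * q)) ->
  (forall c, Q (cst c)) -> Q z -> (forall i, Q 'X_i) -> forall p, Q p.
Proof.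
move=> QD QM Qc Qz QX; apply: mpoly_gen_ind => // c.
elim/poly_ind: c => [|p c Qp]; first by rewrite -[0]/(0%:P); exact: Qc.
by rewrite mpolyCD mpolyCM; apply: (QD); [apply: QM | exact: Qc].
Qed.

Definition mono (j : nat) (m : 'X_{1..n}) : P := z ^+ j * 'X_[m].

Lemma monoE j m : mono j m = ('X^j : A) *: 'X_[m].
Proof. by rewrite /mono -rmorphXn /= mul_mpolyC. Qed.

Lemma mono_expansion (f : P) :
  f = \sum_(m <- msupp f) \sum_(j < size f@_m) cst (f@_m)`_j * mono j m.
Proof.
rewrite {1}(mpolyE f); apply: eq_bigr => m _.
rewrite -{1}[f@_m]coefK poly_def scaler_suml; apply: eq_bigr => j _.
by rewrite monoE /cst mul_mpolyC scalerA mul_polyC.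
Qed.

(** The action of the multiplicative group with weight 1 on [z] and weights [s] on the variables.
    The coefficients of the image are the homogeneous components; as the map is a ring morphism,
    degrees of products are found by computing. *)
Definition wscale : {rmorphism P -> {poly P}} :=
  mpoly_hom ((horner_eval (z%:P * 'X) \o map_poly (polyC \o cst)) : {rmorphism A -> {poly P}})
    (fun i => ('X_i)%:P * 'X^(tnth s i)).

Lemma wscale_cst c : wscale (cst c) = (cst c)%:P.
Proof. by rewrite /wscale mpoly_homC /= map_polyC /horner_eval hornerC. Qed.
Lemma wscale_z : wscale z = z%:P * 'X.
Proof. by rewrite /wscale mpoly_homC /= map_polyX /horner_eval hornerX. Qed.
Lemma wscaleX i : wscale 'X_i = ('X_i)%:P * 'X^(tnth s i).
Proof. by rewrite /wscale mpoly_homX. Qed.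

Definition whomog (d : nat) (f : P) : Prop := wscale f = f%:P * 'X^d.

Lemma wscale_mono j m : whomog (j + wdeg s m) (mono j m).
Proof.
rewrite /whomog /mono rmorphM rmorphXn wscale_z exprMn exprD polyCM rmorphXn /=.
rewrite -!mulrA; congr (_ * _); rewrite mulrCA; congr (_ * _).
rewrite mpolyXE_id !rmorph_prod /wdeg /= -prodrXr -big_split /=.
by apply: eq_bigr => i _; rewrite !rmorphXn /= wscaleX exprMn -exprM.
Qed.

Lemma whomogM d e f g : whomog d f -> whomog e g -> whomog (d + e) (f * g).
Proof. by rewrite /whomog rmorphM => -> ->; rewrite polyCM exprD; ring. Qed.

Lemma whomogD d f g : whomog d f -> whomog d g -> whomog d (f + g).
Proof. by rewrite /whomog rmorphD => -> ->; rewrite polyCD mulrDl. Qed.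

Lemma whomog0 d : whomog d 0.
Proof. by rewrite /whomog rmorph0 polyC0 mul0r. Qed.

Lemma whomog_sum d (I : Type) (r : seq I) (Q : pred I) F :
  (forall i, Q i -> whomog d (F i)) -> whomog d (\sum_(i <- r | Q i) F i).
Proof. by move=> h; elim/big_ind: _; [exact: whomog0 | exact: whomogD |]. Qed.

Lemma whomog_cst c : whomog 0 (cst c).
Proof. by rewrite /whomog wscale_cst expr0 mulr1. Qed.

Definition wcomp d f := (wscale f)`_d.

Lemma wcomp_whomog d e f : whomog d f -> wcomp e f = if e == d then f else 0.
Proof.
rewrite /wcomp => ->; rewrite coefCM coefXn; case: eqP; by rewrite ?mulr1 ?mulr0.
Qed.

Lemma wcomp_sum d (I : Type) (r : seq I) (Q : pred I) F :
  wcomp d (\sum_(i <- r | Q i) F i) = \sum_(i <- r | Q i) wcomp d (F i).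
Proof. by rewrite /wcomp rmorph_sum coef_sum. Qed.

Lemma wcompP d f : whomog d (wcomp d f).
Proof.
rewrite [f]mono_expansion wcomp_sum; apply: whomog_sum => m _.
rewrite wcomp_sum; apply: whomog_sum => j _.
have h := whomogM (whomog_cst (f@_m)`_j) (wscale_mono j m).
by rewrite (wcomp_whomog _ h); case: eqP => [->//|_]; apply: whomog0.
Qed.

Lemma wcompM d e f g : whomog e g ->
  wcomp d (f * g) = if (e <= d)%N then wcomp (d - e) f * g else 0.
Proof.
move=> hg; rewrite /wcomp rmorphM hg mulrA coefMXn ltnNge; case: leqP => //= _.
by rewrite coefMC.
Qed.

Lemma wcomp_mono d f : wcomp d f =
  \sum_(m <- msupp f) \sum_(j < size f@_m | (d == j + wdeg s m)%N) cst (f@_m)`_j * mono j m.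
Proof.
rewrite {1}[f]mono_expansion wcomp_sum; apply: eq_bigr => m _.
rewrite wcomp_sum [RHS]big_mkcond /=; apply: eq_bigr => j _.
by rewrite (wcomp_whomog _ (whomogM (whomog_cst (f@_m)`_j) (wscale_mono j m))).
Qed.

(** * A dimension count for homogeneous equations *)

Section Counting.
Variables (r : nat) (y : 'I_r -> P) (e : 'I_r -> nat) (D : nat).
Hypothesis y_homog : forall i, whomog (e i).+1 (y i).

Definition yprod (a : 'I_r -> nat) : P := \prod_i y i ^+ a i.

(** Only exponents are bounded, by [D] in the variables and by [w] in the [y i]. The spanning set
    then has D^(n+1) (w+1)^r elements, which grows like w^r. *)
Inductive yspan (w : nat) : P -> Prop :=
| yspan0 : yspan w 0
| yspanD f g : yspan w f -> yspan w g -> yspan w (f + g)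
| yspanG c j (m : 'X_{1..n}) (a : 'I_r -> nat) : (j < D)%N -> (forall i, m i < D)%N -> (forall i, a i <= w)%N ->
    yspan w (cst c * (mono j m * yprod a)).

Lemma yspanZ w c f : yspan w f -> yspan w (cst c * f).
Proof.
elim=> [|g h _ IHg _ IHh|c' j m a jD mD aw]; rewrite ?mulr0 ?mulrDr.
- exact: yspan0.
- exact: yspanD.
- by rewrite mulrA -rmorphM; apply: yspanG.
Qed.

Lemma yspan_sum w (I : Type) (t : seq I) (Q : pred I) F :
  (forall i, Q i -> yspan w (F i)) -> yspan w (\sum_(i <- t | Q i) F i).
Proof. by move=> h; elim/big_ind: _; [exact: yspan0 | exact: yspanD |]. Qed.

Lemma yspanS w w' f : (w <= w')%N -> yspan w f -> yspan w' f.
Proof.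
move=> le; elim=> [|g h _ IHg _ IHh|c j m a jD mD aw]; [exact: yspan0 | exact: yspanD |].
by apply: yspanG => // i; apply: leq_trans (aw i) le.
Qed.

Lemma yspanM w f i : yspan w f -> yspan w.+1 (f * y i).
Proof.
elim=> [|g h _ IHg _ IHh|c j m a jD mD aw]; rewrite ?mul0r ?mulrDl.
- exact: yspan0.
- exact: yspanD.
- have yE : yprod (fun l => (l == i) + a l)%N = yprod a * y i.
    rewrite /yprod (bigD1 i) //= [in RHS](bigD1 i) //= eqxx exprS.
    rewrite [X in _ = X]mulrAC [y i ^+ _ * y i]mulrC; congr (_ * _).
    by apply: eq_bigr => l /negbTE ->.
  rewrite -mulrA -[_ * yprod a * _]mulrA -yE.
  apply: yspanG => // l; case: eqP => _; last exact/leqW/aw.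
  by rewrite add1n ltnS aw.
Qed.

Hypothesis powers : forall (v : P), v = z \/ (exists i, v = 'X_i) ->
  exists a : 'I_r -> P, v ^+ D = \sum_i a i * y i.

(** A graded Nakayama argument: a monomial with an exponent at least [D] contains some [v ^+ D],
    hence is a combination of the [y i] with coefficients of smaller degree, because the [y i] have
    positive degree. For the same reason no [y i] occurs more than [d] times in degree [d]. *)
Lemma whomog_yspan d f : whomog d f -> yspan d f.
Proof.
elim/ltn_ind: d f => d IH f hf.
have -> : f = wcomp d f by rewrite (wcomp_whomog _ hf) eqxx.
rewrite wcomp_mono; apply: yspan_sum => m _; apply: yspan_sum => j /eqP dE.
apply: yspanZ; move: (nat_of_ord j) dE => {}j dE.
have step v wv j' m' : v = z \/ (exists i, v = 'X_i) -> whomog wv v ->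
    mono j m = v ^+ D * mono j' m' -> (d = D * wv + (j' + wdeg s m'))%N ->
    yspan d (mono j m).
  move=> /powers[a aE] hv -> dE'.
  have hvD : whomog (D * wv) (v ^+ D).
    elim: (D) => [|l IHl]; first by rewrite mul0n expr0 -(rmorph1 cst); apply: whomog_cst.
    by rewrite mulSn exprS; apply: whomogM.
  have vDE : v ^+ D = \sum_i wcomp (D * wv) (a i * y i).
    by rewrite -wcomp_sum -aE (wcomp_whomog _ hvD) eqxx.
  rewrite vDE mulr_suml; apply: yspan_sum => i _.
  rewrite (wcompM _ _ (y_homog i)); case: ifP => [le|_]; last by rewrite mul0r; apply: yspan0.
  rewrite mulrAC.
  have ltd : (D * wv - (e i).+1 + (j' + wdeg s m') < d)%N by lia.
  apply: (yspanS (w := (D * wv - (e i).+1 + (j' + wdeg s m')).+1)) => //.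
  apply: yspanM; apply: IH => //; apply: whomogM; first exact: wcompP.
  exact: wscale_mono.
have [jD|Dj] := ltnP j D; last first.
  apply: (step z 1%N (j - D)%N m); [by left | by rewrite /whomog wscale_z | | ].
    by rewrite /mono mulrA -exprD subnKC.
  by rewrite dE muln1 addnA subnKC.
have [[i Dm]|mD] := classic (exists i, (D <= m i)%N); last first.
  rewrite -[mono j m]mul1r -(rmorph1 cst) -[mono j m]mulr1.
  have -> : (1 : P) = yprod (fun=> 0%N) by rewrite /yprod big1.
  apply: yspanG => // i; rewrite ltnNge; apply/negP => h; apply: mD; by exists i.
pose m' := (m - U_(i) *+ D)%MM.
have mE : m = (U_(i) *+ D + m')%MM.
  by rewrite addmC submK //; apply/mnm_lepP => l; rewrite mulmnE mnm1E; case: eqP => [<-|]; rewrite ?mul1n ?mul0n.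
apply: (step 'X_i (tnth s i) j m').
- by right; exists i.
- exact: wscaleX.
- by rewrite /mono {1}mE mpolyXD mpolyXn; ring.
- rewrite dE {1}mE addnCA; congr (_ + _)%N.
  rewrite /wdeg; under eq_bigr do rewrite mnmDE mulnDr.
  rewrite big_split /=; congr (_ + _)%N.
  rewrite (bigD1 i) //= big1 => [|l li]; rewrite mulmnE mnm1E; first by rewrite eqxx mul1n addn0 mulnC.
  by rewrite eq_sym (negbTE li) mul0n muln0.
Qed.

Lemma yspan_gen (w : nat) : exists gen : {ffun 'I_n.+1 -> 'I_D} * {ffun 'I_r -> 'I_w.+1} -> P,
  forall f, yspan w f -> exists c, f = \sum_x cst (c x) * gen x.
Proof.
pose G (x : {ffun 'I_n.+1 -> 'I_D} * {ffun 'I_r -> 'I_w.+1}) : P :=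
  mono (x.1 ord0) [multinom x.1 (lift ord0 i) : nat | i < n] * yprod (fun i => x.2 i).
exists G => f; elim=> [|g h _ [c ->] _ [d ->]|c j m a jD mD aw].
- by exists (fun=> 0); rewrite big1 // => x _; rewrite rmorph0 mul0r.
- by exists (fun x => c x + d x); rewrite -big_split; apply: eq_bigr => x _; rewrite rmorphD mulrDl.
pose x1 : {ffun 'I_n.+1 -> 'I_D} :=
  [ffun i => if unlift ord0 i is Some l then Ordinal (mD l) else Ordinal jD].
pose x2 : {ffun 'I_r -> 'I_w.+1} := [ffun i => Ordinal (aw i : (a i < w.+1)%N)].
exists (fun x => if x == (x1, x2) then c else 0).
rewrite (bigD1 (x1, x2)) //= eqxx big1 ?addr0 => [|x /negbTE ->]; last by rewrite rmorph0 mul0r.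
congr (_ * _); rewrite /G; congr (_ * _); last first.
  by apply: eq_bigr => i _; rewrite ffunE.
rewrite ffunE unlift_none; congr mono; apply/mnmP => i.
by rewrite mnmE ffunE liftK.
Qed.

(** By [whomog_yspan], [P] is a finite module over the algebra of the [y i]. With at most [n] of
    them it would grow too slowly for a ring of [n + 1] independent variables. *)
Lemma counting_bound : (n < r)%N.
Proof.
rewrite ltnNge; apply/negP => rn.
pose wt := (1 + \sum_i tnth s i)%N.
(* Monomials with exponents at most [L] have weight at most [w], and there are (L+1)^(n+1) of them.
   The spanning set has D^(n+1) (w+1)^r elements, which is at most L (L+1)^r because w + 1 is at
   most wt (L+1). *)
pose L := (D ^ n.+1 * wt ^ r)%N.
pose w := (L * wt)%N.
have [gen genP] := yspan_gen w.
pose X := {ffun 'I_n.+1 -> 'I_L.+1}.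
pose mon (x : X) := mono (x ord0) [multinom x (lift ord0 i) : nat | i < n].
have monS x : yspan w (mon x).
  apply: yspanS (whomog_yspan (wscale_mono _ _)).
  rewrite /w /wt mulnDr muln1 leq_add //; first by rewrite -ltnS.
  rewrite big_distrr /= /wdeg; apply: leq_sum => i _; rewrite mulnC leq_mul2r mnmE.
  by rewrite -ltnS ltn_ord orbT.
have [c cE] : exists c : X -> _ -> k, forall x, mon x = \sum_t cst (c x t) * gen t.
  exists (fun x => proj1_sig (constructive_indefinite_description _ (genP _ (monS x)))).
  by move=> x; case: constructive_indefinite_description.
set Y := ({ffun 'I_n.+1 -> 'I_D} * {ffun 'I_r -> 'I_w.+1})%type in gen genP c cE.
pose M : 'M[k]_(#|{: X}|, #|{: Y}|) := \matrix_(i, j) c (enum_val i) (enum_val j).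
have ltYX : (#|{: Y}| < #|{: X}|)%N.
  rewrite card_prod !card_ffun !card_ord.
  have le1 : (w.+1 <= wt * L.+1)%N by rewrite /w mulnS (mulnC wt L) -add1n leq_add2r /wt leq_addr.
  apply: (@leq_ltn_trans (D ^ n.+1 * (wt * L.+1) ^ r)).
    rewrite leq_mul2l; apply/orP; right.
    by case: (r) => [|r']; rewrite ?expn0 // leq_exp2r.
  rewrite expnMn mulnA -/L.
  apply: (@leq_trans (L.+1 ^ r.+1)); last by rewrite leq_pexp2l.
  by rewrite expnS ltn_pmul2r // expn_gt0.
have : kermx M != 0.
  rewrite -mxrank_eq0 mxrank_ker -lt0n subn_gt0.
  exact: leq_ltn_trans (rank_leq_col _) ltYX.
move=> /rowV0Pn[u /sub_kermxP uM /rV0Pn[i0 ui0]].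
have : \sum_i cst (u 0 i) * mon (enum_val i) = 0.
  under eq_bigr do rewrite cE mulr_sumr.
  rewrite exchange_big big1 //= => t _.
  under eq_bigr do rewrite mulrA -rmorphM.
  rewrite -mulr_suml -rmorph_sum /=.
  have /matrixP/(_ 0 (enum_rank t)) := uM; rewrite !mxE => E.
  rewrite (_ : \sum_i _ = 0) ?rmorph0 ?mul0r // -[RHS]E.
  by apply: eq_bigr => i _; rewrite mxE enum_rankK.
pose m0 : 'X_{1..n} := [multinom (enum_val i0 : X) (lift ord0 i) : nat | i < n].
move=> /(congr1 (fun f : P => (f@_m0)`_((enum_val i0 : X) ord0))).
rewrite mcoeff0 coef0 raddf_sum coef_sum (bigD1 i0) //= big1 ?addr0.
  rewrite /mon monoE /cst mcoeffCM mcoeffZ mcoeffX eqxx mulr1 coefCM coefXn eqxx mulr1.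
  by move/eqP; rewrite (negbTE ui0).
move=> i ii0; rewrite /mon monoE /cst mcoeffCM mcoeffZ mcoeffX coefCM.
case: eqP => [E|_]; rewrite ?mulr0 ?coef0 ?mulr0 // mulr1 coefXn.
case: eqP => [E'|_]; rewrite ?mulr0 //.
case/eqP: ii0; apply: enum_val_inj; apply/ffunP => l; apply: val_inj.
case: (unliftP ord0 l) => [l'|] -> //.
by have /mnmP/(_ l') := E; rewrite !mnmE.
Qed.

End Counting.
End Weights.

Section CommonZero.
Variables (k : closedFieldType) (n : nat) (s : n.-tuple nat).
Local Notation A := {poly k}.
Local Notation P := {mpoly A[n]}.
Local Notation z := (('X : A)%:MP_[n] : P).

Lemma nullstellensatz_family :
  noetherian P /\ nullstellensatz (@cst k n : {rmorphism k -> P}).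
Proof.
have [noeP nullP] := nullstellensatz_mpoly (noetherian_poly (@noetherian_field k))
  (nullstellensatz_poly (@nullstellensatz_field k) (@noetherian_field k)) n.
by split.
Qed.

(** Otherwise the Nullstellensatz puts a power of every variable into the ideal of the [y i], and
    the dimension count gives [n < r]. *)
Lemma homog_common_zero (r : nat) (y : 'I_r -> P) (e : 'I_r -> nat) :
  (forall i, whomog s (e i).+1 (y i)) -> (r <= n)%N ->
  exists ev : {rmorphism P -> k}, [/\ cancel (@cst k n) ev, forall i, ev (y i) = 0
    & ev z != 0 \/ exists i, ev 'X_i != 0].
Proof.
move=> hy rn.
pose J f := exists a : 'I_r -> P, f = \sum_i a i * y i.
have IJ : ideal J.
  split.
  - by exists (fun=> 0); rewrite big1 // => i _; rewrite mul0r.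
  - move=> _ _ [a ->] [b ->]; exists (fun i => a i + b i).
    by rewrite -big_split; apply: eq_bigr => i _; rewrite mulrDl.
  - move=> c _ [a ->]; exists (fun i => c * a i).
    by rewrite mulr_sumr; apply: eq_bigr => i _; rewrite mulrA.
have Jy i : J (y i).
  exists (fun j => (j == i)%:R); rewrite (bigD1 i) //= eqxx mul1r big1 ?addr0 // => j /negbTE ->.
  by rewrite mul0r.
apply: NNPP => nopt.
have pow v : v = z \/ (exists i, v = 'X_i) -> exists D, J (v ^+ D).
  move=> hv; apply: NNPP => /not_ex_all_not/((proj2 nullstellensatz_family) J v IJ).
  case=> ev [h1 h2 h3]; apply: nopt; exists ev; split=> // [i|]; first exact: h2.
  by case: hv => [<-|[i vE]]; [left | right; exists i; rewrite -vE].
have [Dz JDz] := pow z (or_introl erefl).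
have [Dx JDx] := @ord_choice _ _ _ (fun i => pow 'X_i (or_intror (ex_intro _ i erefl))).
pose D := (Dz + \sum_i Dx i)%N.
suff : (n < r)%N by rewrite ltnNge rn.
apply: (@counting_bound _ _ s _ y e D hy) => _ [->|[i ->]].
  by rewrite exprD; apply: (idealMl IJ).
by rewrite /D (bigD1 i) //= addnCA exprD; apply: (idealMl IJ).
Qed.

End CommonZero.

(** * Functions with poles at one point *)

(* [pole_le n f]: the function f is regular except for a pole of order at most
   n at p, and [lead n f] is the coefficient of that pole. *)
Record pole_filtration (k : fieldType) (S : pred nat) := PoleFiltration {
  function_field : fieldType;
  const : {rmorphism k -> function_field};
  pole_le : nat -> function_field -> Prop;
  lead : nat -> function_field -> k;
  pole_le1 : pole_le 0 1;
  pole_leP : forall n c f g, pole_le n f -> pole_le n g -> pole_le n (const c * f + g);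
  pole_leM : forall n m f g, pole_le n f -> pole_le m g -> pole_le (n + m) (f * g);
  lead1 : lead 0 1 = 1;
  leadP : forall n c f g, pole_le n f -> pole_le n g ->
    lead n (const c * f + g) = c * lead n f + lead n g;
  leadM : forall n m f g, pole_le n f -> pole_le m g ->
    lead (n + m) (f * g) = lead n f * lead m g;
  pole_leS : forall n f, pole_le n f -> pole_le n.+1 f /\ lead n.+1 f = 0;
  lead_eq0 : forall n f, pole_le n.+1 f -> lead n.+1 f = 0 -> pole_le n f;
  lead0_eq0 : forall f, pole_le 0 f -> lead 0 f = 0 -> f = 0;
  pole_order_semigroup : forall n, S n <-> exists2 f, pole_le n f & lead n f != 0;
  pole_le_normal : forall f g, g != 0 ->
    (forall j, exists n, pole_le n (g * f ^+ j)) -> exists n, pole_le n f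
}.

(** * Free modules are flat *)

Section FreeFlat.
Variables (A : comNzRingType) (B : lmodType A).
Variables (coord : nat -> B -> A) (basis : nat -> B).
Hypotheses (coordP : forall i a b c, coord i (a *: b + c) = a * coord i b + coord i c)
  (coordE : forall b, exists N, forall M, (N <= M)%N -> b = \sum_(i < M) coord i b *: basis i).

(** Testing the vanishing over [N] on the bilinear maps that send [u] and [b] to [coord i b *: u]
    kills every coordinate in [N], hence in [M] by injectivity; and the coordinates determine the
    tensor. *)
Lemma free_flat : flat B.
Proof.
move=> M N f injf z hz T beta.
have coordD i b c : coord i (b + c) = coord i b + coord i c.
  by rewrite -[b]scale1r coordP scale1r mul1r.
have coordZ i a b : coord i (a *: b) = a * coord i b.
  have coord0 : coord i 0 = 0 by apply: (addrI (coord i 0)); rewrite -coordD !addr0.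
  by rewrite -[a *: b]addr0 coordP coord0 addr0.
have coord_z i : \sum_(x <- z) coord i x.2 *: x.1 = 0.
  apply: injf; rewrite linear0 linear_sum /=.
  pose b0 (u : N) (b : B) : N := coord i b *: u.
  have b0P : bilinear_for *:%R *:%R b0.
    split=> [b|u] a x1 x2; rewrite /b0 /=.
      by rewrite scalerDr !scalerA mulrC.
    by rewrite coordP scalerDl scalerA.
  pose F := HB.pack_for {bilinear N -> B -> N} b0 (bilinear_isBilinear.Build _ _ _ _ _ _ b0 b0P).
  have := hz N F; rewrite big_map /= /b0 => E; rewrite -[RHS]E.
  by apply: eq_bigr => x _; rewrite linearZ.
have [K hK] : exists K, forall x, x \in z -> x.2 = \sum_(i < K) coord i x.2 *: basis i.
  suff [K hK] : exists K, forall K', (K <= K')%N ->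
      forall x, x \in z -> x.2 = \sum_(i < K') coord i x.2 *: basis i.
    by exists K => x; apply: hK.
  elim: (z) => [|x t [K hK]]; first by exists 0%N.
  have [N0 hN0] := coordE x.2; exists (maxn N0 K) => K'; rewrite geq_max => /andP[h1 h2] x0.
  by rewrite inE => /predU1P[->|]; [apply: hN0 | apply: hK].
transitivity (\sum_(x <- z) \sum_(i < K) beta (coord i x.2 *: x.1) (basis i)).
  apply: eq_big_seq => x xz; rewrite {1}(hK x xz) linear_sumr; apply: eq_bigr => i _.
  by rewrite linearZr_LR linearZl_LR.
rewrite exchange_big big1 //= => i _.
by rewrite -linear_sumlz /= coord_z linear0l.
Qed.

End FreeFlat.

Section Filtration.
Variables (k : fieldType) (S : pred nat) (D : pole_filtration k S).
Local Notation L := (function_field D).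
Local Notation iota := (@const k S D).
Local Notation F := (@pole_le k S D).
Local Notation lc := (@lead k S D).

Lemma pole_leW n m f : (n <= m)%N -> F n f -> F m f.
Proof. by apply: (ascending (J := F)) => i a /pole_leS[]. Qed.
Lemma pole_le_const n c : F n (iota c).
Proof.
have F0 : F 0 0 by rewrite -(addNr 1) -[-1]mulr1 -[-1](rmorphN1 iota); apply: pole_leP; exact: pole_le1.
apply: (pole_leW (leq0n n)); rewrite -[iota c]mulr1 -[_ * 1]addr0.
by apply: pole_leP => //; exact: pole_le1.
Qed.
Lemma pole_le0 n : F n 0. Proof. by rewrite -(rmorph0 iota); apply: pole_le_const. Qed.
Lemma pole_leD n f g : F n f -> F n g -> F n (f + g).
Proof. by move=> Ff Fg; rewrite -[f]mul1r -(rmorph1 iota); apply: pole_leP. Qed.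
Lemma pole_leZ n c f : F n f -> F n (iota c * f).
Proof. by move=> Ff; rewrite -[_ * f]addr0; apply: pole_leP => //; apply: pole_le0. Qed.
Lemma pole_leN n f : F n f -> F n (- f).
Proof. by move=> Ff; rewrite -mulN1r -(rmorphN1 iota); apply: pole_leZ. Qed.
Lemma pole_leB n f g : F n f -> F n g -> F n (f - g).
Proof. by move=> Ff Fg; apply: pole_leD => //; apply: pole_leN. Qed.
Lemma pole_le_sum n (I : Type) (r : seq I) (Q : pred I) G :
  (forall i, Q i -> F n (G i)) -> F n (\sum_(i <- r | Q i) G i).
Proof. by move=> h; elim/big_ind: _; [exact: pole_le0 | exact: pole_leD |]. Qed.
Lemma pole_leX n m f : F n f -> F (m * n) (f ^+ m).
Proof.
move=> Ff; elim: m => [|m IH]; first by rewrite expr0; exact: pole_le1.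
by rewrite exprS mulSn; apply: pole_leM.
Qed.
Lemma pole_le_prod (I : Type) (r : seq I) (n : I -> nat) (G : I -> L) :
  (forall i, F (n i) (G i)) -> F (\sum_(i <- r) n i) (\prod_(i <- r) G i).
Proof.
move=> h; elim: r => [|i r IH]; first by rewrite !big_nil; exact: pole_le1.
by rewrite !big_cons; apply: pole_leM.
Qed.

Lemma lead0 n : lc n 0 = 0.
Proof.
have := leadP (-1) (pole_le0 n) (pole_le0 n).
by rewrite mulr0 addr0 mulN1r addNr.
Qed.
Lemma leadD n f g : F n f -> F n g -> lc n (f + g) = lc n f + lc n g.
Proof. by move=> Ff Fg; rewrite -[f]mul1r -(rmorph1 iota) leadP // rmorph1 !mul1r. Qed.
Lemma leadZ n c f : F n f -> lc n (iota c * f) = c * lc n f.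
Proof. by move=> Ff; rewrite -[_ * f]addr0 leadP ?lead0 ?addr0 //; apply: pole_le0. Qed.
Lemma leadN n f : F n f -> lc n (- f) = - lc n f.
Proof. by move=> Ff; rewrite -mulN1r -(rmorphN1 iota) leadZ // mulN1r. Qed.
Lemma leadB n f g : F n f -> F n g -> lc n (f - g) = lc n f - lc n g.
Proof. by move=> Ff Fg; rewrite leadD ?leadN //; apply: pole_leN. Qed.
Lemma lead_sum n (I : Type) (r : seq I) (Q : pred I) G :
  (forall i, Q i -> F n (G i)) ->
  lc n (\sum_(i <- r | Q i) G i) = \sum_(i <- r | Q i) lc n (G i).
Proof.
move=> h; elim: r => [|i r IH]; rewrite ?big_nil ?lead0 // !big_cons.
by case: ifP => Qi //; rewrite leadD ?IH //; [apply: h | apply: pole_le_sum].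
Qed.
Lemma lead_const n c : lc n (iota c) = if n is 0 then c else 0.
Proof.
case: n => [|n]; last by have [_ ->] := pole_leS (pole_le_const n c).
by rewrite -[iota c]mulr1 leadZ ?lead1 ?mulr1 //; exact: pole_le1.
Qed.
Lemma leadX n m f : F n f -> lc (m * n) (f ^+ m) = lc n f ^+ m.
Proof.
move=> Ff; elim: m => [|m IH]; first by rewrite !expr0 lead1.
by rewrite !exprS mulSn leadM ?IH //; apply: pole_leX.
Qed.
Lemma lead_prod (I : Type) (r : seq I) (n : I -> nat) (G : I -> L) :
  (forall i, F (n i) (G i)) ->
  lc (\sum_(i <- r) n i) (\prod_(i <- r) G i) = \prod_(i <- r) lc (n i) (G i).
Proof.
move=> h; elim: r => [|i r IH]; first by rewrite !big_nil lead1.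
by rewrite !big_cons leadM ?IH //; apply: pole_le_prod.
Qed.

Lemma semigroup_function n : S n -> exists2 f, F n f & lc n f = 1.
Proof.
move=> /(pole_order_semigroup D)[f Ff lf]; exists (iota (lc n f)^-1 * f).
  exact: pole_leZ.
by rewrite leadZ // mulVf.
Qed.

Lemma exact_pole n f : F n f -> f != 0 ->
  exists2 m, (m <= n)%N & [/\ S m, F m f & lc m f != 0].
Proof.
move=> Fn f0; elim: n Fn => [|n IH] Fn.
  exists 0%N => //; have l0 : lc 0 f != 0 by apply: contraNneq f0 => /lead0_eq0 ->.
  by split=> //; apply/(pole_order_semigroup D); exists f.
have [l0|l0] := eqVneq (lc n.+1 f) 0.
  by have [m le h] := IH (lead_eq0 Fn l0); exists m => //; apply: leqW.
by exists n.+1 => //; split=> //; apply/(pole_order_semigroup D); exists f.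
Qed.

Lemma lead_lt m n f : (m < n)%N -> F m f -> lc n f = 0.
Proof. by case: n => // n; rewrite ltnS => le /(pole_leW le)/pole_leS[]. Qed.

Lemma pole_basis_subproof s : exists f, F s f /\ (S s -> lc s f = 1).
Proof.
have [/semigroup_function[f Ff lf]|nS] := boolP (S s); first by exists f.
by exists 0; split=> //; apply: pole_le0.
Qed.

(** At a gap of [S] the value carries no information. Expansions are required to have coefficient 0
    there, so that they are unique although the index runs over all of [nat]. *)
Definition pole_basis s : L :=
  proj1_sig (constructive_indefinite_description _ (pole_basis_subproof s)).

Lemma pole_le_basis s : F s (pole_basis s).
Proof. by rewrite /pole_basis; case: constructive_indefinite_description => f []. Qed.

Lemma lead_basis s : S s -> lc s (pole_basis s) = 1.
Proof. by rewrite /pole_basis; case: constructive_indefinite_description => f []. Qed.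

Definition expansion (c : nat -> k) (f : L) : Prop :=
  (forall s, ~~ S s -> c s = 0) /\
  exists N, (forall s, (N <= s)%N -> c s = 0) /\ f = \sum_(s < N) iota (c s) * pole_basis s.

Lemma expansion_widen N M (c : nat -> k) : (N <= M)%N -> (forall s, (N <= s)%N -> c s = 0) ->
  \sum_(s < M) iota (c s) * pole_basis s = \sum_(s < N) iota (c s) * pole_basis s.
Proof.
move=> le c0; rewrite -!(big_mkord xpredT (fun s => iota (c s) * pole_basis s)).
rewrite (big_cat_nat _ le) //= [X in _ + X = _]big_nat_cond [X in _ + X = _]big1 ?addr0 // => s.
by rewrite andbT => /andP[/c0 -> _]; rewrite rmorph0 mul0r.
Qed.

Lemma pole_basis_free N (c : nat -> k) : (forall s, ~~ S s -> c s = 0) ->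
  \sum_(s < N) iota (c s) * pole_basis s = 0 -> forall s, (s < N)%N -> c s = 0.
Proof.
move=> cS; elim: N => [//|N IH]; rewrite big_ord_recr /= => E.
have Fs (s : 'I_N) : F s (iota (c s) * pole_basis s).
  by apply: pole_leZ; apply: pole_le_basis.
have cN : c N = 0.
  have [SN|/cS//] := boolP (S N).
  have FsN (s : 'I_N) : F N (iota (c s) * pole_basis s).
    by apply: pole_leW (Fs s); apply: ltnW.
  have FN : F N (iota (c N) * pole_basis N) by apply: pole_leZ; apply: pole_le_basis.
  have /(congr1 (lc N)) := E; rewrite lead0 leadD //; last exact: pole_le_sum.
  rewrite lead_sum // big1 ?add0r => [|s _]; last by apply: lead_lt (Fs s).
  by rewrite leadZ ?lead_basis ?mulr1 //; apply: pole_le_basis.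
move=> s; rewrite ltnS leq_eqVlt => /predU1P[->//|]; apply: IH.
by move: E; rewrite cN rmorph0 mul0r addr0.
Qed.

Lemma expansion_exists n f : F n f ->
  exists c, expansion c f /\ forall s, (n < s)%N -> c s = 0.
Proof.
elim: n f => [|n IH] f Ff.
  exists (fun s => if s is 0 then lc 0 f / lc 0 (pole_basis 0) else 0).
  have S0 : S 0%N.
    apply/(pole_order_semigroup D); exists 1; [exact: pole_le1 | by rewrite lead1 oner_eq0].
  split; last by case.
  split; first by case=> // /negP; rewrite S0.
  exists 1%N; split; first by case.
  rewrite big_ord1 /= lead_basis // divr1; apply/eqP; rewrite -subr_eq0; apply/eqP.
  apply: lead0_eq0.
    by apply: pole_leB => //; apply: pole_leZ; apply: pole_le_basis.
  rewrite leadB ?leadZ ?lead_basis ?mulr1 ?subrr //; try exact: pole_le_basis.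
  by apply: pole_leZ; apply: pole_le_basis.
pose a := if S n.+1 then lc n.+1 f else 0.
have Fb : F n.+1 (iota a * pole_basis n.+1) by apply: pole_leZ; apply: pole_le_basis.
have [|c [[cS [N [cN E]]] cn]] := IH (f - iota a * pole_basis n.+1).
  apply: lead_eq0; first exact: pole_leB.
  rewrite leadB // leadZ; last exact: pole_le_basis.
  rewrite /a; case: ifP => [Sn|nS]; first by rewrite lead_basis ?mulr1 ?subrr.
  rewrite mul0r subr0; apply/eqP/negPn/negP => l0.
  by have : S n.+1; [apply/(pole_order_semigroup D); exists f | rewrite nS].
pose c' s := if s == n.+1 then a else c s.
have cn1 : c n.+1 = 0 by apply: cn.
have c'n s : (n.+1 < s)%N -> c' s = 0.
  by move=> lt; rewrite /c' gtn_eqF // cn // ltnW.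
have c'S s : ~~ S s -> c' s = 0.
  by move=> nSs; rewrite /c'; case: eqP => [Es|_]; [rewrite /a -Es (negbTE nSs) | apply: cS].
exists c'; split=> //; split=> //; exists n.+2; split=> //.
have {E} E : f - iota a * pole_basis n.+1 = \sum_(s < n.+1) iota (c s) * pole_basis s.
  have M1 : (N <= maxn N n.+1)%N by rewrite leq_maxl.
  have M2 : (n.+1 <= maxn N n.+1)%N by rewrite leq_maxr.
  by rewrite E -(expansion_widen M1) // (expansion_widen M2).
rewrite big_ord_recr /= {2}/c' eqxx -[LHS](subrK (iota a * pole_basis n.+1)) E; congr (_ + _).
by apply: eq_bigr => s _; rewrite /c' ltn_eqF.
Qed.

Lemma expansion_unique c d f : expansion c f -> expansion d f -> forall s, c s = d s.
Proof.
move=> [cS [N [cN fc]]] [dS [M [dM fd]]] s.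
have [le|lt] := leqP (maxn N M) s.
  by move: le; rewrite geq_max => /andP[/cN -> /dM ->].
apply/eqP; rewrite -subr_eq0; apply/eqP.
apply: (pole_basis_free (c := fun s => c s - d s)) lt => [t nS|]; first by rewrite cS // dS // subrr.
under eq_bigr do rewrite rmorphB mulrBl.
rewrite sumrB (expansion_widen (leq_maxl N M)) // (expansion_widen (leq_maxr N M)) //.
by rewrite -fc -fd subrr.
Qed.

Definition coordinate (s : nat) (f : L) : k :=
  if excluded_middle_informative (exists c, expansion c f) is left h
  then proj1_sig (constructive_indefinite_description _ h) s else 0.

Lemma coordinateE c f s : expansion c f -> coordinate s f = c s.
Proof.
move=> cf; rewrite /coordinate; case: excluded_middle_informative => [h|[]]; last by exists c.
by case: constructive_indefinite_description => d df /=; apply: expansion_unique df cf _.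
Qed.

Lemma coordinate_gt n s f : F n f -> (n < s)%N -> coordinate s f = 0.
Proof. by move=> /expansion_exists[c [cf cn]] /cn; rewrite (coordinateE _ cf). Qed.

Lemma coordinateP n s c f g : F n f -> F n g ->
  coordinate s (iota c * f + g) = c * coordinate s f + coordinate s g.
Proof.
move=> /expansion_exists[a [ha an]] /expansion_exists[b [hb bn]].
have h : expansion (fun s => c * a s + b s) (iota c * f + g).
  case: ha hb => [aS [N [aN ->]]] [bS [M [bM ->]]]; split=> [t nS|].
    by rewrite aS // bS // mulr0 addr0.
  exists (maxn N M); split=> [t|].
    by rewrite geq_max => /andP[/aN -> /bM ->]; rewrite mulr0 addr0.
  rewrite -(expansion_widen (leq_maxl N M)) // -(expansion_widen (leq_maxr N M)) //.
  rewrite mulr_sumr -big_split /=; apply: eq_bigr => t _.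
  by rewrite rmorphD rmorphM mulrDl mulrA.
by rewrite (coordinateE _ h) (coordinateE _ ha) (coordinateE _ hb).
Qed.

Lemma coordinateD n s f g : F n f -> F n g ->
  coordinate s (f + g) = coordinate s f + coordinate s g.
Proof.
by move=> Ff Fg; have := coordinateP s 1 Ff Fg; rewrite rmorph1 !mul1r.
Qed.

Lemma coordinate0 s : coordinate s 0 = 0.
Proof.
have := coordinateP s (-1) (pole_le0 0) (pole_le0 0).
by rewrite mulr0 addr0 mulN1r addNr.
Qed.

Lemma coordinate_sum n s (I : Type) (r : seq I) (Q : pred I) G :
  (forall i, Q i -> F n (G i)) ->
  coordinate s (\sum_(i <- r | Q i) G i) = \sum_(i <- r | Q i) coordinate s (G i).
Proof.
move=> h; elim: r => [|i r IH]; rewrite ?big_nil ?coordinate0 // !big_cons.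
case: ifP => Qi //.
by rewrite (coordinateD _ (h i Qi) (pole_le_sum r h)) IH.
Qed.

Lemma coordinateZ n s c f : F n f -> coordinate s (iota c * f) = c * coordinate s f.
Proof.
move=> Ff; rewrite -[_ * f]addr0 (coordinateP (n := n)) //; last exact: pole_le0.
by rewrite coordinate0 addr0.
Qed.

Lemma coordinate_expansion n f : F n f ->
  f = \sum_(s < n.+1) iota (coordinate s f) * pole_basis s.
Proof.
move=> /expansion_exists[c [cf cn]].
under eq_bigr do rewrite (coordinateE _ cf).
case: cf => _ [N [cN ->]].
rewrite -(expansion_widen (leq_maxl N n.+1)) // (expansion_widen (leq_maxr N n.+1)) //.
Qed.

End Filtration.

(** * The Rees algebra *)

Section Rees.
Variables (k : fieldType) (S : pred nat) (D : pole_filtration k S).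
Local Notation L := (function_field D).
Local Notation iota := (@const k S D).
Local Notation F := (@pole_le k S D).
Local Notation lc := (@lead k S D).
Local Notation A := {poly k}.

(** The Rees algebra inside [{poly L}], with [z] acting as 'X: a nonzero value for 'X gives back the
    ring of functions, and 'X = 0 leaves only the leading coefficients, that is, k[S]. *)
Definition rees_pred : {pred {poly L}} := fun q =>
  if excluded_middle_informative (forall i, F i q`_i) then true else false.

Lemma rees_predP (q : {poly L}) : reflect (forall i, F i q`_i) (q \in rees_pred).
Proof. by rewrite unfold_in /rees_pred; case: excluded_middle_informative => h; constructor. Qed.

Lemma rees_subring : subring_closed rees_pred.
Proof.
split.
- apply/rees_predP => i; rewrite coef1 -(rmorph_nat iota); exact: pole_le_const.
- move=> p q /rees_predP hp /rees_predP hq; apply/rees_predP => i.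
  by rewrite coefB; apply: pole_leB.
- move=> p q /rees_predP hp /rees_predP hq; apply/rees_predP => i.
  rewrite coefM; apply: pole_le_sum => j _.
  by rewrite -[i in F i](subnKC (leq_ord j)); apply: pole_leM.
Qed.
HB.instance Definition _ := GRing.isSubringClosed.Build {poly L} rees_pred rees_subring.

Record rees := Rees {rees_val : {poly L}; _ : rees_val \in rees_pred}.
HB.instance Definition _ := [isSub for rees_val].
HB.instance Definition _ := [Choice of rees by <:].
HB.instance Definition _ := [SubChoice_isSubComNzRing of rees by <:].

Lemma rees_const_subproof (a : A) : map_poly iota a \in rees_pred.
Proof. by apply/rees_predP => i; rewrite coef_map; apply: pole_le_const. Qed.

Definition rees_const (a : A) : rees := Rees (rees_const_subproof a).

Lemma rees_const_zmod : zmod_morphism rees_const.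
Proof. by move=> a b; apply: val_inj; rewrite /= rmorphB. Qed.
Lemma rees_const_monoid : monoid_morphism rees_const.
Proof. by split=> [|a b]; apply: val_inj; rewrite /= ?rmorph1 ?rmorphM. Qed.
HB.instance Definition _ := GRing.isZmodMorphism.Build A rees rees_const rees_const_zmod.
HB.instance Definition _ := GRing.isMonoidMorphism.Build A rees rees_const rees_const_monoid.

Definition rees_scale (a : A) (b : rees) : rees := rees_const a * b.
Lemma rees_scaleA a b c : rees_scale a (rees_scale b c) = rees_scale (a * b) c.
Proof. by rewrite /rees_scale rmorphM mulrA. Qed.
Lemma rees_scale1 : left_id 1 rees_scale.
Proof. by move=> b; rewrite /rees_scale rmorph1 mul1r. Qed.
Lemma rees_scaleDr : right_distributive rees_scale +%R.
Proof. by move=> a b c; rewrite /rees_scale mulrDr. Qed.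
Lemma rees_scaleDl b : {morph rees_scale^~ b : a a' / a + a'}.
Proof. by move=> a a'; rewrite /rees_scale rmorphD mulrDl. Qed.
HB.instance Definition _ := GRing.Zmodule_isLmodule.Build A rees
  rees_scaleA rees_scale1 rees_scaleDr rees_scaleDl.
Lemma rees_scaleAl (a : A) (b c : rees) : a *: (b * c) = a *: b * c.
Proof. by rewrite /GRing.scale /= /rees_scale mulrA. Qed.
HB.instance Definition _ := GRing.Lmodule_isLalgebra.Build A rees rees_scaleAl.
HB.instance Definition _ := GRing.Lalgebra_isComAlgebra.Build A rees.

Lemma rees_scaleE (a : A) (b : rees) : a *: b = rees_const a * b. Proof. by []. Qed.

(** The basis element of index [s] sits in degree [s], so the coefficient of its multiple by z^j is
    read off in degree [j + s]. *)
Definition rees_coord (s : nat) (b : rees) : A :=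
  \poly_(j < size (val b)) coordinate s (val b)`_(j + s).

Lemma rees_valP (b : rees) i : F i (val b)`_i.
Proof. exact: (rees_predP _ (valP b)). Qed.

Lemma coef_rees_coord s b j : (rees_coord s b)`_j = coordinate s (val b)`_(j + s).
Proof.
rewrite coef_poly; case: ltnP => // le.
by rewrite nth_default ?coordinate0 // (leq_trans le) // leq_addr.
Qed.

Lemma rees_basis_subproof s : pole_basis D s *: 'X^s \in rees_pred.
Proof.
apply/rees_predP => i; rewrite coefZ coefXn; case: eqP => [->|_].
  by rewrite mulr1; apply: pole_le_basis.
by rewrite mulr0; apply: pole_le0.
Qed.
Definition rees_basis s : rees := Rees (rees_basis_subproof s).

Lemma rees_flat : flat (rees : comAlgType A).
Proof.
apply: (free_flat (coord := rees_coord) (basis := rees_basis)) => [s a b c|b].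
- apply/polyP => j; rewrite coefD coefM !coef_rees_coord.
  rewrite [val _](_ : _ = map_poly iota a * val b + val c) // coefD.
  have Fp : F (j + s) (map_poly iota a * val b)`_(j + s).
    by have /= := rees_valP (rees_const a * b) (j + s).
  rewrite (coordinateD s Fp (rees_valP c _)); congr (_ + _).
  have Fi (i : 'I_(j + s).+1) : F (j + s) ((map_poly iota a)`_i * (val b)`_(j + s - i)).
    rewrite coef_map; apply: pole_leZ.
    by apply: pole_leW (rees_valP b _); apply: leq_subr.
  rewrite coefM (coordinate_sum s _ (fun i _ => Fi i)).
  rewrite (big_ord_widen (j + s).+1 (fun i => a`_i * (rees_coord s b)`_(j - i))) ?ltnS ?leq_addr //.
  rewrite [RHS]big_mkcond /=; apply: eq_bigr => i _.
  rewrite coef_map (coordinateZ _ _ (pole_leW (leq_subr i _) (rees_valP b _))) coef_rees_coord.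
  case: ltnP => [le|lt]; first by rewrite addnBAC.
  by rewrite (coordinate_gt (rees_valP b _)) ?mulr0 //; have := ltn_ord i; move: lt; clear; lia.
- exists (size (val b)) => M le; apply: val_inj; apply/polyP => d.
  rewrite raddf_sum coef_sum.
  under eq_bigr => s _.
    have -> : (val (rees_coord s b *: rees_basis s))`_d =
        iota (coordinate s (val b)`_d) * pole_basis D s.
      rewrite rees_scaleE /= -scalerAr coefZ mulrC coefMXn.
      case: ltnP => [lt|le']; last by rewrite coef_map coef_rees_coord subnK.
      by rewrite (coordinate_gt (rees_valP b d) lt) rmorph0 mul0r.
    over.
  rewrite /=; have [ltd|led] := ltnP d M; last first.
    rewrite nth_default ?(leq_trans le) // big1 // => s _.
    by rewrite coordinate0 rmorph0 mul0r.
  rewrite (@expansion_widen _ _ D d.+1 M (fun s => coordinate s (val b)`_d) ltd) => [|s lt]; last exact: coordinate_gt (rees_valP b d) lt.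
  exact: (coordinate_expansion (rees_valP b d)).
Qed.

End Rees.

Section PolynomialGrading.
Variable k : fieldType.
Local Notation A := {poly k}.

Definition monomial_part (d : nat) (a : A) : Prop := exists c : k, a = c *: 'X^d.

Lemma monomial_part_coef d a : monomial_part d a -> a = a`_d *: 'X^d.
Proof. by case=> c ->; rewrite coefZ coefXn eqxx mulr1. Qed.

Lemma monomial_part0 d : monomial_part d 0.
Proof. by exists 0; rewrite scale0r. Qed.
Lemma monomial_partP d (c : k) a b :
  monomial_part d a -> monomial_part d b -> monomial_part d (c *: a + b).
Proof. by move=> [a' ->] [b' ->]; exists (c * a' + b'); rewrite scalerA scalerDl. Qed.
Lemma monomial_part_one : monomial_part 0 1.
Proof. by exists 1; rewrite scale1r expr0. Qed.
Lemma monomial_partM i j a b :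
  monomial_part i a -> monomial_part j b -> monomial_part (i + j) (a * b).
Proof.
move=> [a' ->] [b' ->]; exists (a' * b').
by rewrite -scalerAl -scalerAr scalerA exprD.
Qed.
Lemma monomial_part_span (a : A) : exists N (c : nat -> A),
  (forall i, monomial_part i (c i)) /\ a = \sum_(i < N) c i.
Proof.
exists (size a), (fun i => a`_i *: 'X^i); split; first by move=> i; exists a`_i.
by rewrite -{1}[a]coefK poly_def.
Qed.
Lemma monomial_part_free N (c : nat -> A) :
  (forall i, monomial_part i (c i)) -> \sum_(i < N) c i = 0 ->
  forall i, (i < N)%N -> c i = 0.
Proof.
move=> hc c0 i lt; rewrite (monomial_part_coef (hc i)).
have := congr1 (fun a : A => a`_i) c0; rewrite coef0 coef_sum.
rewrite (bigD1 (Ordinal lt)) //= big1 ?addr0 => [->|j ji]; first by rewrite scale0r.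
rewrite (monomial_part_coef (hc j)) coefZ coefXn.
by case: eqP => [E|]; rewrite ?mulr0 //; case/eqP: ji; apply: val_inj.
Qed.

Definition poly_grading : grading A := Grading monomial_part0 monomial_partP monomial_part_one
  monomial_partM monomial_part_span monomial_part_free.

Lemma poly_finitely_generated : finitely_generated (A : comAlgType k).
Proof.
pose g : {rmorphism {mpoly k[1]} -> A} := mpoly_hom (@polyC k) (fun=> 'X).
have gZ : scalable (g : {mpoly k[1]} -> A).
  by move=> c p; rewrite -mul_mpolyC rmorphM /g mpoly_homC mul_polyC.
pose G := HB.pack_for {lrmorphism {mpoly k[1]} -> A} (g : {mpoly k[1]} -> A)
  (GRing.isZmodMorphism.Build _ _ (g : {mpoly k[1]} -> A) (rmorphB g))
  (GRing.isMonoidMorphism.Build _ _ (g : {mpoly k[1]} -> A) (conj (rmorph1 g) (rmorphM g)))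
  (GRing.isScalable.Build _ _ _ _ (g : {mpoly k[1]} -> A) gZ).
exists 1%N, G => a; elim/poly_ind: a => [|p c [q qE]]; first by exists 0; rewrite /= rmorph0.
exists (q * 'X_ord0 + c%:MP); move: qE; change (g q = p -> g (q * 'X_ord0 + c%:MP) = p * 'X + c%:P).
by move=> <-; rewrite rmorphD rmorphM /g mpoly_homX mpoly_homC.
Qed.

Variables (n : nat) (s : n.-tuple nat).
Local Notation P := {mpoly A[n]}.
Local Notation ph := (phomog poly_grading s).

Lemma phomogD d f g : ph d f -> ph d g -> ph d (f + g).
Proof.
move=> hf hg m; have := hf m; have := hg m; rewrite mcoeffD.
case: ifP => _; last by move=> -> ->; rewrite addr0.
by move=> [a ->] [b ->]; exists (b + a); rewrite scalerDl.
Qed.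

Lemma phomog_mono c j m : ph (j + wdeg s m) (cst n c * mono k j m).
Proof.
move=> m'; rewrite monoE /cst mcoeffCM mcoeffZ mcoeffX.
case: eqP => [<-|_]; last by rewrite !mulr0; case: ifP => // _; exact: monomial_part0.
by rewrite leq_addl addnK mulr1 mul_polyC; exists c.
Qed.

Lemma phomog_sum d (I : Type) (r : seq I) (Q : pred I) G :
  (forall i, Q i -> ph d (G i)) -> ph d (\sum_(i <- r | Q i) G i).
Proof.
move=> h; elim/big_ind: _ => [m||//]; last exact: phomogD.
by rewrite mcoeff0; case: ifP => // _; exact: monomial_part0.
Qed.

Lemma whomog_phomog d f : whomog s d f -> ph d f.
Proof.
move=> hf; have -> : f = wcomp s d f by rewrite (wcomp_whomog _ hf) eqxx.
rewrite wcomp_mono; apply: phomog_sum => m _; apply: phomog_sum => j /eqP ->.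
exact: phomog_mono.
Qed.

Lemma phomog_whomog d f : ph d f -> whomog s d f.
Proof.
move=> hf; rewrite (mpolyE f); apply: whomog_sum => m _.
have := hf m; case: leqP => [le [c ->]|_ ->]; last by rewrite scale0r; apply: whomog0.
have -> : (c *: 'X^(d - wdeg s m) : A) *: 'X_[m] = cst n c * mono k (d - wdeg s m) m.
  by rewrite monoE /cst mul_mpolyC scalerA mul_polyC.
have := whomogM (@whomog_cst k n s c) (@wscale_mono k n s (d - wdeg s m) m).
by rewrite add0n subnK.
Qed.

End PolynomialGrading.

(** * The Rees algebra as a flat graded deformation of k[S] *)

Section ReesDeformation.
Variables (k : fieldType) (S : pred nat) (D : pole_filtration k S).
Local Notation L := (function_field D).
Local Notation iota := (@const k S D).
Local Notation F := (@pole_le k S D).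
Local Notation lc := (@lead k S D).
Local Notation A := {poly k}.
Variables (n : nat) (s : n.-tuple nat).
Hypothesis gens : minimal_generators S s.
Local Notation P := {mpoly A[n]}.
Local Notation z := (('X : A)%:MP_[n] : P).
Local Notation B := (rees D : comAlgType A).

Lemma generator_in i : S (tnth s i).
Proof.
case: gens => srt gen _; apply/gen; exists (fun a => (a == tnth s i) : nat).
have us : uniq s := sorted_uniq ltn_trans ltnn srt.
rewrite (perm_big _ (perm_to_rem (mem_tnth i s))) big_cons /= eqxx mul1n.
rewrite big_seq big1 ?addn0 // => a.
by rewrite mem_rem_uniq // inE => /andP[/negbTE ->].
Qed.

Lemma generated_sum d : S d -> exists m : 'X_{1..n}, wdeg s m = d.
Proof.
case: gens => _ gen _ /gen[c ->]; exists [multinom c (tnth s i) | i < n].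
by rewrite /wdeg big_tuple; apply: eq_bigr => i _; rewrite mnmE mulnC.
Qed.

Lemma generator_gt0 i : (0 < tnth s i)%N.
Proof.
case: gens => _ gen nrem; rewrite lt0n; apply/eqP => si0.
case: (nrem (tnth s i)) => [|d /gen[c ->]]; first exact: mem_tnth.
exists c; rewrite (perm_big _ (perm_to_rem (mem_tnth i s))) big_cons /= si0 muln0.
by [].
Qed.

Lemma generator_function_subproof i : exists f, F (tnth s i) f /\ lc (tnth s i) f = 1.
Proof. by have [f Ff lf] := semigroup_function D (generator_in i); exists f. Qed.

Definition generator_function i : L :=
  proj1_sig (constructive_indefinite_description _ (generator_function_subproof i)).

Lemma pole_le_generator i : F (tnth s i) (generator_function i).
Proof. by rewrite /generator_function; case: constructive_indefinite_description => f []. Qed.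
Lemma lead_generator i : lc (tnth s i) (generator_function i) = 1.
Proof. by rewrite /generator_function; case: constructive_indefinite_description => f []. Qed.

Lemma rees_monomial_subproof d f : F d f -> f *: 'X^d \in @rees_pred k S D.
Proof.
move=> Ff; apply/rees_predP => i; rewrite coefZ coefXn; case: eqP => [->|_].
  by rewrite mulr1.
by rewrite mulr0; apply: pole_le0.
Qed.
Definition rees_monomial d f (Ff : F d f) : rees D := Rees (rees_monomial_subproof Ff).

Definition rees_hom : {rmorphism P -> rees D} :=
  mpoly_hom (@rees_const k S D : {rmorphism A -> rees D})
    (fun i => rees_monomial (pole_le_generator i)).

Lemma rees_homC c : rees_hom c%:MP = rees_const D c.
Proof. exact: mpoly_homC. Qed.
Lemma rees_homX i : rees_hom 'X_i = rees_monomial (pole_le_generator i).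
Proof. exact: mpoly_homX. Qed.

Definition rees_map (p : P) : rees D := rees_hom p.
Lemma rees_map_zmod : zmod_morphism rees_map. Proof. exact: rmorphB. Qed.
Lemma rees_map_monoid : monoid_morphism rees_map.
Proof. by split; [exact: rmorph1 | exact: rmorphM]. Qed.
Lemma rees_map_scalable : scalable rees_map.
Proof. by move=> c p; rewrite /rees_map -mul_mpolyC rmorphM rees_homC. Qed.
HB.instance Definition _ := GRing.isZmodMorphism.Build P (rees D) rees_map rees_map_zmod.
HB.instance Definition _ := GRing.isMonoidMorphism.Build P (rees D) rees_map rees_map_monoid.
HB.instance Definition _ := GRing.isScalable.Build A P (rees D) *:%R rees_map rees_map_scalable.

Definition mono_function (m : 'X_{1..n}) : L := \prod_i generator_function i ^+ m i.

Lemma pole_le_mono m : F (wdeg s m) (mono_function m).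
Proof.
have -> : wdeg s m = (\sum_i m i * tnth s i)%N by apply: eq_bigr => i _; rewrite mulnC.
by apply: pole_le_prod => i; apply: pole_leX; apply: pole_le_generator.
Qed.
Lemma lead_mono m : lc (wdeg s m) (mono_function m) = 1.
Proof.
have -> : wdeg s m = (\sum_i m i * tnth s i)%N by apply: eq_bigr => i _; rewrite mulnC.
rewrite lead_prod => [|i]; last by apply: pole_leX; apply: pole_le_generator.
rewrite big1 // => i _; rewrite leadX ?lead_generator ?expr1n //; exact: pole_le_generator.
Qed.

Lemma rees_map_mono j m :
  val (rees_map (mono k j m)) = mono_function m *: 'X^(j + wdeg s m).
Proof.
rewrite /rees_map /mono !rmorphM !rmorphXn rees_homC /= map_polyX.
rewrite mpolyXE_id rmorph_prod /=.
have -> : rees_val (\prod_i rees_hom ('X_i ^+ m i)) = mono_function m *: 'X^(wdeg s m).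
  transitivity (\prod_i val (rees_hom ('X_i ^+ m i)) : {poly L}).
    exact: (rmorph_prod (val : rees D -> {poly L})).
  transitivity (\prod_i (generator_function i ^+ m i *: 'X^(tnth s i * m i) : {poly L})).
    2: by rewrite scaler_prod prodrXr.
  apply: eq_bigr => i _.
  by rewrite !rmorphXn /= rees_homX /= exprZn -exprM.
by rewrite -scalerAr -exprD.
Qed.

Lemma rees_map_cst c : val (rees_map (cst n c)) = (iota c)%:P.
Proof. by rewrite /rees_map /cst rees_homC /= map_polyC. Qed.

Lemma rees_map_whomog d f : whomog s d f ->
  exists2 u, F d u & val (rees_map f) = u *: 'X^d.
Proof.
move=> hf; have -> : f = wcomp s d f by rewrite (wcomp_whomog _ hf) eqxx.
pose Q (g : P) := exists2 u, F d u & val (rees_map g) = u *: 'X^d.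
have Q0 : Q 0 by exists 0; [exact: pole_le0 | rewrite rmorph0 scale0r].
have QD g h : Q g -> Q h -> Q (g + h).
  move=> [u Fu gE] [v Fv hE]; exists (u + v); first exact: pole_leD.
  by rewrite rmorphD /= scalerDl -gE -hE.
rewrite wcomp_mono -/(Q _); elim/big_ind: _ => [//|//|m _].
elim/big_ind: _ => [//|//|j /eqP dE]; rewrite /Q dE; exists (iota (f@_m)`_j * mono_function m).
  apply: pole_leZ; apply: pole_leW (pole_le_mono m); exact: leq_addl.
by rewrite rmorphM /= -/(rees_map _) [rees_val _]rees_map_cst [rees_val _]rees_map_mono mul_polyC scalerA.
Qed.

Lemma wscale_at1 f : (wscale k s f).[1] = f.
Proof.
elim/family_ring_ind: f => [p q|p q|c||i].
- by rewrite rmorphD hornerD => -> ->.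
- by rewrite rmorphM hornerM => -> ->.
- by rewrite wscale_cst hornerC.
- by rewrite wscale_z !hornerE.
- by rewrite wscaleX !hornerE expr1n mulr1.
Qed.

Lemma wcomp_decomposition f : f = \sum_(i < size (wscale k s f)) wcomp s i f.
Proof.
rewrite -{1}[f]wscale_at1 horner_coef; apply: eq_bigr => i _.
by rewrite expr1n mulr1.
Qed.

(** Components of different weights are sent to different powers of 'X, so they cannot cancel. *)
Lemma rees_map_homogeneous :
  homogeneous_ideal (phomog (poly_grading k) s) (fun f => rees_map f = 0).
Proof.
move=> f f0; exists (size (wscale k s f)), (fun i => wcomp s i f).
split; last exact: wcomp_decomposition.
move=> i; split; first exact/whomog_phomog/wcompP.
have [le|lt] := leqP (size (wscale k s f)) i.
  by rewrite /wcomp nth_default // rmorph0.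
have [u uP] := @ord_choice _ _ (fun (j : 'I_(size (wscale k s f))) u =>
  val (rees_map (wcomp s j f)) = u *: 'X^j)
  (fun j => let: ex_intro2 u _ E := rees_map_whomog (wcompP s j f) in ex_intro _ u E).
apply: val_inj; rewrite (uP (Ordinal lt)).
have := congr1 (fun b : rees D => (val b)`_i) f0.
rewrite [in LHS](wcomp_decomposition f) !rmorph_sum coef_sum (bigD1 (Ordinal lt)) //=.
rewrite -/(rees_map _) [rees_val _](uP (Ordinal lt)) coefZ coefXn eqxx mulr1 big1 ?addr0 => [->|j ji].
  by rewrite coef0 scale0r.
rewrite [rees_val _](uP j) coefZ coefXn; case: eqP => [E|]; rewrite ?mulr0 //.
by case/eqP: ji; apply: val_inj.
Qed.

(** A monomial in the generator functions takes off the leading coefficient. The remainder has a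
    smaller pole and so lies in the image of [z] times an element of lower degree. *)
Lemma rees_map_surj b : exists f, rees_map f = b.
Proof.
have imD a c : (exists f, rees_map f = a) -> (exists f, rees_map f = c) ->
    exists f, rees_map f = a + c.
  by move=> [f <-] [g <-]; exists (f + g); rewrite rmorphD.
have im_mono d u (Fu : F d u) : exists f, rees_map f = rees_monomial Fu.
  elim: d u Fu => [|d IH] u Fu.
    exists (cst n (lc 0 u)); apply: val_inj; rewrite rees_map_cst /= expr0 alg_polyC.
    congr _%:P; apply/eqP; rewrite eq_sym -subr_eq0; apply/eqP; apply: (@lead0_eq0 _ _ D).
      by apply: pole_leB => //; apply: pole_le_const.
    by rewrite leadB ?lead_const ?subrr //; apply: pole_le_const.
  pose v := if S d.+1 =P true is ReflectT h then
    let: exist m _ := constructive_indefinite_description _ (generated_sum h) in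
    cst n (lc d.+1 u) * mono k 0 m else 0.
  have [w [Fw lw vE]] : exists w, [/\ F d.+1 w, lc d.+1 w = lc d.+1 u
      & exists g, val (rees_map g) = w *: 'X^(d.+1)].
    have [Sd|nS] := boolP (S d.+1); last first.
      exists 0; split; [exact: pole_le0 | | by exists 0; rewrite rmorph0 scale0r].
      rewrite lead0; apply/esym/eqP/negPn/negP => l0; case/negP: nS.
      by apply/(pole_order_semigroup D); exists u.
    have [m mE] := generated_sum Sd; exists (iota (lc d.+1 u) * mono_function m).
    have Fm := pole_le_mono m; have lm := lead_mono m; rewrite mE in Fm lm.
    split; [exact: pole_leZ | by rewrite leadZ // lm mulr1 |].
    exists (cst n (lc d.+1 u) * mono k 0 m).
    by rewrite rmorphM /= -/(rees_map _) [rees_val _]rees_map_cst [rees_val _]rees_map_mono mE mul_polyC scalerA.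
  have Fuw : F d (u - w).
    apply: lead_eq0; first exact: pole_leB.
    by rewrite leadB // lw subrr.
  have [f fE] := IH _ Fuw; have [g gE] := vE.
  exists (z * f + g); apply: val_inj; rewrite rmorphD rmorphM /= -/(rees_map _) [rees_val (rees_map g)]gE.
  rewrite {1}/rees_map rees_homC /= map_polyX fE /= -scalerAr -exprS -scalerDl.
  by rewrite subrK.
have Fb i : F i (val b)`_i by apply: rees_valP.
have -> : b = \sum_(i < size (val b)) rees_monomial (Fb i).
  apply: val_inj; rewrite raddf_sum /= -{1}[rees_val b]coefK poly_def.
  by apply: eq_bigr.
elim/big_ind: _ => [|//|i _]; [by exists 0; rewrite rmorph0 | exact: im_mono].
Qed.

(** Reduction modulo [z]: since [lc i] vanishes on functions with a pole of order less than [i],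
    multiples of 'X go to 0. The target is a domain, which yields the regularity of the variables on
    the central fibre. *)
Definition initial_form (b : rees D) : A := \poly_(i < size (val b)) lc i (val b)`_i.

Lemma coef_initial b i : (initial_form b)`_i = lc i (val b)`_i.
Proof. by rewrite coef_poly; case: ltnP => // le; rewrite nth_default ?lead0. Qed.

Lemma initial_zmod : zmod_morphism initial_form.
Proof.
move=> a b; apply/polyP => i; rewrite coefB !coef_initial [val _](_ : _ = val a - val b) //.
by rewrite coefB leadB //; apply: rees_valP.
Qed.
Lemma initial_monoid : monoid_morphism initial_form.
Proof.
split=> [|a b]; apply/polyP => i.
  rewrite coef_initial [val _](_ : _ = 1) // !coef1.
  by case: i => [|i]; rewrite ?lead1 ?lead0.
rewrite coefM !coef_initial [val _](_ : _ = val a * val b) // coefM.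
have Fab (j : 'I_i.+1) : F i ((val a)`_j * (val b)`_(i - j)).
  by rewrite -[i in F i](subnKC (leq_ord j)); apply: pole_leM; apply: rees_valP.
rewrite lead_sum //; apply: eq_bigr => j _; rewrite !coef_initial.
by rewrite -[i in lc i](subnKC (leq_ord j)) leadM //; apply: rees_valP.
Qed.
HB.instance Definition _ := GRing.isZmodMorphism.Build (rees D) A initial_form initial_zmod.
HB.instance Definition _ := GRing.isMonoidMorphism.Build (rees D) A initial_form initial_monoid.

Lemma initial_const a : initial_form (rees_const D a) = (a`_0)%:P.
Proof.
apply/polyP => i; rewrite coef_initial /= coef_map lead_const coefC.
by case: i.
Qed.

Lemma initial_monomial d f (Ff : F d f) : initial_form (rees_monomial Ff) = lc d f *: 'X^d.
Proof.
apply/polyP => i; rewrite coef_initial /= !coefZ !coefXn; case: eqP => [->|_]; rewrite ?mulr1 //.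
by rewrite !mulr0 lead0.
Qed.

Lemma initial_eq0 b : initial_form b = 0 -> exists b', b = rees_const D 'X * b'.
Proof.
move=> b0; have lb i : lc i (val b)`_i = 0 by rewrite -coef_initial b0 coef0.
have b'P : \poly_(i < size (val b)) (val b)`_i.+1 \in @rees_pred k S D.
  apply/rees_predP => i; rewrite coef_poly; case: ifP => _; last exact: pole_le0.
  by apply: lead_eq0 (lb _); apply: rees_valP.
exists (Rees b'P); apply: val_inj.
change (val b = map_poly iota 'X * \poly_(i < size (val b)) (val b)`_i.+1).
rewrite map_polyX; apply/polyP => i; rewrite coefXM coef_poly.
case: i => [|i] /=; first by apply: (@lead0_eq0 _ _ D) (lb 0%N); apply: (rees_valP b 0).
by case: ltnP => // le; rewrite nth_default // ltnW.
Qed.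

Lemma rees_deformation :
  flat_graded_deformation S s (poly_grading k) (rees_map : {lrmorphism P -> B}).
Proof.
split; first split.
- exact: poly_finitely_generated.
- by move=> a [c ->]; exists c; rewrite expr0.
- exact: rees_map_surj.
- exact: rees_map_homogeneous.
- exact: rees_flat.
exists (initial_form : {rmorphism B -> A}); split.
- move=> c b; change (initial_form (rees_const D c%:A * b) = c *: initial_form b).
  by rewrite rmorphM /= initial_const alg_polyC coefC eqxx mul_polyC.
- move=> i; change (initial_form (rees_map 'X_i) = 'X^(tnth s i)).
  by rewrite /rees_map rees_homX initial_monomial lead_generator scale1r.
- move=> d f /phomog_whomog/rees_map_whomog[u Fu uE]; exists (lc d u).
  rewrite -(initial_monomial Fu); congr initial_form; exact: val_inj.
- move=> q; split=> [[b <-] i|hq].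
    move=> qi; apply/(pole_order_semigroup D); exists (val b)`_i; first exact: rees_valP.
    by move: qi; rewrite coef_initial.
  have Fq i : F i (iota q`_i * pole_basis D i) by apply: pole_leZ; apply: pole_le_basis.
  exists (\sum_(i < size q) rees_monomial (Fq i)).
  rewrite rmorph_sum -[RHS]coefK poly_def; apply: eq_bigr => i _.
  change (initial_form (rees_monomial (Fq i)) = q`_i *: 'X^i).
  rewrite initial_monomial leadZ; last exact: pole_le_basis.
  have [->|qi] := eqVneq q`_i 0; first by rewrite mul0r.
  by rewrite lead_basis ?mulr1 //; apply: hq.
- move=> b; split=> [b0|[r [a [c [ha ->]]]]].
    have [b' bE] := initial_eq0 b0; exists 1%N, (fun=> 'X), (fun=> b'); split.
      move=> _; exists 1%N, (fun i => if i is 0%N then 'X else 0); split.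
        by case=> [|i]; [exists 1; rewrite scale1r | exists 0; rewrite scale0r].
      by rewrite big_ord1.
    by rewrite big_ord1 bE.
  change (initial_form (\sum_i rees_const D (a i) * c i) = 0).
  rewrite rmorph_sum big1 // => i _; rewrite rmorphM /= initial_const.
  have [N [e [he ->]]] := ha i.
  rewrite coef_sum big1 ?mul0r // => j _.
  by have [x ->] := he j; rewrite coefZ coefXn mulr0.
Qed.

End ReesDeformation.

(** * Tangent vectors *)

Section TangentVectors.
Variables (k : fieldType) (n : nat).
Local Notation A := {poly k}.
Local Notation P := {mpoly A[n]}.
Local Notation z := (('X : A)%:MP_[n] : P).
Variable ev : {rmorphism P -> k}.
Hypothesis evK : cancel (@cst k n) ev.

(* The first-order part along the line ev + epsilon v. *)
Definition line_hom (v : 'rV[k]_n.+1) : {rmorphism P -> {poly k}} :=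
  mpoly_hom (horner_eval ((ev z)%:P + v 0 ord0 *: 'X) \o map_poly (@polyC k) : {rmorphism A -> {poly k}})
    (fun i => (ev 'X_i)%:P + v 0 (lift ord0 i) *: 'X).

Definition derive_along (v : 'rV[k]_n.+1) (f : P) : k := (line_hom v f)`_1.

Lemma line_hom_cst v c : line_hom v (cst n c) = c%:P.
Proof. by rewrite /line_hom mpoly_homC /= map_polyC /horner_eval hornerC. Qed.
Lemma line_hom_z v : line_hom v z = (ev z)%:P + v 0 ord0 *: 'X.
Proof. by rewrite /line_hom mpoly_homC /= map_polyX /horner_eval hornerX. Qed.
Lemma line_hom_X v i : line_hom v 'X_i = (ev 'X_i)%:P + v 0 (lift ord0 i) *: 'X.
Proof. exact: mpoly_homX. Qed.

Lemma line_hom0 v f : (line_hom v f)`_0 = ev f.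
Proof.
elim/family_ring_ind: f => [p q|p q|c||i].
- by rewrite !rmorphD coefD => -> ->.
- by rewrite !rmorphM coefM big_ord1 => -> ->.
- by rewrite line_hom_cst coefC evK.
- by rewrite line_hom_z coefD coefC coefZ coefX mulr0 addr0.
- by rewrite line_hom_X coefD coefC coefZ coefX mulr0 addr0.
Qed.

Lemma derive_along_der v : point_derivation ev (derive_along v).
Proof.
rewrite /derive_along; split=> a b; first by rewrite rmorphD coefD.
by rewrite rmorphM coefM big_ord_recl big_ord1 /= !line_hom0 addrC mulrC [X in _ + X]mulrC addrC mulrC [X in _ + X]mulrC addrC.
Qed.

Lemma derive_cst v c : derive_along v (cst n c) = 0.
Proof. by rewrite /derive_along line_hom_cst coefC. Qed.
Lemma derive_z v : derive_along v z = v 0 ord0.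
Proof. by rewrite /derive_along line_hom_z coefD coefC coefZ coefX mulr1 add0r. Qed.
Lemma derive_X v i : derive_along v 'X_i = v 0 (lift ord0 i).
Proof. by rewrite /derive_along line_hom_X coefD coefC coefZ coefX mulr1 add0r. Qed.

Lemma derive_linear v f :
  derive_along v f = \sum_j v 0 j * derive_along (delta_mx 0 j) f.
Proof.
elim/family_ring_ind: f => [p q Hp Hq|p q Hp Hq|c||i].
- rewrite (pderD (derive_along_der v)) Hp Hq -big_split; apply: eq_bigr => j _.
  by rewrite (pderD (derive_along_der _)) mulrDr.
- rewrite (pderM (derive_along_der v)) Hp Hq mulr_suml mulr_sumr -big_split.
  by apply: eq_bigr => j _; rewrite (pderM (derive_along_der _)) /=; ring.
- by rewrite derive_cst big1 // => j _; rewrite derive_cst mulr0.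
- rewrite derive_z (bigD1 ord0) //= derive_z mxE !eqxx mulr1 big1 ?addr0 // => j j0.
  by rewrite derive_z mxE eqxx eq_sym (negbTE j0) mulr0.
- rewrite derive_X (bigD1 (lift ord0 i)) //= derive_X mxE !eqxx mulr1 big1 ?addr0 // => j ji.
  by rewrite derive_X mxE eqxx eq_sym (negbTE ji) mulr0.
Qed.

Variable I : P -> Prop.
Hypothesis (idealI : ideal I) (evI : forall f, I f -> ev f = 0).

Definition tangent (v : 'rV[k]_n.+1) : Prop := forall f, I f -> derive_along v f = 0.

Definition jacobian m (f : 'I_m -> P) : 'M[k]_(m, n.+1) :=
  \matrix_(i, j) derive_along (delta_mx 0 j) (f i).

Lemma jacobianE m (f : 'I_m -> P) v i : (v *m (jacobian f)^T) 0 i = derive_along v (f i).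
Proof. by rewrite derive_linear !mxE; apply: eq_bigr => j _; rewrite !mxE. Qed.

(** [I] is not given by finitely many generators, so a finite family with Jacobian of maximal rank
    is chosen. No further element of [I] raises this rank, so the kernel of the Jacobian consists of
    tangent vectors, and the rank is at least n + 1 - 2. *)
Lemma dual_equations r :
  (forall q (V : 'M[k]_(q, n.+1)), (forall i, tangent (row i V)) -> (\rank V <= 2)%N) ->
  (r < n)%N ->
  exists (f : 'I_r -> P) (d : 'I_r -> P -> k),
    [/\ forall i, I (f i), forall i, point_derivation ev (d i)
      & forall i j, d i (f j) = (i == j)%:R].
Proof.
move=> tan2 rn.
pose Q rho := exists m (f : 'I_m -> P), (forall i, I (f i)) /\ (\rank (jacobian f) = n.+1 - rho)%N.
have [|rho [m [f [If rf]]] rmin] := @exists_minimal Q.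
  exists n.+1, 0%N, (fun=> 0); split=> [|]; first by move=> i; apply: ideal0.
  by rewrite subnn; apply/eqP; rewrite -leqn0 (leq_trans (rank_leq_row _)).
have tanK i : tangent (row i (kermx (jacobian f)^T)).
  move=> g Ig; set v := row i _.
  have vJ : v *m (jacobian f)^T = 0 by rewrite /v -row_mul mulmx_ker row0.
  pose h (j : 'I_(m + 1)) := if split j is inl j' then f j' else g.
  have Ih j : I (h j) by rewrite /h; case: split.
  have Jh : jacobian h = col_mx (jacobian f) (jacobian (fun _ : 'I_1 => g)).
    apply/matrixP => a b; rewrite mxE /h; case: split_ordP => a' ->.
      by rewrite col_mxEu mxE.
    by rewrite col_mxEd mxE.
  have le : (\rank (jacobian h) <= \rank (jacobian f))%N.
    rewrite rf -[X in (X <= _)%N](subKn (rank_leq_col _)) leq_sub2l //.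
    by apply: rmin; exists (m + 1)%N, h; split=> //; rewrite subKn // rank_leq_col.
  have sub : (jacobian f <= jacobian h)%MS by rewrite Jh -addsmxE addsmxSl.
  have /submxP[W JW] : (jacobian h <= jacobian f)%MS.
    by have := mxrank_leqif_sup sub; case=> lef; rewrite eqn_leq lef le => <-.
  have gW : jacobian (fun _ : 'I_1 => g) = dsubmx W *m jacobian f.
    by rewrite mul_dsub_mx -JW Jh col_mxKd.
  rewrite -(jacobianE (fun _ : 'I_1 => g) v 0) gW trmx_mul mulmxA vJ mul0mx mxE.
  by [].
have rJ : (r <= \rank (jacobian f))%N.
  have := tan2 _ _ tanK; rewrite mxrank_ker mxrank_tr; have := rank_leq_col (jacobian f).
  by move: (\rank _) rn; clear; lia.
(* Both factors come from the rank normal form of the Jacobian: [U] recombines the equations with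
   constant coefficients, and the columns of [W] are the dual directions. *)
pose U : 'M_(r, m) := pid_mx r *m invmx (col_ebase (jacobian f)).
pose W : 'M_(n.+1, r) := invmx (row_ebase (jacobian f)) *m pid_mx r.
have UJW : U *m jacobian f *m W = 1%:M.
  rewrite -(mulmx_ebase (jacobian f)) /U /W !mulmxA mulmxKV ?col_ebase_unit //.
  rewrite mulmxK ?row_ebase_unit // !mul_pid_mx -pid_mx_1; congr pid_mx.
  have := rank_leq_row (jacobian f); have := rank_leq_col (jacobian f).
  by move: rJ; clear; lia.
exists (fun l => \sum_i cst n (U l i) * f i), (fun j => derive_along (col j W)^T).
split=> [l|j|j l]; last 1 first.
- have /matrixP/(_ l j) := UJW; rewrite [in RHS]mxE eq_sym => <-.
  rewrite (pder_sum (derive_along_der _)) mxE.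
  rewrite (eq_bigr (fun i => U l i * derive_along (col j W)^T (f i))) => [|i _]; last first.
    by rewrite (pderM (derive_along_der _)) derive_cst mul0r add0r evK.
  rewrite (eq_bigr (fun i => \sum_b U l i * (jacobian f i b * W b j))) => [|i _]; last first.
    rewrite derive_linear mulr_sumr; apply: eq_bigr => b _.
    by rewrite [_^T 0 b]mxE [col j W b 0]mxE [jacobian f i b]mxE [W b j * _]mulrC.
  rewrite exchange_big /=; apply: eq_bigr => b _.
  by rewrite [(U *m _) l b]mxE mulr_suml; apply: eq_bigr => i _; rewrite mulrA.
- by apply: ideal_sum => // i _; apply: idealM.
- exact: derive_along_der.
Qed.

(** The component along [z] is one linear form, and its kernel on the tangent space is at most a
    line. *)
Lemma tangent_rank q (V : 'M[k]_(q, n.+1)) (t : 'rV[k]_n.+1) :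
  (forall v, tangent v -> v 0 ord0 = 0 -> exists a, v = a *: t) ->
  (forall i, tangent (row i V)) -> (\rank V <= 2)%N.
Proof.
move=> ht tanV.
have [[w tw w1]|h] := classic (exists2 w, tangent w & w 0 ord0 = 1).
  have : (V <= col_mx w t)%MS.
    apply/row_subP => i; have [||a aE] := ht (row i V - (V i ord0) *: w).
    - move=> f If; rewrite derive_linear; under eq_bigr do rewrite !mxE mulrBl -mulrA.
      rewrite sumrB -mulr_sumr -derive_linear tw // mulr0 subr0.
      have := tanV i f If; rewrite derive_linear; under eq_bigr do rewrite mxE.
      by [].
    - by rewrite !mxE w1 mulr1 subrr.
    rewrite -(subrK (V i ord0 *: w) (row i V)) aE -addsmxE addrC.
    by rewrite addmx_sub_adds ?scalemx_sub.
  by move/mxrankS/leq_trans; apply; rewrite rank_leq_row.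
have : (V <= t)%MS.
  apply/row_subP => i; have [|a ->] := ht (row i V) (tanV i); last by rewrite scalemx_sub.
  apply/eqP/negPn/negP => v0; apply: h; exists ((row i V 0 ord0)^-1 *: row i V); last by rewrite mxE mulVf.
  move=> f If; rewrite derive_linear; under eq_bigr do rewrite mxE -mulrA.
  by rewrite -mulr_sumr -derive_linear (tanV i) ?mulr0.
by move/mxrankS/leq_trans; apply; rewrite (leq_trans (rank_leq_row _)).
Qed.

End TangentVectors.

(** * The tangent line *)

Section FamilyPoints.
Variables (k : closedFieldType) (S : pred nat) (D : pole_filtration k S).
Hypothesis semigroupS : numerical_semigroup S.
Local Notation L := (function_field D).
Local Notation iota := (@const k S D).
Local Notation F := (@pole_le k S D).
Local Notation lc := (@lead k S D).
Local Notation A := {poly k}.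
Variables (n : nat) (s : n.-tuple nat).
Hypothesis gens : minimal_generators S s.
Local Notation P := {mpoly A[n]}.
Local Notation z := (('X : A)%:MP_[n] : P).
Local Notation pi := (rees_map D gens).

Definition family_ideal (f : P) : Prop := pi f = 0.
Local Notation I := family_ideal.

Lemma rees_val_eq0 (b : rees D) : (val b == 0) = (b == 0).
Proof. by apply/eqP/eqP => [b0|->//]; apply: val_inj. Qed.

Lemma family_prime : prime_ideal I.
Proof.
split; first split.
- by rewrite /I rmorph0.
- by move=> a b; rewrite /I rmorphD /= => -> ->; rewrite addr0.
- by move=> a b; rewrite /I rmorphM /= => ->; rewrite mulr0.
- by rewrite /I rmorph1 => /eqP; rewrite oner_eq0.
move=> a b; rewrite /I rmorphM => /(congr1 val)/eqP.
change (val (pi a) * val (pi b) == 0 -> pi a = 0 \/ pi b = 0).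
by rewrite mulf_eq0 !rees_val_eq0 => /orP[/eqP|/eqP]; [left | right].
Qed.

Lemma family_idealE : ideal I. Proof. by case: family_prime. Qed.

Lemma pi_z : pi z = rees_const D 'X. Proof. exact: rees_homC. Qed.

Lemma family_z_regular f : I (z * f) -> I f.
Proof.
case: family_prime => _ _ h /h[|//]; rewrite /I pi_z => /(congr1 val)/eqP.
by rewrite /= map_polyX polyX_eq0.
Qed.

Lemma family_central_fibre f : adjoin I z f <-> initial_form (pi f) = 0.
Proof.
split=> [[b Ib]|f0].
  have -> : f = (f - b * z) + b * z by rewrite subrK.
  rewrite rmorphD /= [pi (f - _)]Ib add0r rmorphM /= pi_z rmorphM.
  by rewrite /= initial_const coefX mulr0.
have [b' bE] := initial_eq0 f0; have [g gE] := rees_map_surj gens b'.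
by exists g; rewrite /I rmorphB rmorphM /= pi_z gE bE mulrC subrr.
Qed.

Lemma family_x_regular i f : adjoin I z ('X_i * f) -> adjoin I z f.
Proof.
move=> /family_central_fibre; rewrite rmorphM rmorphM /= => /eqP; rewrite mulf_eq0 => /orP[|/eqP h].
  rewrite /rees_map rees_homX initial_monomial lead_generator scale1r.
  by rewrite expf_eq0 polyX_eq0 andbF.
exact/family_central_fibre.
Qed.

Lemma initial_monomial_map m : initial_form (pi 'X_[m]) = 'X^(wdeg s m).
Proof.
have := rees_map_mono D gens 0 m; rewrite /mono expr0 mul1r add0n => E.
have -> : pi 'X_[m] = rees_monomial (pole_le_mono D gens m) by apply: val_inj.
by rewrite initial_monomial lead_mono scale1r.
Qed.

Section Point.
Variable ev : {rmorphism P -> k}.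
Hypotheses (evK : cancel (@cst k n) ev) (evI : forall f, I f -> ev f = 0).

Local Notation der := (derive_along ev).
Local Notation tan := (tangent ev I).
Let derP v := derive_along_der evK v.

(** On the central fibre monomials of equal weight agree. Comparing powers shows that none of them
    vanishes at a point other than the origin, and the tangent direction is that of the orbit of the
    grading, with coordinates s_i x_i. *)
Lemma tangent_line_special : ev z = 0 -> (exists i, ev 'X_i != 0) ->
  exists t : 'rV[k]_n.+1, forall v, tan v -> v 0 ord0 = 0 -> exists a, v = a *: t.
Proof.
move=> ev_z [i0 evi0].
have same m m' : wdeg s m = wdeg s m' -> adjoin I z ('X_[m] - 'X_[m']).
  by move=> E; apply/family_central_fibre; rewrite !rmorphB /= !initial_monomial_map E subrr.
have ev_adj f : adjoin I z f -> ev f = 0.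
  case=> b /evI; rewrite rmorphB rmorphM ev_z mulr0 subr0; exact.
have evX m m' : wdeg s m = wdeg s m' -> ev 'X_[m] = ev 'X_[m'].
  by move=> /same/ev_adj/eqP; rewrite rmorphB subr_eq0 => /eqP.
have wdegD m m' : wdeg s (m + m') = (wdeg s m + wdeg s m')%N.
  rewrite /wdeg -big_split; apply: eq_bigr => i _.
  by rewrite mnmDE mulnDr.
have wdegMn m a : wdeg s (m *+ a) = (a * wdeg s m)%N.
  by elim: a => [|a IH]; [rewrite mulm0n /wdeg big1 // => i _; rewrite mnm0E muln0 | rewrite mulmS wdegD IH mulSn].
have wdegU i : wdeg s U_(i) = tnth s i.
  rewrite /wdeg (bigD1 i) //= mnm1E eqxx muln1 big1 ?addn0 // => j ji.
  by rewrite mnm1E eq_sym (negbTE ji) muln0.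
have evX0 m : ev 'X_[m] != 0.
  have : ev 'X_[(m *+ tnth s i0)] = ev 'X_[(U_(i0) *+ wdeg s m)].
    by apply: evX; rewrite !wdegMn wdegU mulnC.
  rewrite -!mpolyXn !rmorphXn /= => E; apply/eqP => m0; have /eqP := E.
  by rewrite m0 expr0n gtn_eqF ?(generator_gt0 gens) //= eq_sym expf_eq0 (negbTE evi0) andbF.
exists (\row_j if unlift ord0 j is Some i then ev 'X_i * (tnth s i)%:R else 0).
move=> v tv v0.
pose l m := der v 'X_[m] / ev 'X_[m].
have lE m m' : wdeg s m = wdeg s m' -> l m = l m'.
  move=> E; rewrite /l (evX _ _ E); congr (_ / _).
  have [b /tv] := same _ _ E; rewrite !(pderB (derP v)) (pderM (derP v)) ev_z mulr0 add0r.
  by rewrite derive_z // v0 mulr0 subr0 => /eqP; rewrite subr_eq0 => /eqP.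
(* The logarithmic derivative l is additive and depends on the degree only. *)
have lD m m' : l (m + m')%MM = l m + l m'.
  rewrite /l mpolyXD (pderM (derP v)) rmorphM.
  by field; rewrite !evX0.
have l0 : l 0%MM = 0 by rewrite /l mpolyX0 (pder1 (derP v)) mul0r.
have lMn m a : l (m *+ a)%MM = a%:R * l m.
  elim: a => [|a IH]; first by rewrite mulm0n l0 mul0r.
  by rewrite mulmS lD IH -[a.+1]add1n natrD mulrDl mul1r.
have [_ _ [c hc]] := semigroupS.
have [m0 m0E] := generated_sum gens (hc c (leqnn c)).
have [m1 m1E] := generated_sum gens (hc c.+1 (leqnSn c)).
(* The weights [c] and [c.+1] both lie in [S], so the identity s_i (c + 1) = s_i c + s_i determines
   l on x_i without a division, in any characteristic. *)
exists (l m1 - l m0); apply/rowP => j; rewrite !mxE.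
case: (unliftP ord0 j) => [i|] ->; last by rewrite v0 mulr0.
rewrite -(derive_X ev v i).
have : l (m1 *+ tnth s i)%MM = l (m0 *+ tnth s i + U_(i))%MM.
  by apply: lE; rewrite wdegD !wdegMn wdegU m1E m0E mulnS addnC.
rewrite lD !lMn => E.
have {E} : l U_(i)%MM = (l m1 - l m0) * (tnth s i)%:R.
  by rewrite -(addKr ((tnth s i)%:R * l m0) (l U_(i)%MM)) -E; ring.
move=> /(congr1 (fun x => x * ev 'X_i)); rewrite /l mulfVK ?evX0 // => ->.
by ring.
Qed.

(** * The fibres off z = 0 *)

Section GeneralFibre.
Hypothesis ev_z : ev z != 0.

(** Restriction to the fibre through the point. As [ev z] is invertible, its powers can be divided
    out, and every such fibre is the ring of functions with poles at [p] only. *)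
Definition fibre_map : {rmorphism P -> L} :=
  (horner_eval (iota (ev z)) \o (val : rees D -> {poly L}) \o pi : {rmorphism P -> L}).

Lemma fibre_mapE f : fibre_map f = (val (pi f)).[iota (ev z)]. Proof. by []. Qed.

Lemma fibre_map_cst c : fibre_map (cst n c) = iota c.
Proof. by rewrite fibre_mapE rees_map_cst hornerC. Qed.

Lemma fibre_map_pole f : exists N, F N (fibre_map f).
Proof.
exists (size (val (pi f))); rewrite fibre_mapE horner_coef; apply: pole_le_sum => i _.
rewrite -(rmorphXn iota) mulrC; apply: pole_leZ; apply: pole_leW (rees_valP _ _).
exact: ltnW.
Qed.

Lemma fibre_map_surj N u : F N u -> exists f, fibre_map f = u.
Proof.
move=> Fu; have [f fE] := rees_map_surj gens (rees_monomial Fu).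
exists (cst n (ev z ^- N) * f); rewrite rmorphM fibre_map_cst fibre_mapE fE /=.
rewrite hornerZ hornerXn -(rmorphXn iota) mulrCA -(rmorphM iota) mulVf ?expf_neq0 // rmorph1.
exact: mulr1.
Qed.

(* An element of the kernel of the fibre map becomes an element of I after
   homogenization by powers of z. *)
Lemma fibre_map_ker f : fibre_map f = 0 ->
  ev f = 0 /\ forall v, tan v -> v 0 ord0 = 0 -> der v f = 0.
Proof.
move=> f0; pose N := size (wscale k s f).
(* On the hyperplane where [z] has the value [ev z], the two scalar factors multiply to [ev z ^+ N],
   so there [g] is a nonzero multiple of [f]. *)
pose g := \sum_(i < N) cst n (ev z ^+ i) * z ^+ (N - i) * wcomp s i f.
have fE := wcomp_decomposition s f; rewrite -/N in fE.
have Ig : I g.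
  have [u uP] := @ord_choice _ _ (fun (j : 'I_N) u =>
    val (pi (wcomp s j f)) = u *: 'X^j)
    (fun j => let: ex_intro2 u _ E := rees_map_whomog D gens (wcompP s j f) in ex_intro _ u E).
  apply: val_inj; change (val (pi g) = 0).
  have piz j : val (pi (z ^+ j)) = 'X^j.
    by rewrite !rmorphXn /= pi_z /= map_polyX.
  have -> : val (pi g) = (\sum_i u i * iota (ev z ^+ i)) *: 'X^N.
    rewrite /g !rmorph_sum scaler_suml; apply: eq_bigr => i _.
    rewrite !rmorphM /= -/(pi _) [rees_val (pi (cst _ _))]rees_map_cst.
    rewrite [rees_val (pi (wcomp _ _ _))]uP [rees_val (pi (_ ^+ _))]piz.
    rewrite -scalerAr -mulrA -exprD subnK ?(ltnW (ltn_ord i)) // mul_polyC scalerA.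
    by [].
  suff -> : \sum_i u i * iota (ev z ^+ i) = fibre_map f by rewrite f0 scale0r.
  rewrite {1}fE rmorph_sum; apply: eq_bigr => i _.
  by rewrite fibre_mapE uP hornerZ hornerXn rmorphXn.
have zN : ev z ^+ N != 0 by rewrite expf_neq0.
have evfN : ev z ^+ N * ev f = ev g.
  rewrite {1}fE !rmorph_sum mulr_sumr; apply: eq_bigr => i _.
  rewrite [RHS]rmorphM [ev (_ * z ^+ _)]rmorphM evK [ev (z ^+ _)]rmorphXn.
  by rewrite -exprD subnKC // ltnW.
split=> [|v tv v0].
  by apply/eqP; rewrite -(inj_eq (mulfI zN)) mulr0 evfN evI.
apply: (mulfI zN); rewrite mulr0 -(tv g Ig) {1}fE !(pder_sum (derP v)) mulr_sumr.
apply: eq_bigr => i _; rewrite !(pderM (derP v)) derive_cst.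
have -> : der v (z ^+ (N - i)) = 0.
  elim: (N - i)%N => [|j IH]; first by rewrite expr0 (pder1 (derP v)).
  by rewrite exprS (pderM (derP v)) derive_z v0 IH mul0r mulr0 addr0.
rewrite mul0r mulr0 addr0 mul0r add0r rmorphM evK [ev (z ^+ _)]rmorphXn -exprD subnKC ?(ltnW (ltn_ord i)) //.
Qed.

Lemma nonconstant_vanishing : exists b, ev b = 0 /\ fibre_map b != 0.
Proof.
have [_ _ [c hc]] := semigroupS.
have [f Ff lf] := semigroup_function D (hc c.+1 (leqnSn c)).
have [g gE] := fibre_map_surj Ff.
exists (g - cst n (ev g)); rewrite rmorphB evK subrr; split=> //.
rewrite rmorphB fibre_map_cst gE; apply/eqP => h.
have := congr1 (lc c.+1) h; rewrite lead0 leadB // ?lead_const ?subr0 ?lf.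
  by move/eqP; rewrite oner_eq0.
exact: pole_le_const.
Qed.

Section Divisor.
Variable b : P.
Hypotheses (evb : ev b = 0) (b0 : fibre_map b != 0).

Definition fibre_multiple (a : P) : Prop := exists q, fibre_map a = fibre_map (q * b).

Lemma fibre_multiple_ideal : ideal fibre_multiple.
Proof.
split.
- by exists 0; rewrite mul0r !rmorph0.
- by move=> a c [q aE] [r cE]; exists (q + r); rewrite mulrDl !rmorphD aE cE.
- by move=> a c [q cE]; exists (a * q); rewrite -mulrA !rmorphM cE rmorphM.
Qed.

Lemma fibre_multiple_vanish a : fibre_multiple a -> ev a = 0.
Proof.
case=> q E; have [|h _] := @fibre_map_ker (a - q * b).
  by rewrite rmorphB E subrr.
by rewrite -(subrK (q * b) a) rmorphD h rmorphM evb mulr0 addr0.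
Qed.

(** If [b] has pole order [e] and [S] has no gap from [c] on, then multiples of [b] realize every
    pole order from [c + e] on. So the fibre modulo [b] is finite-dimensional. *)
Lemma fibre_reduction : exists K, forall a, exists2 a', fibre_multiple (a - a') & F K (fibre_map a').
Proof.
have [N FN] := fibre_map_pole b; have [e _ [_ Fe le]] := exact_pole FN b0.
have [_ _ [c hc]] := semigroupS.
exists (c + e)%N => a; have [M] := fibre_map_pole a.
have IJ := fibre_multiple_ideal.
elim: M a => [|M IH] a FM.
  exists a; first by rewrite subrr; apply: ideal0.
  exact: pole_leW FM.
have [leM|ltM] := leqP M.+1 (c + e).
  by exists a; [rewrite subrr; apply: ideal0 | exact: pole_leW FM].
have ceM : (c + e <= M.+1)%N by exact: ltnW.
have eM : (e <= M.+1)%N by apply: leq_trans ceM; apply: leq_addl.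
have SM : S (M.+1 - e)%N by apply: hc; rewrite leq_subRL // addnC.
have [w Fw lw] := semigroup_function D SM.
have [q qE] := fibre_map_surj Fw.
pose t := lc M.+1 (fibre_map a) / lc e (fibre_map b).
have Fqb : F M.+1 (fibre_map (q * b)).
  by rewrite rmorphM qE -(subnK eM); apply: pole_leM.
have [|a' Ja' Fa'] := IH (a - cst n t * (q * b)).
  apply: lead_eq0.
    by rewrite rmorphB; apply: pole_leB => //; rewrite rmorphM fibre_map_cst; apply: pole_leZ.
  rewrite rmorphB [fibre_map (_ * (q * b))]rmorphM fibre_map_cst leadB //; last exact: pole_leZ.
  rewrite leadZ // rmorphM qE -{2}(subnK eM) leadM // lw mul1r /t divfK ?subrr //.
exists a' => //; rewrite -(subrK (cst n t * (q * b)) a) addrAC; apply: idealD => //.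
by exists (cst n t * q); rewrite mulrA.
Qed.

(** Among [K.+2] powers of [a], reduced to a space with [K.+1] coordinates, there is a linear
    relation. *)
Lemma fibre_algebraic a : exists2 g : {poly k}, g != 0 &
  fibre_multiple (map_poly (@cst k n) g).[a].
Proof.
have [K hK] := fibre_reduction; have IJ := fibre_multiple_ideal.
have [a' ha'] := @ord_choice K.+2 _ (fun j a' => fibre_multiple (a ^+ j - a') /\ F K (fibre_map a'))
  (fun j => let: ex_intro2 a' h1 h2 := hK (a ^+ j) in ex_intro _ a' (conj h1 h2)).
pose M := \matrix_(j < K.+2, i < K.+1) coordinate i (fibre_map (a' j)).
have : kermx M != 0.
  rewrite -mxrank_eq0 mxrank_ker -lt0n subn_gt0.
  exact: leq_ltn_trans (rank_leq_col _) (ltnSn _).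
move=> /rowV0Pn[u /sub_kermxP uM /rV0Pn[j0 uj0]].
exists (\poly_(j < K.+2) u 0 (inord j)).
  apply/eqP => /polyP/(_ j0)/eqP; rewrite coef_poly ltn_ord inord_val coef0.
  by rewrite (negbTE uj0).
have sum0 : \sum_j iota (u 0 j) * fibre_map (a' j) = 0.
  under eq_bigr => j _ do rewrite (coordinate_expansion (proj2 (ha' j))) mulr_sumr.
  rewrite exchange_big big1 //= => i _.
  under eq_bigr do rewrite mulrA -rmorphM.
  rewrite -mulr_suml -rmorph_sum.
  have /matrixP/(_ 0 i) := uM; rewrite !mxE => E.
  rewrite (_ : \sum_j _ = 0) ?rmorph0 ?mul0r // -[RHS]E.
  by apply: eq_bigr => j _; rewrite mxE.
have -> : (map_poly (@cst k n) (\poly_(j < K.+2) u 0 (inord j))).[a] =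
    \sum_j cst n (u 0 j) * (a ^+ j - a' j) + \sum_j cst n (u 0 j) * a' j.
  rewrite -big_split (@horner_coef_wide _ K.+2); last first.
    by apply: leq_trans (size_poly _ _) (size_poly _ _).
  apply: eq_bigr => j _; rewrite coef_map coef_poly ltn_ord inord_val /=; ring.
apply: idealD => //.
  by apply: ideal_sum => // j _; apply: idealM => //; case: (ha' j).
exists 0; rewrite mul0r rmorph0 rmorph_sum -[RHS]sum0; apply: eq_bigr => j _.
by rewrite rmorphM fibre_map_cst.
Qed.

(** The ideal of the point is found as an associated prime of [b]: an annihilator [K] that is
    maximal among those contained in it is prime, and modulo [K] everything is algebraic over [k].
    The restriction to annihilators inside that ideal stands in for localization. *)
Lemma socle_element : exists c, ~ fibre_multiple c /\
  forall m, ev m = 0 -> fibre_multiple (m * c).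
Proof.
have IJ := fibre_multiple_ideal.
have [noeP _] := nullstellensatz_family k n.
pose Q (K : P -> Prop) := (exists c, forall a, K a <-> fibre_multiple (a * c)) /\
  forall a, K a -> ev a = 0.
have QJ : Q fibre_multiple.
  by split; [exists 1 => a; rewrite mulr1 | exact: fibre_multiple_vanish].
have [K [IK [[c cK] Kev] _ Kmax]] := noetherian_maximal noeP IJ QJ.
have idealQ d : ideal (fun a => fibre_multiple (a * d)).
  split; first by rewrite mul0r; apply: ideal0.
    by move=> a a' h h'; rewrite mulrDl; apply: idealD.
  by move=> a a' h; rewrite -mulrA; apply: idealM.
have K1 : ~ K 1 by move/Kev => /eqP; rewrite rmorph1 oner_eq0.
have Kprime a a' : K (a * a') -> K a \/ K a'.
  move=> Kaa'; apply: NNPP => /not_or_and[nKa nKa'].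
  (* If the annihilator of [a * c] stays inside the ideal of the point, maximality applies to it.
     Otherwise some [e] that is nonzero at the point kills [a * c], and maximality applies to the
     annihilator of [e * c]. *)
  have [h|] := classic (forall g, fibre_multiple (g * (a * c)) -> ev g = 0).
    apply: nKa'; apply: (Kmax (fun g => fibre_multiple (g * (a * c)))) => //.
    - by split=> //; exists (a * c) => g.
    - by move=> g /cK Jg; rewrite mulrCA; apply: idealM.
    - by move/cK: Kaa'; rewrite -mulrA mulrCA.
  move=> nh; have [e he] := not_all_ex_not _ _ nh.
  have [Jeac eve] := imply_to_and _ _ he; apply: nKa.
  apply: (Kmax (fun g => fibre_multiple (g * (e * c)))) => //.
  - split; first by exists (e * c) => g.
    move=> g Jgec; have : ev (g * e) = 0 by apply: Kev; apply/cK; rewrite -mulrA.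
    by rewrite rmorphM => /eqP; rewrite mulf_eq0 => /orP[/eqP//|/eqP/eve].
  - by move=> g /cK Jg; rewrite mulrCA; apply: idealM.
  - by rewrite mulrCA.
exists c; split=> [Jc|m evm]; first by apply: K1; apply/cK; rewrite mul1r.
(* A polynomial relation for [m] splits into linear factors, one of which lies in the prime [K];
   evaluation at the point shows that its root is 0. *)
apply/cK; have [g g0 Jg] := fibre_algebraic m.
have Kg : K (map_poly (@cst k n) g).[m] by apply/cK; apply: idealMl.
have [r gE] := closed_field_poly_normal g.
move: Kg; rewrite gE linearZ /= hornerZ rmorph_prod horner_prod => Kg.
have : K (\prod_(a <- r) (map_poly (@cst k n) ('X - a%:P)).[m]).
  have := idealM IK (cst n (lead_coef g)^-1) Kg.
  by rewrite mulrA -rmorphM mulVf ?lead_coef_eq0 // rmorph1 mul1r.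
elim: (r) => [|a t IH]; first by rewrite big_nil => /K1.
rewrite big_cons => /Kprime[|//]; rewrite rmorphB /= map_polyX map_polyC /= hornerD hornerN hornerX hornerC.
move=> Ka; have := Kev _ Ka; rewrite rmorphB evm evK sub0r => /eqP; rewrite oppr_eq0 => /eqP a0.
by move: Ka; rewrite a0 rmorph0 subr0.
Qed.

End Divisor.

(* c / b is not regular, while the maximal ideal m of the point satisfies
   m c <= (b).  If m c <= m b, then b (c / b)^j is regular for all j, against
   normality; so t0 c = u b with t0 in m and u a unit, and t0 generates m. *)
Lemma tangent_line_general :
  exists t : 'rV[k]_n.+1, forall v, tan v -> v 0 ord0 = 0 -> exists a, v = a *: t.
Proof.
have [b [evb b0]] := nonconstant_vanishing.
have [c [nJc socle]] := socle_element evb b0.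
have [[t0 [u [evt evu tE]]]|noT] :=
  classic (exists t0 u, [/\ ev t0 = 0, ev u != 0 & fibre_map (t0 * c) = fibre_map (u * b)]).
  have [q qP] := @ord_choice n _ (fun i q => fibre_map (('X_i - cst n (ev 'X_i)) * c) = fibre_map (q * b))
    (fun i => socle ('X_i - cst n (ev 'X_i)) (etrans (rmorphB ev _ _) (etrans (congr1 _ (congr1 _ (evK _))) (subrr _)))).
  (* On the fibre, [u] times the coordinate x_i minus its value is [q i * t0]; so these are the
     derivatives of the coordinates with respect to the parameter [t0]. *)
  exists (\row_j if unlift ord0 j is Some i then ev (q i) / ev u else 0).
  move=> v tv v0; exists (der v t0); apply/rowP => j; rewrite !mxE.
  case: (unliftP ord0 j) => [i|] ->; last by rewrite v0 mulr0.
  rewrite -(derive_X ev v i).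
  pose m := 'X_i - cst n (ev 'X_i) : P.
  have evm : ev m = 0 by rewrite rmorphB evK subrr.
  have dm : der v m = der v 'X_i by rewrite (pderB (derP v)) derive_cst subr0.
  have [|_ /(_ v tv v0)] := @fibre_map_ker (u * m - q i * t0).
    have E : fibre_map (u * m) * fibre_map b = fibre_map (q i * t0) * fibre_map b.
      transitivity (fibre_map (u * b) * fibre_map m); first by rewrite !rmorphM mulrAC.
      rewrite -tE; transitivity (fibre_map (m * c) * fibre_map t0).
        by rewrite !rmorphM mulrC mulrA mulrAC.
      by rewrite qP !rmorphM mulrAC.
    by rewrite rmorphB (mulIf b0 E) subrr.
  rewrite (pderB (derP v)) !(pderM (derP v)) evm evt !mulr0 !add0r dm => /eqP.
  rewrite subr_eq0 => /eqP E; apply: (mulfI evu); rewrite E; field.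
  by [].
case: nJc; pose f := fibre_map c / fibre_map b.
have fpow j : exists m, ev m = 0 /\ fibre_map b * f ^+ j = fibre_map m.
  elim: j => [|j [m [evm mE]]]; first by exists b; rewrite expr0 mulr1.
  have [q qE] := socle m evm; exists q; split.
    by apply/eqP/negPn/negP => evq; apply: noT; exists m, q.
  rewrite exprSr mulrA mE /f mulrA -rmorphM qE rmorphM mulfK //.
have [j|N FN] := pole_le_normal (f := f) b0.
  by have [m [_ ->]] := fpow j; exact: fibre_map_pole.
have [h hE] := fibre_map_surj FN.
by exists h; rewrite rmorphM hE /f divfK.
Qed.

End GeneralFibre.

Lemma tangent_line : ev z != 0 \/ (exists i, ev 'X_i != 0) ->
  exists t : 'rV[k]_n.+1, forall v, tan v -> v 0 ord0 = 0 -> exists a, v = a *: t.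
Proof.
have [ev_z [//|]|ev_z _] := eqVneq (ev z) 0; last exact: tangent_line_general.
exact: tangent_line_special.
Qed.

End Point.
End FamilyPoints.

(** * Special semigroups *)

Section Origin.
Variables (k : fieldType) (n : nat) (s : n.-tuple nat).
Hypothesis s_gt0 : forall i, (0 < tnth s i)%N.
Local Notation A := {poly k}.
Local Notation P := {mpoly A[n]}.

Definition origin : {rmorphism P -> k} :=
  mpoly_hom (horner_eval 0 : {rmorphism A -> k}) (fun=> 0).

Lemma origin_cst c : origin (cst n c) = c.
Proof. by rewrite /origin /cst mpoly_homC /= /horner_eval hornerC. Qed.

Lemma wscale_at0 f : (wscale k s f).[0] = cst n (origin f).
Proof.
elim/family_ring_ind: f => [p q|p q|c||i].
- by rewrite !rmorphD hornerD => -> ->.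
- by rewrite !rmorphM hornerM => -> ->.
- by rewrite wscale_cst hornerC origin_cst.
- by rewrite wscale_z !hornerE /origin mpoly_homC /= /horner_eval hornerX rmorph0.
- by rewrite wscaleX !hornerE /origin mpoly_homX expr0n gtn_eqF //= mulr0 rmorph0.
Qed.

Lemma origin_whomog d f : whomog s d.+1 f -> origin f = 0.
Proof.
move=> hf; rewrite -(origin_cst (origin f)) -wscale_at0 hf.
by rewrite hornerM hornerXn expr0n mulr0 rmorph0.
Qed.

Lemma origin_positive f : positive_part (phomog (poly_grading k) s) f -> origin f = 0.
Proof.
case=> N [c [hc ->]]; rewrite rmorph_sum big1 // => i _.
by apply: (@origin_whomog i); apply: phomog_whomog.
Qed.

Lemma whomog0_origin f : whomog s 0 f -> f = cst n (origin f).
Proof. by move=> hf; rewrite -wscale_at0 hf hornerM hornerC expr0 hornerC mulr1. Qed.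

Lemma coord_ideal_origin f : origin f = 0 -> coord_ideal n f.
Proof.
move=> f0; apply/coord_idealP; suff -> : coord_kill k n n f = cst n (origin f) by rewrite f0 rmorph0.
elim/family_ring_ind: f {f0} => [p q|p q|c||i].
- by rewrite !rmorphD => -> ->.
- by rewrite !rmorphM => -> ->.
- by rewrite origin_cst /cst coord_killC hornerC.
- by rewrite coord_killC /origin mpoly_homC /= /horner_eval hornerX.
- by rewrite coord_killX ltn_ord /origin mpoly_homX rmorph0.
Qed.

End Origin.

Section Contradiction.
Variables (k : closedFieldType) (S : pred nat) (D : pole_filtration k S).
Hypothesis semigroupS : numerical_semigroup S.
Variables (n : nat) (s : n.-tuple nat).
Hypothesis gens : minimal_generators S s.
Local Notation P := {mpoly {poly k}[n]}.
Local Notation I := (family_ideal D gens).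

Lemma special_filtration_absurd : special_quotient (poly_grading k) s I -> False.
Proof.
case=> phi1 [phi2 [phi3 [[acyc genI [d1 [d2 [d3 [_ _ hom3]]]] [min1 min2 min3]] spec]]].
have s_gt0 := generator_gt0 gens.
have primeI := family_prime D gens.
pose ev0 : {rmorphism P -> k} := origin k n.
have ev0_2 : map_mx ev0 phi2 = 0.
  by apply/matrixP => i j; rewrite !mxE; apply: (origin_positive s_gt0); apply: min2.
have n_gt0 : (0 < n)%N.
  rewrite lt0n; apply/eqP => n0; have [_ _ [c hc]] := semigroupS.
  have [m mE] := generated_sum gens (hc c.+1 (leqnSn c)); move: mE.
  rewrite /wdeg big1 // => i; by move: (ltn_ord i); rewrite [X in (_ < X)%N]n0.
have n_gt3 : (3 < n)%N.
  apply: (length3_codim_ge3 acyc genI _ (@family_z_regular _ _ _ _ _ gens)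
    (@family_x_regular _ _ _ _ _ gens) n_gt0).
  by move=> i j; apply: coord_ideal_origin; apply: (origin_positive s_gt0); apply: min3.
pose y := ulsubmx phi3 : 'cV[P]_4.
(* A nonzero entry of degree 0 would be a nonzero constant, against minimality. A zero entry counts
   as homogeneous of any degree, so a positive degree can be assigned to every entry. *)
have [e yhom] : exists e, forall i, whomog s (e i).+1 (y i 0).
  pose i' (i : 'I_4) : 'I_(4 + 4) := lshift 4 i.
  exists (fun i => (d3 (lshift 2 0) - d2 (i' i)).-1) => i.
  have -> : y i 0 = phi3 (i' i) (lshift 2 0) by rewrite !mxE.
  have pos := origin_positive s_gt0 (min3 (i' i) (lshift 2 0)).
  have := hom3 (i' i) (lshift 2 0); case: leqP => [le /phomog_whomog h|_ ->]; last exact: whomog0.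
  case E: (d3 _ - d2 _)%N h => [|q] // h.
  by rewrite (whomog0_origin s_gt0 h) pos rmorph0; apply: whomog0.
have [ev [evK evy nz]] := homog_common_zero yhom n_gt3.
have evy0 : map_mx ev y = 0 by apply/matrixP => i j; rewrite ord1 mxE [RHS]mxE evy.
have evI f : I f -> ev f = 0.
  move=> If; have [g gE] := ideal_sub_col acyc genI spec If.
  have := congr1 (map_mx ev) gE; rewrite map_mxM evy0 mulmx0 => /matrixP/(_ 0 0).
  by rewrite !mxE mulr1n.
have [t ht] := tangent_line semigroupS evK evI nz.
have dual r := @dual_equations k n ev evK I (family_idealE D gens) r
  (fun q V => tangent_rank evK ht).
have n4 : n = 4.
  apply/eqP; rewrite eqn_leq n_gt3 andbT leqNgt; apply/negP => n5.
  have [f [d [If dP dE]]] := dual 4 n5.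
  by have := codim_le3 acyc genI spec evI evy0 If dP dE.
have [f [d [If dP dE]]] := dual 3 n_gt3.
exact: (special_contradiction primeI acyc genI spec ev0_2 evK evI evy0 If dP dE).
Qed.

End Contradiction.

Lemma special_not_filtered (k : closedFieldType) (S : pred nat) :
  numerical_semigroup S -> special_semigroup k S -> pole_filtration k S -> False.
Proof.
move=> hS [n [s [gens spec]]] D; apply: (special_filtration_absurd hS (gens := gens)).
exact: (spec _ _ _ _ (rees_deformation D gens)).
Qed.

(** * The function field *)

Section PrimeQuotient.
Local Open Scope quotient_scope.
Variables (T : comNzRingType) (J : T -> Prop).
Hypothesis primeJ : prime_ideal J.

Definition prime_pred (a : T) : bool := if excluded_middle_informative (J a) then true else false.

Lemma prime_predP a : reflect (J a) (prime_pred a).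
Proof. by rewrite /prime_pred; case: excluded_middle_informative => h; constructor. Qed.

Lemma prime_pred_idealr : idealr_closed prime_pred.
Proof.
have [IJ J1 _] := primeJ; split.
- by apply/prime_predP; apply: ideal0.
- by apply/negP => /prime_predP.
- move=> a u v /prime_predP Ju /prime_predP Jv; apply/prime_predP.
  by apply: idealD => //; apply: idealM.
Qed.

Lemma prime_pred_prime : prime_idealr_closed prime_pred.
Proof.
have [_ _ Jp] := primeJ; move=> u v /prime_predP/Jp[] h; apply/orP; [left | right]; exact/prime_predP.
Qed.

HB.instance Definition _ := isIdealr.Build T prime_pred prime_pred_idealr.
HB.instance Definition _ := isPrimeIdealrClosed.Build T prime_pred prime_pred_prime.

Definition prime_quotient := {ideal_quot (prime_pred : prime_idealr T)}.
HB.instance Definition _ := GRing.ComNzRing.on prime_quotient.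

Definition quot_unit (x : prime_quotient) : bool :=
  if excluded_middle_informative (exists y, y * x = 1) then true else false.
Definition quot_inv (x : prime_quotient) : prime_quotient :=
  if excluded_middle_informative (exists y, y * x = 1) is left h
  then proj1_sig (constructive_indefinite_description _ h) else x.

Lemma quot_mulVr : {in quot_unit, left_inverse 1 quot_inv *%R}.
Proof.
move=> x; rewrite unfold_in /quot_unit /quot_inv; case: excluded_middle_informative => // h _.
by case: constructive_indefinite_description.
Qed.
Lemma quot_unitP x y : y * x = 1 -> quot_unit x.
Proof.
by move=> h; rewrite /quot_unit; case: excluded_middle_informative => // -[]; exists y.
Qed.
Lemma quot_inv_out : {in [predC quot_unit], quot_inv =1 id}.
Proof.
by move=> x; rewrite !inE unfold_in /quot_unit /quot_inv; case: excluded_middle_informative.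
Qed.
HB.instance Definition _ := GRing.ComNzRing_hasMulInverse.Build prime_quotient
  quot_mulVr quot_unitP quot_inv_out.
Lemma quot_integral (x y : prime_quotient) : x * y = 0 -> (x == 0) || (y == 0).
Proof. exact: Quotient.rquot_IdomainAxiom. Qed.
HB.instance Definition _ := GRing.ComUnitRing_isIntegral.Build prime_quotient quot_integral.

(** Applied to the ideal of [X], this gives the function field of the affine cone over [X]. The
    rational functions on [X] are its quotients of forms of equal degree. *)
Lemma prime_fraction_field : exists (L : fieldType) (rho : {rmorphism T -> L}),
  forall a, rho a = 0 <-> J a.
Proof.
exists {fraction prime_quotient}.
pose g : {rmorphism T -> prime_quotient} := \pi_prime_quotient.
exists (@tofrac prime_quotient \o g : {rmorphism T -> {fraction prime_quotient}}) => a.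
have -> : (tofrac (g a) = 0) <-> (g a = 0).
  by split=> [/eqP|->]; rewrite ?tofrac0 // tofrac_eq0 => /eqP.
have gE : (g a == 0) = (a \in prime_pred).
  rewrite -(rmorph0 g) -[a in RHS]subr0; apply/esym.
  exact: (Quotient.idealrBE (prime_pred : prime_idealr T) a 0).
by split=> [/eqP|Ja]; [rewrite gE => /prime_predP | apply/eqP; rewrite gE; apply/prime_predP].
Qed.

End PrimeQuotient.

Section HomogeneousComponents.
Variables (k : fieldType) (M : nat).
Local Notation T := {mpoly k[M]}.

(* X_i |-> X_i t, so that the coefficient of t^d is the component of degree d. *)
Definition hscale : {rmorphism T -> {poly T}} :=
  mpoly_hom (polyC \o @mpolyC M k : {rmorphism k -> {poly T}}) (fun i => ('X_i)%:P * 'X).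

Definition hcomp (d : nat) (f : T) : T := (hscale f)`_d.

Lemma hscaleC c : hscale c%:MP = (c%:MP)%:P. Proof. exact: mpoly_homC. Qed.
Lemma hscaleX i : hscale 'X_i = ('X_i)%:P * 'X. Proof. exact: mpoly_homX. Qed.

Lemma hcompD d f g : hcomp d (f + g) = hcomp d f + hcomp d g.
Proof. by rewrite /hcomp rmorphD coefD. Qed.

Lemma hscale_at1 f : (hscale f).[1] = f.
Proof.
elim/mpoly_gen_ind: f => [p q|p q|c|i].
- by rewrite rmorphD hornerD => -> ->.
- by rewrite rmorphM hornerM => -> ->.
- by rewrite hscaleC hornerC.
- by rewrite hscaleX !hornerE.
Qed.

Lemma hcomp_sum f : f = \sum_(i < size (hscale f)) hcomp i f.
Proof.
rewrite -{1}[f]hscale_at1 horner_coef; apply: eq_bigr => i _.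
by rewrite expr1n mulr1.
Qed.

Lemma hscale_homog d f : f \is d.-homog -> hscale f = f%:P * 'X^d.
Proof.
move=> /dhomogP hf; rewrite {1 2}(mpolyE f) !rmorph_sum mulr_suml big_seq [RHS]big_seq.
apply: eq_bigr => m /hf <-; rewrite -mul_mpolyC !rmorphM /= hscaleC -mulrA; congr (_ * _).
rewrite mpolyXE_id !rmorph_prod mdegE -prodrXr -big_split; apply: eq_bigr => i _ /=.
by rewrite !rmorphXn /= hscaleX exprMn.
Qed.

Lemma hcomp_homog d f : hcomp d f \is d.-homog.
Proof.
elim/mpoly_gen_ind: f d => [p q hp hq|p q hp hq|c|i] d.
- by rewrite hcompD rpredD.
- rewrite /hcomp rmorphM coefM rpred_sum // => j _.
  by have := dhomogM (hp j) (hq (d - j)%N); rewrite subnKC // -ltnS.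
- rewrite /hcomp hscaleC coefC; case: eqP => [->|_]; last exact: dhomog0.
  by rewrite -[c%:MP]mulr1 mul_mpolyC dhomogZ // dhomog1.
- rewrite /hcomp hscaleX coefCM coefX; case: eqP => [->|_]; last by rewrite mulr0 dhomog0.
  by rewrite mulr1 dhomogX /= mdeg1.
Qed.

Lemma hcomp_id d e f : f \is d.-homog -> hcomp e f = if e == d then f else 0.
Proof.
by move=> /hscale_homog; rewrite /hcomp => ->; rewrite coefCM coefXn; case: eqP; rewrite ?mulr1 ?mulr0.
Qed.

Lemma hcompM d e f g : g \is e.-homog ->
  hcomp d (f * g) = if (e <= d)%N then hcomp (d - e) f * g else 0.
Proof.
move=> /hscale_homog hg; rewrite /hcomp rmorphM hg mulrA coefMXn ltnNge; case: leqP => //= _.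
by rewrite coefMC.
Qed.

End HomogeneousComponents.

(** * The homogeneous ideal of a projective variety *)

Section Cone.
Variables (k : closedFieldType) (N : nat) (X : 'rV[k]_N.+1 -> Prop).
Hypothesis varX : proj_variety X.
Local Notation T := {mpoly k[N.+1]}.

Definition evx (x : 'rV[k]_N.+1) : {rmorphism T -> k} :=
  mpoly_hom (idfun : {rmorphism k -> k}) (x 0).

Lemma evxC x c : evx x c%:MP = c. Proof. exact: mpoly_homC. Qed.
Lemma evxX x i : evx x 'X_i = x 0 i. Proof. exact: mpoly_homX. Qed.
Lemma evxE x (f : T) : ev f x = evx x f.
Proof.
rewrite /ev; elim/mpoly_gen_ind: f => [p q|p q|c|i].
- by rewrite mevalD rmorphD => -> ->.
- by rewrite mevalM rmorphM => -> ->.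
- by rewrite mevalC evxC.
- by rewrite mevalXU evxX.
Qed.

Lemma evx_scale x c f : (map_poly (evx x) (hscale k N.+1 f)).[c] = evx (c *: x) f.
Proof.
elim/mpoly_gen_ind: f => [p q|p q|a|i].
- by rewrite !rmorphD hornerD => -> ->.
- by rewrite !rmorphM hornerM => -> ->.
- by rewrite hscaleC map_polyC hornerC /= !evxC.
- by rewrite hscaleX rmorphM /= map_polyC map_polyX hornerM hornerC hornerX /= !evxX mxE mulrC.
Qed.

Lemma evx_homog d x c f : f \is d.-homog -> evx (c *: x) f = c ^+ d * evx x f.
Proof.
move=> hf; rewrite -evx_scale (hscale_homog hf) rmorphM /= map_polyC map_polyXn /=.
by rewrite hornerM hornerC hornerXn mulrC.
Qed.

Lemma cone x c : X x -> c != 0 -> X (c *: x).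
Proof.
have [[F [Fh XF]] _] := varX => /XF[x0 Fx] c0; apply/XF; split.
  by rewrite scaler_eq0 negb_or c0.
move=> f Ff; have [d hf] := Fh f Ff.
by rewrite evxE (evx_homog _ _ hf) -evxE Fx // mulr0.
Qed.

Lemma point_neq0 x : X x -> x != 0.
Proof. by have [[F [_ XF]] _] := varX => /XF[]. Qed.

Lemma vanishes_closed x : x != 0 -> (forall f, vanishes_on X f -> ev f x = 0) -> X x.
Proof.
have [[F [Fh XF]] _] := varX => x0 h; apply/XF; split=> // f Ff; apply: h => y /XF[_]; exact.
Qed.

(** On the line through [x], [f] is a polynomial in the scalar whose coefficients are the values of
    its components. It vanishes at all nonzero scalars, and [k] is infinite. *)
Lemma vanishes_hcomp d f : vanishes_on X f -> vanishes_on X (hcomp d f).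
Proof.
move=> hf x Xx; pose q := map_poly (evx x) (hscale k N.+1 f).
suff q0 : q = 0 by rewrite evxE; move/polyP/(_ d): q0; rewrite coef_map coef0.
apply/eqP/negPn/negP => q0.
have : q * 'X != 0 by rewrite mulf_neq0 ?polyX_eq0.
case/closed_nonrootP => c; rewrite /root hornerM hornerX mulf_eq0 negb_or => /andP[qc c0].
by case/eqP: qc; rewrite evx_scale -evxE; apply: hf; apply: cone.
Qed.

Lemma vanishes_ideal : ideal (vanishes_on X).
Proof.
split.
- by move=> x _; rewrite evxE rmorph0.
- by move=> f g hf hg x Xx; rewrite evxE rmorphD /= -!evxE hf // hg // addr0.
- by move=> f g hg x Xx; rewrite evxE rmorphM /= -!evxE hg // mulr0.
Qed.

Lemma vanishes_homog_prime d e f g : f \is d.-homog -> g \is e.-homog ->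
  vanishes_on X (f * g) -> vanishes_on X f \/ vanishes_on X g.
Proof.
move=> hf hg hfg; have [[F [Fh XF]] [_ irr]] := varX.
pose Z h x := X x /\ ev h x = 0.
have Zclosed h c : h \is c.-homog -> proj_closed (Z h).
  move=> hh; exists (fun u => F u \/ u = h); split=> [u [/Fh//|->]|x]; first by exists c.
  split=> [[/XF[x0 Fx] hx]|[x0 hx]]; first by split=> // u [/Fx|->].
  by split; [apply/XF; split=> // u Fu; apply: hx; left | apply: hx; right].
have [x Xx|h|h] := irr _ _ (Zclosed f d hf) (Zclosed g e hg).
- have /eqP := hfg x Xx; rewrite evxE rmorphM mulf_eq0 -!evxE.
  by case/orP=> /eqP h; [left | right].
- by left=> x /h[].
- by right=> x /h[].
Qed.

(** Irreducibility only speaks of forms. In a product that vanishes on [X], the lowest components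
    not vanishing on [X] of the two factors reduce the claim to that case. *)
Lemma vanishes_prime : prime_ideal (vanishes_on X).
Proof.
have IV := vanishes_ideal.
have [_ [[x0 Xx0] _]] := varX.
split=> //; first by move=> /(_ x0 Xx0)/eqP; rewrite evxE rmorph1 oner_eq0.
move=> f g hfg; apply: NNPP => /not_or_and[nf ng].
have low h : ~ vanishes_on X h -> exists d, ~ vanishes_on X (hcomp d h) /\
    forall e, (e < d)%N -> vanishes_on X (hcomp e h).
  move=> nh; have [|d nd dmin] := @exists_minimal (fun d => ~ vanishes_on X (hcomp d h)).
    apply: not_all_not_ex => hall; apply: nh; rewrite (hcomp_sum h).
    by apply: (ideal_sum IV) => i _; apply: NNPP => /hall.
  by exists d; split=> // e ltd; apply: NNPP => /dmin; rewrite leqNgt ltd.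
have [d [nd hd]] := low f nf; have [e [ne he]] := low g ng.
have := vanishes_hcomp (d + e) hfg; rewrite /hcomp rmorphM coefM.
have lt : (d < (d + e).+1)%N by rewrite ltnS leq_addr.
rewrite (bigD1 (Ordinal lt)) //= addKn -!/(hcomp _ _) => h.
have : vanishes_on X (hcomp d f * hcomp e g).
  rewrite -[_ * _](addrK (\sum_(i < (d + e).+1 | i != Ordinal lt) (hscale k N.+1 f)`_i * (hscale k N.+1 g)`_(d + e - i))).
  apply: (idealB IV) => //; apply: (ideal_sum IV) => i id.
  have [lti|] := ltnP i d; first by apply: (idealMl IV); apply: hd.
  rewrite leq_eqVlt => /predU1P[E|gti]; first by case/eqP: id; apply: val_inj.
  by apply: (idealM IV); apply: he; have := ltn_ord i; lia.
by case/(vanishes_homog_prime (hcomp_homog _ _) (hcomp_homog _ _)).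
Qed.

End Cone.

(** * Local rings *)

Lemma nullstellensatz_coordinates (k : closedFieldType) n : noetherian {mpoly k[n]} /\
  nullstellensatz (@mpolyC n k \o (idfun : {rmorphism k -> k}) : {rmorphism k -> {mpoly k[n]}}).
Proof.
exact: (nullstellensatz_mpoly (@noetherian_field k) (@nullstellensatz_field k)).
Qed.

Lemma eigenvalue_closed (k : closedFieldType) (L : fieldType) (iota : {rmorphism k -> L}) n
    (A : 'M[k]_n) (v : 'rV[L]_n) l :
  v != 0 -> v *m map_mx iota A = l *: v -> exists c, l = iota c.
Proof.
move=> v0 hv; have : eigenvalue (map_mx iota A) l by apply/eigenvalueP; exists v.
rewrite eigenvalue_root_char -map_char_poly.
have [r ->] := closed_field_poly_normal (char_poly A).
rewrite (monicP (char_poly_monic A)) scale1r rmorph_prod /=.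
rewrite (eq_bigr (fun z => 'X - (iota z)%:P)) => [|z _]; last by rewrite rmorphB /= map_polyX map_polyC.
rewrite -(big_map iota xpredT (fun z => 'X - z%:P)) root_prod_XsubC => /mapP[c _ ->].
by exists c.
Qed.

Section LocalRings.
Variables (k : closedFieldType) (N : nat) (X : 'rV[k]_N.+1 -> Prop).
Local Notation T := {mpoly k[N.+1]}.
Variables (L : fieldType) (rho : {rmorphism T -> L}).
Hypothesis rho0 : forall a, rho a = 0 <-> vanishes_on X a.

(** Membership in the local ring at [q] and the residue there, in one relation. Equal degrees are
    demanded because [L] also contains elements that are not functions on [X]. *)
Definition has_val (q : 'rV[k]_N.+1) (l : L) (c : k) : Prop :=
  exists d a b, [/\ a \is d.-homog, b \is d.-homog, evx q b != 0,
    l = rho a / rho b & c = evx q a / evx q b].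

Lemma rho_neq0 q b : X q -> evx q b != 0 -> rho b != 0.
Proof. by move=> Xq; apply: contra_neq => /rho0/(_ q Xq); rewrite evxE. Qed.

Lemma rho_eq q a b : X q -> rho a = rho b -> evx q a = evx q b.
Proof.
move=> Xq /eqP; rewrite -subr_eq0 -rmorphB => /eqP/rho0/(_ q Xq).
by rewrite evxE rmorphB /= => /eqP; rewrite subr_eq0 => /eqP.
Qed.

Section Point.
Variables (q : 'rV[k]_N.+1) (Xq : X q).

Lemma has_val_fun l c c' : has_val q l c -> has_val q l c' -> c = c'.
Proof.
case=> d [a [b [_ _ bq -> ->]]] [d' [a' [b' [_ _ bq' E ->]]]].
have := rho_neq0 Xq bq; have := rho_neq0 Xq bq' => rb' rb.
move/eqP: E; rewrite eqr_div // -!rmorphM => /eqP/(rho_eq Xq); rewrite !rmorphM /= => E.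
by apply/eqP; rewrite eqr_div // E.
Qed.

Lemma has_val_const c : has_val q (rho c%:MP) c.
Proof.
exists 0, c%:MP, 1; rewrite !rmorph1 !divr1 evxC oner_eq0; split=> //; last exact: dhomog1.
by rewrite -[c%:MP]mulr1 mul_mpolyC dhomogZ // dhomog1.
Qed.

Lemma has_val1 : has_val q 1 1.
Proof. by have := has_val_const 1; rewrite mpolyC1 rmorph1. Qed.

Lemma has_val0 : has_val q 0 0.
Proof. by have := has_val_const 0; rewrite mpolyC0 rmorph0. Qed.

Lemma has_valD l l' c c' : has_val q l c -> has_val q l' c' -> has_val q (l + l') (c + c').
Proof.
case=> d [a [b [ha hb bq -> ->]]] [d' [a' [b' [ha' hb' bq' -> ->]]]].
have := rho_neq0 Xq bq; have := rho_neq0 Xq bq' => rb' rb.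
exists (d + d')%N, (a * b' + a' * b), (b * b'); rewrite !(rmorphD, rmorphM) /=; split.
- by apply: rpredD; last rewrite mulrC; apply: dhomogM.
- exact: dhomogM.
- by rewrite mulf_neq0.
- by rewrite addf_div.
- by rewrite addf_div.
Qed.

Lemma has_valM l l' c c' : has_val q l c -> has_val q l' c' -> has_val q (l * l') (c * c').
Proof.
case=> d [a [b [ha hb bq -> ->]]] [d' [a' [b' [ha' hb' bq' -> ->]]]].
exists (d + d')%N, (a * a'), (b * b'); rewrite !rmorphM /= !mulf_div; split=> //.
- exact: dhomogM.
- exact: dhomogM.
- by rewrite mulf_neq0.
Qed.

Lemma has_valN l c : has_val q l c -> has_val q (- l) (- c).
Proof.
by move/(has_valM (has_val_const (-1))); rewrite mpolyCN mpolyC1 rmorphN1 !mulN1r.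
Qed.

Lemma has_valB l l' c c' : has_val q l c -> has_val q l' c' -> has_val q (l - l') (c - c').
Proof. by move=> h /has_valN; apply: has_valD. Qed.

Lemma has_valX l c n : has_val q l c -> has_val q (l ^+ n) (c ^+ n).
Proof.
move=> h; elim: n => [|n IH]; rewrite ?expr0 ?exprS; [exact: has_val1 | exact: has_valM].
Qed.

Lemma has_val_sum (I : Type) (r : seq I) (P : pred I) l c :
  (forall i, P i -> has_val q (l i) (c i)) ->
  has_val q (\sum_(i <- r | P i) l i) (\sum_(i <- r | P i) c i).
Proof.
by move=> h; elim/big_rec2: _ => [|i y1 y2 Pi]; [exact: has_val0 | apply: has_valD; apply: h].
Qed.

Lemma has_valV l c : has_val q l c -> c != 0 -> has_val q l^-1 c^-1.
Proof.
case=> d [a [b [ha hb bq -> ->]]]; rewrite mulf_eq0 negb_or => /andP[aq _].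
by exists d, b, a; rewrite !invf_div.
Qed.

Lemma has_val_neq0 l c : has_val q l c -> c != 0 -> l != 0.
Proof.
by move=> h; apply: contra_neq => l0; apply: (has_val_fun h); rewrite l0; apply: has_val0.
Qed.

Definition regular_elt (l : L) := exists c, has_val q l c.
Definition unit_elt (l : L) := exists2 c, c != 0 & has_val q l c.

Definition uniformizing (tau : L) : Prop :=
  has_val q tau 0 /\ forall l, has_val q l 0 -> exists2 u, regular_elt u & l = tau * u.

Lemma regular_eltM l l' : regular_elt l -> regular_elt l' -> regular_elt (l * l').
Proof. by case=> c h [c' h']; exists (c * c'); apply: has_valM. Qed.

Lemma unit_regular l : unit_elt l -> regular_elt l.
Proof. by case=> c _ h; exists c. Qed.

Lemma unit_eltM l l' : unit_elt l -> unit_elt l' -> unit_elt (l * l').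
Proof.
by case=> c c0 h [c' c0' h']; exists (c * c'); [rewrite mulf_neq0 | apply: has_valM].
Qed.

Lemma unit_eltV l : unit_elt l -> unit_elt l^-1.
Proof. by case=> c c0 h; exists c^-1; [rewrite invr_eq0 | apply: has_valV]. Qed.

Lemma unit_eltX l n : unit_elt l -> unit_elt (l ^+ n).
Proof. by case=> c c0 h; exists (c ^+ n); [rewrite expf_neq0 | apply: has_valX]. Qed.

Lemma unit_elt_neq0 l : unit_elt l -> l != 0.
Proof. by case=> c c0 h; apply: (has_val_neq0 h). Qed.

(* Krull: otherwise h = tau^i h_i for all i, and the ideals of the g with
   g / h_i regular at q form an ascending chain; when it stops, h_(m+1) / h_m
   is regular at q, hence 1 = tau * (h_(m+1) / h_m) has value 0. *)
Lemma order_factorization tau h : uniformizing tau -> regular_elt h -> h != 0 ->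
  exists i u, unit_elt u /\ h = tau ^+ i * u.
Proof.
move=> [tau0 gen] [c0 hc0] hn0; apply: NNPP => nofac.
have step i : exists g, regular_elt g /\ h = tau ^+ i * g.
  elim: i => [|i [g [[c gc] hg]]]; first by exists h; rewrite mul1r; split=> //; exists c0.
  have [c_0|cn0] := eqVneq c 0.
    by move: gc; rewrite c_0 => /gen[u ru gu]; exists u; split=> //; rewrite hg gu exprSr mulrA.
  by case: nofac; exists i, g; split=> //; exists c.
have [g_ gP] := choice _ step.
have taun0 : tau != 0.
  by apply: contra_neq hn0 => t0; have [_] := gP 1%N; rewrite t0 expr1 mul0r.
have gS i : g_ i = tau * g_ i.+1.
  apply: (mulfI (expf_neq0 i taun0)); rewrite mulrA -exprSr.
  by have [_ <-] := gP i; have [_ <-] := gP i.+1.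
have gn0 i : g_ i != 0.
  by apply: contra_neq hn0 => g0; have [_ ->] := gP i; rewrite g0 mulr0.
have [d [a [b [_ _ bq tauE /esym/eqP]]]] := tau0.
rewrite mulf_eq0 invr_eq0 (negPf bq) orbF => /eqP aq; have rb := rho_neq0 Xq bq.
pose J i (G : T) := exists E C, evx q E != 0 /\ rho E * rho G = rho C * g_ i.
have IJ i : ideal (J i).
  split.
  - by exists 1, 0; rewrite !rmorph1 !rmorph0 oner_eq0 mulr0 mul0r.
  - move=> G1 G2 [E1 [C1 [e1 h1]]] [E2 [C2 [e2 h2]]].
    exists (E1 * E2), (C1 * E2 + C2 * E1); rewrite !(rmorphD, rmorphM) /= mulf_neq0 //; split=> //.
    transitivity (rho E2 * (rho E1 * rho G1) + rho E1 * (rho E2 * rho G2)); first by ring.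
    by rewrite h1 h2; ring.
  - move=> A G [E [C [e hh]]]; exists E, (A * C); split=> //.
    by rewrite !rmorphM /= -mulrA -hh mulrCA.
have [|m hm] := (nullstellensatz_coordinates k N.+1).1 J IJ.
  move=> i G [E [C [e hh]]]; exists (E * b), (C * a); rewrite !rmorphM /= mulf_neq0 //; split=> //.
  by rewrite mulrAC hh (gS i) tauE; field.
have [[c [d' [a' [b' [_ _ bq' gE _]]]]] _] := gP m.+1.
have rb' := rho_neq0 Xq bq'.
have [|E [C [e hh]]] := hm m.+1 a'.
  by exists 1, b'; rewrite !rmorph1 oner_eq0 mul1r gE mulrC divfK.
have : rho (E * b' * b) = rho (C * a).
  rewrite !rmorphM /=; apply: (mulIf (gn0 m.+1)).
  have -> : rho C * rho a * g_ m.+1 = rho b * (rho C * g_ m) by rewrite (gS m) tauE; field.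
  by rewrite -hh {1}gE; field.
by move/(rho_eq Xq)/eqP; rewrite !rmorphM /= aq mulr0 !mulf_eq0 (negPf e) (negPf bq) (negPf bq').
Qed.

End Point.

Hypothesis varX : proj_variety X.

Lemma has_val_same_point p q l c : same_point p q -> has_val p l c -> has_val q l c.
Proof.
case=> z z0 -> [d [a [b [ha hb bp -> ->]]]]; exists d, a, b.
rewrite !(evx_homog _ _ ha) !(evx_homog _ _ hb) mulf_neq0 ?expf_neq0 //; split=> //.
by rewrite -mulf_div divff ?expf_neq0 // mul1r.
Qed.

(* The homogeneous g with l g in the coordinate ring contain all monomials of
   some degree d, so multiplication by l preserves their span, and l is an
   eigenvalue of a matrix over k. *)
Lemma regular_everywhere l : (forall q, X q -> regular_elt q l) ->
  exists c, l = rho c%:MP.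
Proof.
move=> reg.
pose J (G : T) := exists F, rho F = l * rho G.
have IJ : ideal J.
  split.
  - by exists 0; rewrite rmorph0 mulr0.
  - by move=> a b [F hF] [G hG]; exists (F + G); rewrite !rmorphD /= hF hG mulrDr.
  - by move=> a b [F hF]; exists (a * F); rewrite !rmorphM /= hF mulrCA.
have powJ i : exists D, J ('X_i ^+ D).
  apply: not_all_not_ex => noD.
  have [chi [chiK chiJ chi0]] := (nullstellensatz_coordinates k N.+1).2 J 'X_i IJ noD.
  pose q : 'rV[k]_N.+1 := \row_j chi 'X_j.
  have chiE f : chi f = evx q f.
    elim/mpoly_gen_ind: f => [f g|f g|c|j].
    - by rewrite !rmorphD => -> ->.
    - by rewrite !rmorphM => -> ->.
    - by rewrite evxC; exact: chiK.
    - by rewrite evxX mxE.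
  have Xq : X q.
    apply: (vanishes_closed varX).
      by apply: contra_neq chi0 => q0; rewrite chiE evxX q0 mxE.
    move=> f hf; rewrite evxE -chiE; apply: chiJ; exists 0.
    by rewrite rmorph0 (rho0 f).2 ?mulr0.
  have [c [d [a [b [_ _ bq lE _]]]]] := reg q Xq.
  have rb := rho_neq0 Xq bq; case/eqP: bq; rewrite -chiE; apply: chiJ; exists a.
  by rewrite lE divfK.
have [D powD] : exists D, forall i, J ('X_i ^+ D).
  have [D hD] := choice _ powJ; exists (\max_i D i)%N => i.
  by rewrite -(subnK (leq_bigmax i)) exprD; apply: (idealM IJ).
(* Pigeonhole: a monomial of this degree in [N.+1] variables has an exponent at least [D]. *)
pose d := (N.+1 * D)%N.
have monJ (m : 'X_{1..N.+1}) : mdeg m = d -> J 'X_[m].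
  move=> md; have [i lti] : exists i, (D <= m i)%N.
    apply: not_all_not_ex => h.
    have hm i : (m i < D)%N by rewrite ltnNge; apply/negP/h.
    have : (mdeg m <= N.+1 * D.-1)%N.
      rewrite mdegE -[X in (_ <= X * _)%N](card_ord N.+1) -sum_nat_const leq_sum // => i _.
      by have := hm i; lia.
    by rewrite md /d leq_pmul2l // leqNgt prednK ?leqnn //; apply: leq_trans (hm ord0).
  rewrite mpolyXE_id (bigD1 i) //= -(subnK lti) exprD -mulrA [_ ^+ D * _]mulrC mulrA.
  exact: (idealM IJ).
have [_ [[x0 Xx0] _]] := varX.
have [c [e [a [b [ha hb bq lE _]]]]] := reg x0 Xx0; have rb := rho_neq0 Xx0 bq.
(* Since [l] is a quotient of forms of equal degree, [F] can be replaced by its component of degree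
   [d]. *)
have monE (m : 'X_{1..N.+1}) : mdeg m = d -> exists2 F, F \is d.-homog & rho F = l * rho 'X_[m].
  move=> md; have [F hF] := monJ m md; exists (hcomp d F); first exact: hcomp_homog.
  have : vanishes_on X (F * b - a * 'X_[m]).
    by apply/rho0; rewrite rmorphB !rmorphM /= hF lE; field.
  have hX : a * 'X_[m] \is (d + e).-homog by rewrite addnC dhomogM // dhomogX /= md.
  move/(vanishes_hcomp varX (d + e)); rewrite /hcomp rmorphB coefB -!/(hcomp _ _) (hcompM _ _ hb) leq_addl addnK (hcomp_id _ hX) eqxx.
  move/rho0; rewrite rmorphB !rmorphM /= lE => /eqP; rewrite subr_eq0 => /eqP E.
  by apply: (mulIf rb); rewrite E; field.
have [F FP] : exists F : 'X_{1..N.+1} -> T, forall m, mdeg m = d ->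
    F m \is d.-homog /\ rho (F m) = l * rho 'X_[m].
  apply: (choice (fun m f => mdeg m = d -> f \is d.-homog /\ rho f = l * rho 'X_[m])) => m.
  have [md|nd] := eqVneq (mdeg m) d; last by exists 0 => md; rewrite md eqxx in nd.
  by have [F h1 h2] := monE m md; exists F.
(* The finite index type contains all monomials of degree at most [d]; those of lower degree get the
   entry 0 in [v] and a zero column in [A]. *)
pose e_ (i : 'I_#|{: 'X_{1..N.+1 < d.+1}}|) : 'X_{1..N.+1} := bmnm (enum_val i).
pose v : 'rV[L]_#|{: 'X_{1..N.+1 < d.+1}}| :=
  \row_i (if mdeg (e_ i) == d then rho 'X_[e_ i] else 0).
pose A : 'M[k]_#|{: 'X_{1..N.+1 < d.+1}}| :=
  \matrix_(i, j) (if mdeg (e_ j) == d then (F (e_ j))@_(e_ i) else 0).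
apply: (@eigenvalue_closed k L (rho \o @mpolyC N.+1 k : {rmorphism k -> L}) _ A v l).
  have [i xi] : exists i, x0 0 i != 0.
    apply: not_all_not_ex => h; case/eqP: (point_neq0 varX Xx0); apply/rowP => i; rewrite mxE.
    by apply/eqP/negPn/negP/h.
  have rX : rho 'X_i != 0 by apply: (rho_neq0 Xx0); rewrite evxX.
  have dm : mdeg (U_(i) *+ d)%MM = d by rewrite mdegMn mdeg1 mul1n.
  have ltm : (mdeg (U_(i) *+ d)%MM < d.+1)%N by rewrite dm.
  apply/eqP => /rowP/(_ (enum_rank (BMultinom ltm))); rewrite !mxE /e_ enum_rankK /= dm eqxx.
  by move/eqP; rewrite -mpolyXn rmorphXn expf_eq0 (negPf rX) andbF.
apply/rowP => j; rewrite !mxE.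
under eq_bigr => i _ do rewrite !mxE.
have [jd|_] := eqVneq (mdeg (e_ j)) d; last first.
  by rewrite mulr0 big1 // => i _; rewrite rmorph0 mulr0.
have [/dhomogP Fh <-] := FP _ jd.
have Fsize : (msize (F (e_ j)) <= d.+1)%N.
  by rewrite mmeasureE; apply/bigmax_leqP_seq => m hm _; rewrite (Fh m hm).
rewrite [X in _ = rho X](mpolywE Fsize) rmorph_sum /=.
rewrite (reindex_onto enum_rank enum_val) /=; last by move=> i _; rewrite enum_valK.
rewrite (eq_bigl xpredT) => [|i]; last by rewrite enum_rankK eqxx.
apply: eq_bigr => m _; rewrite /e_ enum_rankK -mul_mpolyC rmorphM /=.
case: eqP => [_|nd]; first by rewrite mulrC.
have : bmnm m \notin msupp (F (e_ j)) by apply/negP => /Fh.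
by move/memN_msupp_eq0 => ->; rewrite mpolyC0 rmorph0 mulr0 mul0r.
Qed.

End LocalRings.

(** * Uniformizers *)

Lemma mderivXU (R : comNzRingType) n (i j : 'I_n) : ('X_i : {mpoly R[n]})^`M(j) = (i == j)%:R.
Proof.
rewrite mderivX mnm1E; case: eqP => [->|_]; last by rewrite scale0r.
have -> : (U_(j) - U_(j) = 0 :> 'X_{1..n})%MM by apply/mnmP => l; rewrite mnmBE mnmE subnn mnmE.
by rewrite mpolyX0 scale1r.
Qed.

Lemma euler_formula (k : fieldType) n d (f : {mpoly k[n]}) : f \is d.-homog ->
  \sum_j 'X_j * f^`M(j) = f *+ d.
Proof.
move=> hf.
have E (g : {mpoly k[n]}) : \sum_j 'X_j * g^`M(j) = (hscale k n g)^`().[1].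
  elim/mpoly_gen_ind: g => [p q hp hq|p q hp hq|c|i].
  - rewrite rmorphD derivD hornerD -hp -hq -big_split /=.
    by apply: eq_bigr => j _; rewrite mderivD mulrDr.
  - rewrite rmorphM derivM hornerD !hornerM !hscale_at1 -hp -hq mulr_suml mulr_sumr -big_split /=.
    by apply: eq_bigr => j _; rewrite mderivM; ring.
  - rewrite hscaleC derivC horner0 big1 // => j _; by rewrite mderivC mulr0.
  - rewrite hscaleX derivM derivC derivX mul0r add0r mulr1 hornerC (bigD1 i) //= mderivXU eqxx mulr1.
    by rewrite big1 ?addr0 // => j ne; rewrite mderivXU eq_sym (negPf ne) mulr0.
rewrite E (hscale_homog hf) derivM derivC mul0r add0r derivXn hornerM hornerC hornerMn hornerXn.
by rewrite expr1n mulr_natr.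
Qed.

(** Every row of [J] is orthogonal to [q], by Euler's formula in the application, and the row
    [delta_mx 0 h] is not. Together they have rank at least [N], so one more row [w] completes
    them. *)
Lemma complete_rows (k : fieldType) m N (J : 'M[k]_(m, N.+1)) (q : 'rV[k]_N.+1) (h : 'I_N.+1) :
  (\rank J + 1 = N)%N -> J *m q^T = 0 -> q 0 h != 0 ->
  exists w : 'rV[k]_N.+1, forall j, exists (u : 'rV[k]_m) (a b : k),
    delta_mx 0 j = u *m J + a *: delta_mx 0 h + b *: w.
Proof.
move=> rJ Jq qh.
have ltadd p (A : 'M[k]_(p, N.+1)) (w : 'rV[k]_N.+1) : ~~ (w <= A)%MS ->
    (\rank A < \rank (A + w)%MS)%N.
  move=> nw; apply: rank_ltmx; rewrite ltmxE addsmxSl /=.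
  by apply: contra nw; apply: submx_trans; apply: addsmxSr.
have hJ : ~~ ((delta_mx 0 h : 'rV[k]_N.+1) <= J)%MS.
  apply/negP => /submxP[D /(congr1 (fun M => M *m q^T))]; rewrite -mulmxA Jq mulmx0.
  by move/matrixP/(_ 0 0)/eqP; rewrite -rowE !mxE (negPf qh).
have /ltadd := hJ; set K := (J + _)%MS => rK.
have [w wK] : exists w : 'rV[k]_N.+1, ~~ (w <= K)%MS \/ row_full K.
  have [f|nf] := boolP (row_full K); first by exists 0; right.
  have : ~~ (1%:M <= K)%MS by rewrite sub1mx.
  by case/row_subPn => i hi; exists (row i 1%:M); left.
have full : row_full (K + w)%MS.
  case: wK => [/ltadd|]; last by rewrite -!sub1mx => /submx_trans; apply; apply: addsmxSl.
  by rewrite /row_full eqn_leq rank_leq_col /=; lia.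
exists w => j; have : ((delta_mx 0 j : 'rV[k]_N.+1) <= K + w)%MS by apply: submx_full.
case/sub_addsmxP => -[u1 u2] /= E.
have : (u1 *m K <= K)%MS by apply: submxMl.
case/sub_addsmxP => -[u3 u4] /= E'.
exists u3, (u4 0 0), (u2 0 0); rewrite E E'; congr (_ + _ + _).
- by rewrite [u4]mx11_scalar mul_scalar_mx mxE.
- by rewrite [u2]mx11_scalar mul_scalar_mx mxE.
Qed.

Section Jacobian.
Variables (k : closedFieldType) (N : nat) (X : 'rV[k]_N.+1 -> Prop).
Local Notation T := {mpoly k[N.+1]}.
Variables (L : fieldType) (rho : {rmorphism T -> L}).
Hypothesis rho0 : forall a, rho a = 0 <-> vanishes_on X a.

Local Notation iota c := (rho c%:MP).

Lemma has_val_prod q (I : Type) (r : seq I) (P : pred I) l c : X q ->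
  (forall i, P i -> has_val rho q (l i) (c i)) ->
  has_val rho q (\prod_(i <- r | P i) l i) (\prod_(i <- r | P i) c i).
Proof.
move=> Xq h; elim/big_rec2: _ => [|i y1 y2 Pi]; [exact: has_val1 | apply: has_valM; exact: h].
Qed.

Lemma has_val_det q n (A : 'M[L]_n) (a : 'M[k]_n) : X q ->
  (forall i j, has_val rho q (A i j) (a i j)) -> has_val rho q (\det A) (\det a).
Proof.
move=> Xq h; apply: (has_val_sum rho0 Xq) => s _; apply: has_valM; last exact: has_val_prod.
by rewrite -[X in has_val _ _ X](rmorph_sign rho); rewrite -(rmorph_sign (@mpolyC N.+1 k)); apply: has_val_const.
Qed.

Lemma uniformizing_same_point p q tau : X p -> X q -> same_point p q ->
  uniformizing rho p tau -> uniformizing rho q tau.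
Proof.
move=> Xp Xq pq [t0 gen].
have qp : same_point q p.
  by case: pq => c c0 ->; exists c^-1; rewrite ?invr_eq0 // scalerA mulVf // scale1r.
split; first exact: has_val_same_point pq t0.
move=> l /(has_val_same_point qp)/gen[u [c hu] ->]; exists u => //.
by exists c; apply: has_val_same_point pq hu.
Qed.

Section Chart.
Variables (q : 'rV[k]_N.+1) (h : 'I_N.+1).
Hypotheses (Xq : X q) (qh : q 0 h = 1).

(* [chart] is dehomogenization with respect to 'X_h. *)
Let rX := rho 'X_h.
Let y j := rho 'X_j / rX.
Let chart : {rmorphism T -> L} :=
  mpoly_hom (rho \o @mpolyC N.+1 k : {rmorphism k -> L}) y.
Let delta j := y j - iota (q 0 j).

Lemma chart_denom_neq0 : rX != 0.
Proof. by apply: (rho_neq0 rho0 Xq); rewrite evxX qh oner_eq0. Qed.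

Lemma chartC c : chart c%:MP = iota c. Proof. exact: mpoly_homC. Qed.
Lemma chartX i : chart 'X_i = y i. Proof. exact: mpoly_homX. Qed.

Lemma has_val_y j : has_val rho q (y j) (q 0 j).
Proof.
exists 1%N, 'X_j, 'X_h; rewrite !evxX qh divr1 oner_eq0.
by rewrite !dhomogX /= !mdeg1.
Qed.

Lemma has_val_chart a : has_val rho q (chart a) (evx q a).
Proof.
elim/mpoly_gen_ind: a => [a b ha hb|a b ha hb|c|i].
- by rewrite !rmorphD; apply: has_valD.
- by rewrite !rmorphM; apply: has_valM.
- by rewrite chartC evxC; apply: has_val_const.
- by rewrite chartX evxX; apply: has_val_y.
Qed.

Lemma chart_homog d a : a \is d.-homog -> rho a = chart a * rX ^+ d.
Proof.
have E b : rho b = (map_poly chart (hscale k N.+1 b)).[rX].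
  elim/mpoly_gen_ind: b => [b c|b c|c|i].
  - by rewrite !rmorphD hornerD => -> ->.
  - by rewrite !rmorphM hornerM => -> ->.
  - by rewrite hscaleC map_polyC hornerC /= chartC.
  - by rewrite hscaleX rmorphM /= map_polyC map_polyX hornerM hornerC hornerX /= chartX divfK // chart_denom_neq0.
move=> ha; rewrite E (hscale_homog ha) rmorphM /= map_polyC map_polyXn /=.
by rewrite hornerM hornerC hornerXn.
Qed.

Lemma has_val_delta j : has_val rho q (delta j) 0.
Proof. by rewrite -(subrr (q 0 j)); apply: has_valB => //; [exact: has_val_y | exact: has_val_const]. Qed.

(** The higher terms are absorbed into the coefficients [g j], which are functions near [q] and not
    constants; no factorial appears, so any characteristic is allowed. *)
Lemma taylor a : exists g : 'I_N.+1 -> L,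
  (forall j, has_val rho q (g j) (evx q a^`M(j))) /\
  chart a = iota (evx q a) + \sum_j g j * delta j.
Proof.
elim/mpoly_gen_ind: a => [a b [g [hg Eg]] [f [hf Ef]]|a b [g [hg Eg]] [f [hf Ef]]|c|i].
- exists (fun j => g j + f j); split=> [j|]; first by rewrite mderivD rmorphD; apply: has_valD.
  rewrite !rmorphD /= Eg Ef; under [X in _ = _ + X]eq_bigr => j _ do rewrite mulrDl.
  by rewrite big_split /=; ring.
- exists (fun j => g j * chart b + iota (evx q a) * f j); split=> [j|].
    rewrite mderivM rmorphD !rmorphM; apply: (has_valD rho0 Xq); apply: has_valM => //.
      exact: has_val_chart.
    exact: has_val_const.
  under eq_bigr => j _ do rewrite mulrDl -mulrA [chart b * _]mulrC mulrA -[iota _ * f j * _]mulrA.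
  rewrite big_split /= -mulr_suml -mulr_sumr.
  rewrite !rmorphM /= {1}Eg mulrDl {1}Ef; ring.
- exists (fun=> 0); split=> [j|]; first by rewrite mderivC rmorph0; apply: has_val0.
  by rewrite big1 ?addr0 => [|j _]; rewrite ?mul0r // chartC evxC.
- exists (fun j => (i == j)%:R); split=> [j|].
    rewrite mderivXU; case: eqP => _; rewrite ?rmorph1 ?rmorph0; [exact: has_val1 | exact: has_val0].
  rewrite (bigD1 i) //= eqxx mul1r big1 => [|j ne]; last by rewrite eq_sym (negPf ne) mul0r.
  by rewrite addr0 chartX evxX /delta addrC subrK.
Qed.

(** Expanded at [q], the equations of [X] are linear relations between the [delta j] whose
    coefficients take the values of the Jacobian matrix at [q]. Together with [delta h = 0] they
    express all [delta j] by the single combination [tau], up to an error matrix [E] that vanishes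
    at [q]. *)
Lemma uniformizing_chart m (F : 'I_m -> T) :
  (forall i, vanishes_on X (F i) /\ exists d, F i \is d.-homog) ->
  (\rank (\matrix_(i < m, j < N.+1) ev (F i)^`M(j) q) + 1 = N)%N ->
  exists tau, uniformizing rho q tau.
Proof.
move=> hF; set J := (X in \rank X) => rJ.
have Jq : J *m q^T = 0.
  apply/colP => i; rewrite !mxE; have [Fi [d Fd]] := hF i.
  have := congr1 (evx q) (euler_formula Fd); rewrite rmorph_sum rmorphMn /= -evxE (Fi _ Xq) mul0rn => E0; rewrite -[RHS]E0.
  by apply: eq_bigr => j _; rewrite !mxE rmorphM /= evxX evxE mulrC.
have [|w hw] := complete_rows (h := h) rJ Jq; first by rewrite qh oner_eq0.
pose tau := \sum_l iota (w 0 l) * delta l.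
have [u hu] : exists u : 'I_N.+1 -> 'rV[k]_m * (k * k), forall j,
    delta_mx 0 j = (u j).1 *m J + (u j).2.1 *: delta_mx 0 h + (u j).2.2 *: w.
  apply: (choice (fun j (v : 'rV[k]_m * (k * k)) => delta_mx 0 j = v.1 *m J + v.2.1 *: delta_mx 0 h + v.2.2 *: w)) => j.
  by have [v [a [b E]]] := hw j; exists (v, (a, b)).
have [g hg] : exists g : 'I_m -> 'I_N.+1 -> L, forall i,
    (forall j, has_val rho q (g i j) (J i j)) /\ \sum_j g i j * delta j = 0.
  apply: (choice (fun i gi => (forall j, has_val rho q (gi j) (J i j)) /\ \sum_j gi j * delta j = 0)) => i.
  have [Fi [d Fd]] := hF i; have [gi [hgi Egi]] := taylor (F i).
  exists gi; split=> [j|]; first by rewrite mxE evxE.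
  move: Egi; rewrite -evxE (Fi _ Xq) mpolyC0 rmorph0 add0r => <-.
  have /rho0 := Fi; rewrite (chart_homog Fd) => /eqP; rewrite mulf_eq0 expf_eq0 (negPf chart_denom_neq0) andbF orbF.
  by move/eqP.
have delta_h : delta h = 0 by rewrite /delta /y qh mpolyC1 rmorph1 divff ?subrr // chart_denom_neq0.
pose E : 'M[L]_N.+1 := \matrix_(j, l) \sum_i iota ((u j).1 0 i) * (iota (J i l) - g i l).
have hE j l : has_val rho q (E j l) 0.
  rewrite mxE; have <- : \sum_(i < m) (0 : k) = 0 by rewrite big1.
  apply: (has_val_sum rho0 Xq) => i _ /=; rewrite -[X in has_val _ _ _ X](mulr0 ((u j).1 0 i)); apply: has_valM => //.
    exact: has_val_const.
  rewrite -(subrr (J i l)); apply: has_valB => //; [exact: has_val_const | exact: (hg i).1].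
pose D : 'cV[L]_N.+1 := \col_j delta j.
pose B : 'cV[L]_N.+1 := \col_j iota (u j).2.2.
have ED : (1%:M - E) *m D = tau *: B.
  rewrite mulmxBl mul1mx; apply/colP => j; rewrite !mxE.
  have dj : delta j = \sum_l iota ((delta_mx 0 j : 'rV[k]_N.+1) 0 l) * delta l.
    rewrite (bigD1 j) //= !mxE !eqxx mpolyC1 rmorph1 mul1r big1 ?addr0 // => l ne.
    by rewrite mxE (negPf ne) andbF mpolyC0 rmorph0 mul0r.
  rewrite {1}dj hu.
  under eq_bigr => l _ do rewrite !mxE !rmorphD /= !mulrDl.
  rewrite !big_split /=.
  rewrite [X in _ + X + _ - _]big1 ?addr0; last first.
    by move=> l _; have [->|_] := eqVneq l h; rewrite ?delta_h ?mulr0 // mpolyC0 rmorph0 mul0r.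
  have -> : \sum_l iota ((u j).2.2 * w 0 l) * delta l = tau * iota (u j).2.2.
    by rewrite /tau mulr_suml; apply: eq_bigr => l _; rewrite mpolyCM rmorphM /=; ring.
  rewrite addrAC -[RHS]add0r; congr (_ + _); apply/eqP; rewrite subr_eq0; apply/eqP.
  have sw (c : 'I_m -> 'I_N.+1 -> L) : \sum_l (\sum_i iota ((u j).1 0 i) * c i l) * delta l =
      \sum_i iota ((u j).1 0 i) * \sum_l c i l * delta l.
    under eq_bigr => l _ do rewrite mulr_suml.
    rewrite exchange_big; apply: eq_bigr => i _; rewrite mulr_sumr.
    by apply: eq_bigr => l _; rewrite mulrA.
  transitivity (\sum_i iota ((u j).1 0 i) * \sum_l iota (J i l) * delta l).
    rewrite -sw; apply: eq_bigr => l _; congr (_ * _); rewrite (rmorph_sum (@mpolyC N.+1 k)) rmorph_sum.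
    by apply: eq_bigr => i _; rewrite /= mpolyCM rmorphM.
  transitivity (\sum_i iota ((u j).1 0 i) * \sum_l (iota (J i l) - g i l) * delta l).
    apply: eq_bigr => i _; congr (_ * _); under [RHS]eq_bigr => l _ do rewrite mulrBl.
    by rewrite sumrB (hg i).2 subr0.
  by rewrite -sw; apply: eq_bigr => l _; rewrite !mxE.
(* (1 - E) D = tau B with E of value 0, so the determinant trick gives tau | D. *)
have h1E i j : has_val rho q ((1%:M - E) i j) ((1%:M : 'M[k]_N.+1) i j).
  rewrite mxE [X in has_val _ _ (_ + X)]mxE -[X in has_val _ _ _ X]subr0; apply: has_valB => //.
  by rewrite !mxE; case: eqP => _; [exact: has_val1 | exact: has_val0].
have hdet : has_val rho q (\det (1%:M - E)) 1.
  by rewrite -(det1 k N.+1); apply: has_val_det.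
have det0 := has_val_neq0 rho0 Xq hdet (oner_neq0 _).
have hadj i j : regular_elt rho q ((\adj (1%:M - E)) i j).
  rewrite mxE /cofactor; exists ((-1) ^+ (j + i) * \det (row' j (col' i (1%:M : 'M[k]_N.+1)))).
  apply: has_valM; first by apply: has_valX => //; apply: has_valN => //; apply: has_val1.
  by apply: has_val_det => // a b; rewrite !mxE; have := h1E (lift j a) (lift i b); rewrite !mxE.
have [v hv] : exists v, forall j, regular_elt rho q (v j) /\ delta j = tau * v j.
  apply: (choice (fun j vj => regular_elt rho q vj /\ delta j = tau * vj)) => j.
  exists ((\det (1%:M - E))^-1 * \sum_l (\adj (1%:M - E)) j l * B l 0); split.
    have inv : has_val rho q (\det (1%:M - E))^-1 1^-1 by apply: has_valV => //; apply: oner_neq0.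
    have [c hc] := choice _ (fun l => hadj j l).
    exists (1^-1 * \sum_l c l * (u l).2.2); apply: has_valM => //; apply: (has_val_sum rho0 Xq) => l _.
    by apply: has_valM => //; rewrite mxE; apply: has_val_const.
  have := congr1 (mulmx (\adj (1%:M - E))) ED; rewrite mulmxA mul_adj_mx mul_scalar_mx -scalemxAr.
  move/colP/(_ j); rewrite [LHS]mxE [D _ _]mxE [RHS]mxE [(_ *m B) j 0]mxE => Edet.
  by apply: (mulfI det0); rewrite Edet; field.
exists tau; split.
  have <- : \sum_l w 0 l * 0 = 0 by rewrite big1 // => l _; rewrite mulr0.
  apply: (has_val_sum rho0 Xq) => l _ /=; apply: has_valM; [exact: has_val_const | exact: has_val_delta].
move=> l [d [a [b [ha hb bq -> /esym/eqP]]]]; rewrite mulf_eq0 invr_eq0 (negPf bq) orbF => /eqP aq.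
have [f [hf Ef]] := taylor a.
exists ((\sum_j f j * v j) / chart b).
  have [c hc] := choice _ (fun j => (hv j).1).
  exists ((\sum_j evx q (a^`M(j)) * c j) / evx q b); apply: has_valM.
    by apply: (has_val_sum rho0 Xq) => j _; apply: has_valM.
  by apply: has_valV => //; apply: has_val_chart.
rewrite (chart_homog ha) (chart_homog hb) -mulf_div divff ?expf_neq0 ?chart_denom_neq0 // mulr1.
rewrite mulrA; congr (_ / _); rewrite Ef aq mpolyC0 rmorph0 add0r mulr_sumr.
by apply: eq_bigr => j _; rewrite (hv j).2 mulrCA.
Qed.

End Chart.

Lemma uniformizing_exists q : proj_variety X -> smooth_of_dim X 1 -> X q ->
  exists tau, uniformizing rho q tau.
Proof.
move=> varX [m [F [[hF _] rJ]]] Xq.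
have [h qh] : exists h, q 0 h != 0.
  apply: not_all_not_ex => hq; case/eqP: (point_neq0 varX Xq); apply/rowP => i; rewrite mxE.
  by apply/eqP/negPn/negP/hq.
have qh0 : (q 0 h)^-1 != 0 by rewrite invr_eq0.
have Xq' := cone varX Xq qh0.
have [tau htau] : exists tau, uniformizing rho ((q 0 h)^-1 *: q) tau.
  by apply: (@uniformizing_chart _ h Xq' _ m F hF (rJ _ Xq')); rewrite mxE mulVf.
exists tau; apply: uniformizing_same_point htau => //.
by exists (q 0 h) => //; rewrite scalerA mulfV // scale1r.
Qed.

End Jacobian.

(** * The pole filtration of a pointed curve *)

Section FunctionField.
Variables (k : closedFieldType) (N : nat) (X : 'rV[k]_N.+1 -> Prop).
Local Notation T := {mpoly k[N.+1]}.
Variables (L : fieldType) (rho : {rmorphism T -> L}).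
Hypothesis rho0 : forall a, rho a = 0 <-> vanishes_on X a.

Definition frac (phi : T * T) : L := rho phi.1 / rho phi.2.

Lemma rational_denom phi : rational_function X phi -> rho phi.2 != 0.
Proof. by case=> _ nv; apply/eqP => /rho0. Qed.

Lemma eq_rationalE phi psi : rho phi.2 != 0 -> rho psi.2 != 0 ->
  eq_rational X phi psi <-> frac phi = frac psi.
Proof.
move=> h1 h2; rewrite /eq_rational /frac -rho0 rmorphB !rmorphM /=.
split=> [/eqP|/eqP]; first by rewrite subr_eq0 -eqr_div // => /eqP.
by rewrite eqr_div // -subr_eq0 => /eqP.
Qed.

Lemma frac_mul phi psi : frac (mul_rational phi psi) = frac phi * frac psi.
Proof. by rewrite /frac /mul_rational /= !rmorphM mulf_div. Qed.

Lemma frac_exp phi n : frac (exp_rational phi n) = frac phi ^+ n.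
Proof. by rewrite /frac /exp_rational /= !rmorphXn expr_div_n. Qed.

Section Point.
Variables (q : 'rV[k]_N.+1) (phi : T * T).
Hypotheses (Xq : X q) (phi2 : rho phi.2 != 0).

Lemma defined_by_val psi : defined_by X q phi psi ->
  has_val rho q (frac phi) (ev psi.1 q / ev psi.2 q).
Proof.
case=> rat eqr p2; have [[d [h1 h2]] _] := rat.
have /(_ phi2 (rational_denom rat)) := eq_rationalE (phi := phi) (psi := psi).
by case=> /(_ eqr) -> _; exists d, psi.1, psi.2; rewrite -!evxE.
Qed.

Lemma val_defined_by c : has_val rho q (frac phi) c ->
  exists2 psi, defined_by X q phi psi & c = ev psi.1 q / ev psi.2 q.
Proof.
case=> d [a [b [ha hb bq E ->]]]; have rb := rho_neq0 rho0 Xq bq.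
exists (a, b); last by rewrite !evxE.
split; rewrite /= ?evxE //; last by apply/eq_rationalE.
by split; [exists d | move/rho0/eqP; apply/negP].
Qed.

Lemma regular_atE : regular_at X q phi <-> regular_elt rho q (frac phi).
Proof.
split=> [[psi /defined_by_val h]|[c /val_defined_by[psi h _]]]; last by exists psi.
by eexists; apply: h.
Qed.

Lemma zero_atE : zero_at X q phi <-> has_val rho q (frac phi) 0.
Proof.
split=> [[psi /defined_by_val h p0]|/val_defined_by[psi h]].
  by move: h; rewrite p0 mul0r.
case: (h) => _ _ p2 /esym/eqP; rewrite mulf_eq0 invr_eq0 (negPf p2) orbF => /eqP.
by exists psi.
Qed.

Lemma unit_atE : unit_at X q phi <-> unit_elt rho q (frac phi).
Proof.
split=> [[psi h p0]|[c c0 /val_defined_by[psi h E]]].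
  have [_ _ p2] := h; eexists; last exact: defined_by_val h.
  by rewrite mulf_neq0 ?invr_eq0.
by exists psi => //; apply: contra_neq c0 => p0; rewrite E p0 mul0r.
Qed.

End Point.

Lemma uniformizer_uniformizing q tau : X q -> uniformizer X q tau ->
  uniformizing rho q (frac tau).
Proof.
move=> Xq [rat z gen]; have rt := rational_denom rat.
split; first by apply/zero_atE.
move=> l hl; have [d [a [b [ha hb bq lE _]]]] := hl; have rb := rho_neq0 rho0 Xq bq.
have rab : rational_function X (a, b) by split; [exists d | move/rho0/eqP; apply/negP].
have [|psi [rpsi reg /eq_rationalE E]] := gen (a, b) rab; first by apply/zero_atE => //; rewrite /frac -lE.
have r2 := rational_denom rpsi.
exists (frac psi); first by apply/regular_atE.
by rewrite -frac_mul -E //= ?rmorphM ?mulf_neq0.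
Qed.

Hypotheses (varX : proj_variety X) (smoothX : smooth_of_dim X 1).
Variables (p : 'rV[k]_N.+1) (tau : T * T).
Hypotheses (Xp : X p) (uni : uniformizer X p tau).
Let t := frac tau.
Hypothesis t0 : t != 0.

Let tU : uniformizing rho p t := uniformizer_uniformizing Xp uni.

Definition pole_bound (n : nat) (l : L) : Prop :=
  (forall q, X q -> ~ same_point p q -> regular_elt rho q l) /\ regular_elt rho p (l * t ^+ n).

Definition lead_coeff (n : nat) (l : L) : k := epsilon (inhabits 0) (has_val rho p (l * t ^+ n)).

Lemma lead_coeffE n l c : has_val rho p (l * t ^+ n) c -> lead_coeff n l = c.
Proof.
move=> h; apply: (has_val_fun rho0 Xp _ h).
by apply: (epsilon_spec (inhabits 0) (has_val rho p (l * t ^+ n))); exists c.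
Qed.

Lemma lead_coeff_val n l : pole_bound n l -> has_val rho p (l * t ^+ n) (lead_coeff n l).
Proof. by case=> _ [c h]; rewrite (lead_coeffE h). Qed.

Let const : {rmorphism k -> L} := (rho \o @mpolyC N.+1 k : {rmorphism k -> L}).

Lemma has_val_linear q c f g a b : X q -> has_val rho q f a -> has_val rho q g b ->
  has_val rho q (const c * f + g) (c * a + b).
Proof.
by move=> Xq ha hb; apply: (has_valD rho0 Xq) => //; apply: has_valM => //; apply: has_val_const.
Qed.

Lemma pole_bound1 : pole_bound 0 1.
Proof. by split=> [q Xq _|]; rewrite ?mulr1; exists 1; apply: has_val1. Qed.

Lemma linear_pow n c f g : (const c * f + g) * t ^+ n = const c * (f * t ^+ n) + g * t ^+ n.
Proof. by rewrite mulrDl mulrA. Qed.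

Lemma pole_boundP n c f g : pole_bound n f -> pole_bound n g -> pole_bound n (const c * f + g).
Proof.
move=> [hf [a ha]] [hg [b hb]]; split=> [q Xq nq|].
  have [a' ha'] := hf q Xq nq; have [b' hb'] := hg q Xq nq.
  by exists (c * a' + b'); apply: has_val_linear.
by rewrite linear_pow; exists (c * a + b); apply: has_val_linear.
Qed.

Lemma mul_pow n m (f g : L) : f * g * t ^+ (n + m) = (f * t ^+ n) * (g * t ^+ m).
Proof. by rewrite exprD mulrACA. Qed.

Lemma pole_boundM n m f g : pole_bound n f -> pole_bound m g -> pole_bound (n + m) (f * g).
Proof.
move=> [hf rf] [hg rg]; split=> [q Xq nq|]; last by rewrite mul_pow; apply: regular_eltM.
by apply: regular_eltM; [apply: hf | apply: hg].
Qed.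

Lemma lead_coeff1 : lead_coeff 0 1 = 1.
Proof. by apply: lead_coeffE; rewrite mulr1; apply: has_val1. Qed.

Lemma lead_coeffP n c f g : pole_bound n f -> pole_bound n g ->
  lead_coeff n (const c * f + g) = c * lead_coeff n f + lead_coeff n g.
Proof.
by move=> hf hg; apply: lead_coeffE; rewrite linear_pow; apply: has_val_linear => //; apply: lead_coeff_val.
Qed.

Lemma lead_coeffM n m f g : pole_bound n f -> pole_bound m g ->
  lead_coeff (n + m) (f * g) = lead_coeff n f * lead_coeff m g.
Proof.
by move=> hf hg; apply: lead_coeffE; rewrite mul_pow; apply: has_valM; apply: lead_coeff_val.
Qed.

Lemma pole_boundS n f : pole_bound n f -> pole_bound n.+1 f /\ lead_coeff n.+1 f = 0.
Proof.
move=> [hf [c hc]]; have h : has_val rho p (f * t ^+ n.+1) 0.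
  by rewrite exprSr mulrA -(mulr0 c); apply: has_valM => //; exact: tU.1.
by split; [split=> //; exists 0 | exact: lead_coeffE].
Qed.

Lemma lead_coeff_eq0 n f : pole_bound n.+1 f -> lead_coeff n.+1 f = 0 -> pole_bound n f.
Proof.
move=> hf l0; have := lead_coeff_val hf; rewrite l0 => /tU.2[u ru E].
split; first exact: hf.1.
by have -> : f * t ^+ n = u by apply: (mulfI t0); rewrite -E exprSr; ring.
Qed.

(** Such an [f] is regular on all of [X], hence constant, and the constant is its value at [p]. *)
Lemma lead_coeff0_eq0 f : pole_bound 0 f -> lead_coeff 0 f = 0 -> f = 0.
Proof.
move=> hf l0; have := lead_coeff_val hf; rewrite l0 mulr1 => h0.
have [c E] : exists c, f = rho c%:MP.
  apply: (regular_everywhere rho0 varX) => q Xq.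
  have [pq|npq] := classic (same_point p q); last exact: hf.1.
  by exists 0; apply: has_val_same_point pq h0.
have c0 : 0 = c by apply: (has_val_fun rho0 Xp h0); rewrite E; apply: has_val_const.
by rewrite E -c0 mpolyC0 rmorph0.
Qed.

(** [pole_order] comes with a uniformizer of its own, which differs from the fixed [tau] by a unit
    at [p]. *)
Lemma pole_order_bound phi n : rational_function X phi -> regular_away_from X p phi ->
  pole_order X p phi n -> pole_bound n (frac phi) /\ lead_coeff n (frac phi) != 0.
Proof.
move=> rat reg [tau' uni' un].
have r2 := rational_denom rat; have [rat' _ _] := uni'; have r2' := rational_denom rat'.
have /unit_atE := un => /(_ Xp); rewrite /= rmorphM rmorphXn mulf_neq0 ?expf_neq0 // => /(_ isT).
rewrite frac_mul frac_exp => U.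
have [z' gen'] := uniformizer_uniformizing Xp uni'.
have [u' [c' hu'] tE] := gen' t tU.1; have [u [c hu] t'E] := tU.2 _ z'.
have uu : u * u' = 1 by apply: (mulfI t0); rewrite mulrA -t'E -tE mulr1.
have cc : c * c' = 1.
  by apply: (has_val_fun rho0 Xp (has_valM hu hu')); rewrite uu; apply: has_val1.
have c0 : c' != 0 by apply: contra_eq_neq cc => ->; rewrite mulr0 eq_sym oner_neq0.
have [a a0 ha] : unit_elt rho p (frac phi * t ^+ n).
  by rewrite tE exprMn mulrA; apply: unit_eltM => //; apply: unit_eltX => //; exists c'.
split; last by rewrite (lead_coeffE ha).
split; last by exists a.
by move=> q Xq nq; apply/regular_atE => //; apply: reg.
Qed.

Lemma pole_bound_order f n : pole_bound n f -> lead_coeff n f != 0 ->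
  exists phi, [/\ rational_function X phi, regular_away_from X p phi & pole_order X p phi n].
Proof.
move=> hf l0; have hv := lead_coeff_val hf.
have [rat _ _] := uni; have [[d0 [h1 h2]] _] := rat; have r2 := rational_denom rat.
have [d [a [b [ha hb bp E _]]]] := hv; have rb := rho_neq0 rho0 Xp bp.
have r1 : rho tau.1 != 0 by apply: contra_neq t0 => e; rewrite /t /frac e mul0r.
pose phi := (a * tau.2 ^+ n, b * tau.1 ^+ n).
have rphi : rho phi.2 != 0 by rewrite rmorphM rmorphXn mulf_neq0 ?expf_neq0.
have fphi : frac phi = f.
  apply: (mulIf (expf_neq0 n t0)); rewrite E /frac /t /frac /= !rmorphM !rmorphXn /= expr_div_n; field.
  by rewrite rb !expf_neq0.
exists phi; split.
- split; last by move/rho0/eqP; apply/negP.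
  by exists (d + d0 * n)%N; rewrite !dhomogM // ?dhomogMn.
- by move=> q Xq nq; apply/regular_atE => //; rewrite fphi; apply: hf.1.
- exists tau => //; apply/unit_atE => //; first by rewrite /= rmorphM rmorphXn mulf_neq0 ?expf_neq0.
  by rewrite frac_mul frac_exp fphi; exists (lead_coeff n f).
Qed.

(** Orders with respect to the parameter [s]: [g] has order [i] and [g * f] has order [j]. If [f]
    had the negative order j - i, then [g * f ^+ i.+1] would have order at most i - (i + 1), so it
    would not be regular. *)
Lemma regular_of_almost_integral q f g : X q -> g != 0 ->
  (forall j, regular_elt rho q (g * f ^+ j)) -> regular_elt rho q f.
Proof.
move=> Xq g0 h; have [->|f0] := eqVneq f 0; first by exists 0; apply: has_val0.
have [s sU] := uniformizing_exists rho0 varX smoothX Xq.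
have := h 0%N; rewrite mulr1 => rg; have := h 1%N; rewrite expr1 => rgf.
have [i [u [Uu gE]]] := order_factorization rho0 Xq sU rg g0.
have [j [v [Uv gfE]]] := order_factorization rho0 Xq sU rgf (mulf_neq0 g0 f0).
have u0 := unit_elt_neq0 rho0 Xq Uu; have v0 := unit_elt_neq0 rho0 Xq Uv.
have rs : regular_elt rho q s by exists 0; exact: sU.1.
have rsX m : regular_elt rho q (s ^+ m) by case: rs => c hc; exists (c ^+ m); apply: has_valX.
have [ij|ji] := leqP i j.
  have si : s ^+ i != 0 by apply: contra_neq g0 => e; rewrite gE e mul0r.
  have -> : f = s ^+ (j - i) * (v * u^-1).
    apply: (mulfI g0); rewrite gfE gE -{1}(subnK ij) exprD; field.
    by [].
  by apply: regular_eltM => //; apply: unit_regular; apply: unit_eltM => //; apply: unit_eltV.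
have sj : s ^+ j != 0 by apply: contra_neq (mulf_neq0 g0 f0) => e; rewrite gfE e mul0r.
have si : s ^+ i != 0 by apply: contra_neq g0 => e; rewrite gE e mul0r.
have fs : f * s ^+ (i - j) = v * u^-1.
  apply: (mulfI sj); rewrite mulrCA -exprD subnKC 1?ltnW //.
  have fg : f * s ^+ i * u = g * f by rewrite gE; ring.
  by apply: (mulIf u0); rewrite fg gfE; field.
have Uw : unit_elt rho q (v * u^-1) by apply: unit_eltM => //; apply: unit_eltV.
have [c hc] := h i.+1; have [w w0 hw] := unit_eltX i.+1 Uw.
have : has_val rho q (u * (v * u^-1) ^+ i.+1) 0.
  have [a ha] := rsX ((i - j) * i.+1 - i.+1)%N.
  suff -> : u * (v * u^-1) ^+ i.+1 = g * f ^+ i.+1 * (s ^+ ((i - j) * i.+1 - i.+1) * s).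
    by rewrite -(mulr0 c) -(mulr0 a); do 2 ?apply: has_valM => //; exact: sU.1.
  rewrite -fs gE exprMn -exprM.
  rewrite -[X in _ * (_ * s ^+ X)](subnK (_ : i.+1 <= (i - j) * i.+1)%N); last by rewrite leq_pmull // subn_gt0.
  by rewrite exprD [s ^+ i.+1]exprS; ring.
have [b b0 hb] := Uu => hz.
have := has_val_fun rho0 Xq hz (has_valM hb hw) => /esym/eqP.
by rewrite mulf_eq0 (negPf b0) (negPf w0).
Qed.

(** Away from [p] the preceding lemma applies. At [p] any bound will do, and the quotient of [g * f]
    by [g] has one because [g] has a finite order there. *)
Lemma pole_bound_normal f g : g != 0 -> (forall j, exists n, pole_bound n (g * f ^+ j)) ->
  exists n, pole_bound n f.
Proof.
move=> g0 h; have [f_0|f0] := eqVneq f 0.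
  by exists 0%N; rewrite f_0; split=> [q Xq _|]; rewrite ?mul0r; exists 0; apply: has_val0.
have [n0 [_ b0]] := h 0%N; have [n1 [_ b1]] := h 1%N; rewrite mulr1 in b0; rewrite expr1 in b1.
have [i [u [Uu E]]] := order_factorization rho0 Xp tU b0 (mulf_neq0 g0 (expf_neq0 n0 t0)).
exists (n1 + i)%N; split=> [q Xq nq|].
  by apply: (regular_of_almost_integral Xq g0) => j; have [n [hn _]] := h j; apply: hn.
have -> : f * t ^+ (n1 + i) = (g * f * t ^+ n1) * (t ^+ n0 * u^-1).
  have u0 := unit_elt_neq0 rho0 Xp Uu.
  by apply: (mulIf u0); rewrite exprD -!mulrA [t ^+ i * u in LHS](_ : _ = g * t ^+ n0) //; field.
apply: regular_eltM => //; apply: regular_eltM; last by apply: unit_regular; apply: unit_eltV.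
by exists (0 ^+ n0); apply: has_valX => //; exact: tU.1.
Qed.

End FunctionField.

Theorem theorem2p9 (k : closedFieldType) (S : pred nat)
    (hS : numerical_semigroup S) (hspecial : special_semigroup k S) :
  ~ weierstrass_semigroup k S.
Proof.
move=> [N [X [p [[varX _ smoothX] Xp Sp]]]].
have [L [rho rho0]] := prime_fraction_field (vanishes_prime varX).
have [_ _ [c hc]] := hS.
have [phi [rat reg [tau uni un]]] := (Sp c.+1).1 (hc _ (leqnSn c)).
have [rat' _ _] := uni.
(* Here a pole of positive order enters: the product with the power [c.+1] of [tau] is a unit, hence
   nonzero. *)
have t0 : frac rho tau != 0.
  have r2 := rational_denom rho0 rat; have r2' := rational_denom rho0 rat'.
  have /(unit_atE rho0 Xp) := un; rewrite /= rmorphM rmorphXn mulf_neq0 ?expf_neq0 // => /(_ isT).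
  move/(unit_elt_neq0 rho0 Xp); rewrite frac_mul frac_exp.
  by apply: contra_neq => ->; rewrite expr0n mulr0.
apply: (special_not_filtered hS hspecial).
apply: (@PoleFiltration k S L (rho \o @mpolyC N.+1 k : {rmorphism k -> L})
  (pole_bound X rho p tau) (lead_coeff rho p tau)).
- exact: pole_bound1.
- by move=> n a f g; apply: pole_boundP.
- by move=> n m f g; apply: pole_boundM.
- exact: lead_coeff1.
- by move=> n a f g; apply: lead_coeffP.
- by move=> n m f g; apply: lead_coeffM.
- by move=> n f; apply: pole_boundS.
- by move=> n f; apply: lead_coeff_eq0.
- by move=> f; apply: lead_coeff0_eq0.
- move=> n; split=> [/Sp[psi [h1 h2 h3]]|[f h1 h2]].
    by have [b1 b2] := pole_order_bound rho0 Xp uni t0 h1 h2 h3; exists (frac rho psi).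
  by apply/Sp; apply: (pole_bound_order rho0 Xp uni t0 h1 h2).
- by move=> f g; apply: pole_bound_normal.
Qed.
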